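(* Let $G$ be a compact Abelian topological group. The following conditions are equivalent: (a) $G$ is a torus group (both in the topological and the algebraic sense), i.e. there are a cardinal $\kappa$ and an isomorphism of topological groups $G \cong \mathbb{T}^{\kappa}$. (b) $G$ is an $AE(1)$-compactum. (c) The map $\exp_{G} \colon L(G) \to G$ is $0$-soft.
   Context: All spaces are Tychonov (completely regular and Hausdorff) and all maps are continuous. $\mathbb{T} = \mathbb{R}/\mathbb{Z}$ is the circle group; torus groups are powers $\mathbb{T}^{\kappa}$ of the circle group, $\kappa$ an arbitrary cardinal (with the product topology). A compactum is a compact Hausdorff space; $\dim$ is the Lebesgue covering dimension (for Tychonov spaces, defined via finite functionally open covers). A compactum $X$ is an $AE(1)$-compactum if every map $g_{0} \colon Z_{0} \to X$ defined on a closed subspace $Z_{0}$ of a compactum $Z$ with $\dim Z \leq 1$ admits an extension $g \colon Z \to X$. $L(G) = \operatorname{Hom}(\mathbb{R}, G)$ is the group of all continuous homomorphisms $\mathbb{R} \to G$ with the topology of uniform convergence on compact sets (it is a real topological vector space), and $\exp_{G} \colon L(G) \to G$ is the continuous homomorphism $\exp_{G}(f) = f(1)$. A map $f \colon X \to Y$ of Tychonov spaces is $0$-soft if for every Tychonov space $Z$ with $\dim Z \leq 0$, every closed subspace $Z_{0} \subseteq Z$ and any two maps $g_{0} \colon Z_{0} \to X$ and $h \colon Z \to Y$ such that $f g_{0} = h|Z_{0}$ and such that for every continuous function $\varphi \colon X \to \mathbb{R}$ the composition $\varphi g_{0}$ extends to a continuous real-valued function on $Z$, there exists a map $g \colon Z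 \to X$ with $g|Z_{0} = g_{0}$ and $f g = h$. (If $X$ is compact and $Z$ is compact, the condition on extending the $\varphi g_{0}$ is automatic.) *)

(* Defs.v *)
From HB Require Import structures.
From mathcomp Require Import all_boot all_order all_algebra.
From mathcomp Require Import all_classical all_reals all_analysis.

Set Implicit Arguments.
Unset Strict Implicit.
Unset Printing Implicit Defensive.

Import Order.TTheory GRing.Theory Num.Theory.
Import numFieldNormedType.Exports.

Local Open Scope classical_set_scope.
Local Open Scope ring_scope.

Definition tychonov (X : topologicalType) : Prop :=
  completely_regular_space X /\ hausdorff_space X.

Definition compactum (X : topologicalType) : Prop :=
  compact [set: X] /\ hausdorff_space X.

Definition functionally_open (R : realType) (X : topologicalType)
    (U : set X) : Prop :=
  exists2 phi : X -> R, continuous phi & U = [set x | phi x != 0].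

Definition finite_functionally_open_cover (R : realType)
    (X : topologicalType) (U : set (set X)) : Prop :=
  [/\ finite_set U, (forall A, U A -> functionally_open R A)
    & \bigcup_(A in U) A = [set: X]].

Definition refines (X : Type) (V U : set (set X)) : Prop :=
  forall B, V B -> exists2 A, U A & B `<=` A.

(* The order is at most [n]: any [n + 2] pairwise distinct members have empty
   intersection, so disjoint families have order at most [0]. *)
Definition order_le (n : nat) (X : Type) (V : set (set X)) : Prop :=
  forall B : 'I_n.+2 -> set X, injective B -> (forall i, V (B i)) ->
    \bigcap_(i in [set: 'I_n.+2]) B i = set0.

Definition dim_le (R : realType) (n : nat) (X : topologicalType) : Prop :=
  forall U : set (set X), finite_functionally_open_cover R U ->
    exists V : set (set X),
      [/\ finite_functionally_open_cover R V, refines V U & order_le n V].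

(* A map on a subspace [Z0] of [Z] is a function on the type [set_type Z0]
   (to which [Z0] coerces), with its initial topology. *)
Definition AE1_compactum (R : realType) (X : topologicalType) : Prop :=
  compactum X /\
  forall Z : topologicalType, compactum Z -> dim_le R 1 Z ->
  forall (Z0 : set Z), closed Z0 ->
  forall g0 : Z0 -> X, continuous g0 ->
  exists2 g : Z -> X, continuous g & forall z : Z0, g (\val z) = g0 z.

Definition zero_soft (R : realType) (X Y : topologicalType) (f : X -> Y) :
    Prop :=
  forall Z : topologicalType, tychonov Z -> dim_le R 0 Z ->
  forall (Z0 : set Z), closed Z0 ->
  forall (g0 : Z0 -> X) (h : Z -> Y), continuous g0 -> continuous h ->
  (forall z : Z0, f (g0 z) = h (\val z)) ->
  (forall phi : X -> R, continuous phi ->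
    exists2 psi : Z -> R, continuous psi &
      forall z : Z0, psi (\val z) = phi (g0 z)) ->
  exists g : Z -> X,
    [/\ continuous g, (forall z : Z0, g (\val z) = g0 z)
      & forall z : Z, f (g z) = h z].

Definition circle_integers (R : realType) : zmodClosed R :=
  GRing.ZmodClosed.clone R (@Num.int_num_subdef R) _.

Lemma circle_integersE (R : realType) (x : R) :
  (x \in circle_integers R) = (x \is a Num.int).
Proof. by []. Qed.

Definition circle (R : realType) : Type :=
  Quotient.quot (circle_integers R).

HB.instance Definition _ (R : realType) :=
  GRing.Zmodule.copy (circle R) (Quotient.quot (circle_integers R)).

(* The quotient topology. [quotient_topology] itself is not copied, because it
   carries its own choice structure, which is not that of the quotient group. *)
HB.instance Definition _ (R : realType) :=
  @isOpenTopological.Build (circle R)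
    (@quotient_open R (Quotient.quot (circle_integers R)))
    (@openT (quotient_topology (Quotient.quot (circle_integers R))))
    (@openI (quotient_topology (Quotient.quot (circle_integers R))))
    (fun I f fo =>
       @bigcup_open (quotient_topology (Quotient.quot (circle_integers R)))
         I setT f (fun i _ => fo i)).

Section circle_topology.
Variable R : realType.

Let pr (x : R) : circle R := (\pi_(Quotient.quot (circle_integers R)) x)%qT.

Let prB (x y : R) : pr (x - y) = pr x - pr y.
Proof. exact: (raddfB (\pi_(Quotient.quot (circle_integers R)))%qT). Qed.

Let pr_continuous : continuous pr.
Proof. exact/continuousP. Qed.

Let pr_surj (a : circle R) : exists x, pr x = a.
Proof. by exists (repr (a : Quotient.quot _)); exact: reprK. Qed.

Let pr_eq (x y : R) : pr x = pr y <-> exists k : int, x - y = k%:~R.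
Proof.
have E := Quotient.idealrBE (circle_integers R) x y.
split => [xy|/intrP xy]; last by apply/eqP; rewrite -E.
by apply/intrP; rewrite -circle_integersE E; apply/eqP.
Qed.

Let pr_open (U : set R) : open U -> open (pr @` U).
Proof.
move=> oU; rewrite /open/= /quotient_open.
rewrite [X in open X](_ : _ = \bigcup_(k in [set: int])
    ((fun x => x + k%:~R) @^-1` U)).
  apply: bigcup_open => k _; apply: open_comp => // x _.
  by apply: cvgD; [exact: cvg_id|exact: cvg_cst].
apply/seteqP; split => [x [y Uy /esym /pr_eq [k xyE]]|x [k _ /= Uk]].
  exists (- k) => //=; rewrite rmorphN /= -xyE opprB addrC subrK//.
exists (x + k%:~R) => //; apply/pr_eq; exists k.
by rewrite addrAC subrr add0r.
Qed.

Let circle_sub_continuous :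
  continuous (fun x : circle R * circle R => x.1 - x.2).
Proof.
move=> [a b] U /= nU.
have [x xa] := pr_surj a; have [y yb] := pr_surj b.
have nx (c : circle R) (z : R) V : pr z = c -> nbhs z V -> nbhs c (pr @` V).
  move=> <-; rewrite nbhsE => -[W [oW Wz] WV].
  apply: (@filterS _ _ _ (pr @` W)); first exact: image_subset.
  by apply: open_nbhs_nbhs; split; [exact: pr_open|exists z].
have := @sub_continuous R (x, y) (pr @^-1` U).
rewrite /= /nbhs/=; case.
  by apply: pr_continuous; rewrite prB xa yb.
move=> [A B] /= [nA nB] AB.
exists (pr @` A, pr @` B) => /=; first by split; [exact: nx nA|exact: nx nB].
move=> [_ _] /= [[s As <-] [t Bt <-]].
by rewrite -prB; exact: (AB (s, t)).
Qed.

HB.instance Definition _ :=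
  PreTopologicalNmodule_isTopologicalZmodule.Build (circle R)
    circle_sub_continuous.

End circle_topology.

Definition torus (R : realType) (kappa : Type) : Type :=
  {ptws kappa -> circle R}.

HB.instance Definition _ (R : realType) (kappa : Type) :=
  Topological.on (torus R kappa).
HB.instance Definition _ (R : realType) (kappa : Type) :=
  GRing.Zmodule.copy (torus R kappa) (kappa -> circle R).

Section torus_topology.
Variables (R : realType) (kappa : Type).

Let torus_sub_continuous :
  continuous (fun x : torus R kappa * torus R kappa => x.1 - x.2).
Proof.
have proj_cts (i : kappa) : continuous (fun u : torus R kappa => u i).
  exact: (@proj_continuous {classic kappa} (fun=> circle R) i).
move=> x; apply/cvg_sup => i; move: x.
apply/(@continuousP _ (initial_topology (fun u : torus R kappa => u i))).
move=> A [B oB <-]; rewrite -comp_preimage.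
move: B oB; apply/continuousP => -[u v] /=.
apply: (@cvg_comp _ _ _
  (fun x : torus R kappa * torus R kappa => (x.1 i, x.2 i))
  (fun x : circle R * circle R => x.1 - x.2) _ (nbhs (u i, v i))).
  apply: (@cvg_pair _ _ _ (nbhs (u, v)) (nbhs (u i)) (nbhs (v i))).
    apply: (@cvg_comp _ _ _ fst (fun w : torus R kappa => w i) _ (nbhs u)).
      exact: cvg_fst.
    exact: proj_cts.
  apply: (@cvg_comp _ _ _ snd (fun w : torus R kappa => w i) _ (nbhs v)).
    exact: cvg_snd.
  exact: proj_cts.
exact: (@sub_continuous (circle R) (u i, v i)).
Qed.

HB.instance Definition _ :=
  PreTopologicalNmodule_isTopologicalZmodule.Build (torus R kappa)
    torus_sub_continuous.

End torus_topology.

Definition topgroup_isomorphic (G H : topologicalZmodType) : Prop :=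
  exists (f : G -> H) (g : H -> G),
    [/\ {morph f : x y / x + y}, cancel f g, cancel g f,
        continuous f & continuous g].

Definition torus_group (R : realType) (G : topologicalZmodType) : Prop :=
  exists kappa : Type, topgroup_isomorphic G (torus R kappa).

(* [G] with the canonical uniformity of a topological abelian group: the
   entourages are generated by the sets of pairs with difference in a given
   neighborhood of [0]. *)
Definition group_uniform (G : topologicalZmodType) : Type := G.

HB.instance Definition _ (G : topologicalZmodType) :=
  TopologicalZmodule.on (group_uniform G).

Section group_uniformity.
Variable G : topologicalZmodType.
Local Open Scope relation_scope.

Definition group_entourage : set_system (group_uniform G * group_uniform G) :=
  [set E | exists2 U : set G, nbhs (0 : G) U &
    forall xy : G * G, U (xy.1 - xy.2) -> E xy].

Let group_entourage_filter : Filter group_entourage.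
Proof.
split.
- by exists setT => //; exact: filterT.
- move=> P Q [U nU UP] [V nV VQ]; exists (U `&` V); first exact: filterI.
  by move=> xy [/UP ? /VQ ?].
- by move=> P Q PQ [U nU UP]; exists U => // xy /UP /PQ.
Qed.

Let group_entourage_diagonal (E : set (group_uniform G * group_uniform G)) :
  group_entourage E -> diagonal `<=` E.
Proof.
move=> [U nU UE] xy; rewrite /diagonal/= => xyE.
by apply: UE; rewrite xyE subrr; exact: nbhs_singleton.
Qed.

Let group_entourage_inv (E : set (group_uniform G * group_uniform G)) :
  group_entourage E -> group_entourage E^-1.
Proof.
move=> [U nU UE]; exists (-%R @^-1` U).
  by apply: (@opp_continuous G); rewrite oppr0.
by move=> [x y] /=; rewrite opprB => /(UE (y, x)).
Qed.

Let group_entourage_split (E : set (group_uniform G * group_uniform G)) :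
  group_entourage E -> exists2 B, group_entourage B & B \; B `<=` E.
Proof.
move=> [U nU UE].
have := @add_continuous G (0, 0) U; rewrite /= addr0 => /(_ nU)[[V W]]/= [nV nW].
move=> VWU; exists [set xy | (V `&` W) (xy.1 - xy.2)].
  by exists (V `&` W) => //; exact: filterI.
move=> [x y] [z /= [Vxz _] [_ Wzy]]; apply: UE => /=.
by rewrite -(subrKA z); exact: (VWU (x - z, z - y)).
Qed.

Let group_nbhsE : nbhs = nbhs_ group_entourage.
Proof.
apply/funext => x; apply/seteqP; split => [P nP|P [E [U nU UE] EP]].
  exists [set xy | P (x - (xy.1 - xy.2))]; last first.
    by move=> y /xsectionP /=; rewrite opprB addrC subrK.
  exists [set z | P (x - z)] => //.
  have := @sub_continuous G (x, 0) P; rewrite /= subr0 => /(_ nP)[[V W]]/= [nV nW].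
  move=> VWP; apply: filterS nW => z Wz.
  by apply: (VWP (x, z)); split => //=; exact: nbhs_singleton.
have := @sub_continuous G (x, x) U; rewrite /= subrr => /(_ nU)[[V W]]/= [nV nW].
move=> VWU; apply: filterS nW => z Wz; apply/EP/xsectionP/UE => /=.
by apply: (VWU (x, z)); split => //=; exact: nbhs_singleton.
Qed.

HB.instance Definition _ := Nbhs_isUniform_mixin.Build (group_uniform G)
  group_entourage_filter group_entourage_diagonal group_entourage_inv
  group_entourage_split group_nbhsE.

End group_uniformity.

(* A [set_type], hence with the subspace topology of [{family compact, _ -> _}],
   the topology of uniform convergence on compact sets. *)
Definition L (R : realType) (G : topologicalZmodType) : Type :=
  [set f : {family compact, R -> group_uniform G} |
    {morph (f : R -> G) : s t / s + t} /\ continuous (f : R -> G)].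

HB.instance Definition _ (R : realType) (G : topologicalZmodType) :=
  Topological.on (L R G).

Definition expG (R : realType) (G : topologicalZmodType) (f : L R G) : G :=
  (\val f : R -> G) 1.

(* Main.v *)
Require Import Defs.
From mathcomp Require Import all_boot all_order all_algebra.
From mathcomp Require Import all_classical all_reals all_analysis.
From mathcomp Require Import ring lra zify.
From mathcomp Require wochoice.
From mathcomp.real_closed Require Import complex.

(** A torus has both extension properties, coordinate by coordinate. A map from a
    closed subset of a space of dimension at most one to the circle extends: the
    cover by three arcs, extended to the space, shrinks to a cover without triple
    intersection, whose barycentric coordinates give a map to the boundary of a
    triangle, close enough to the given one to be corrected by a real function
    ([circle_AE1]). Next, [L R G] is a product of lines, and [expG] reduces it
    modulo one: the lifting problem of softness is solved by extending real slopes
    and by taking logarithms of maps from spaces of dimension zero to the circle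
    ([torus_zero_soft]).

    Conversely, each extension property lifts a map from a zero-dimensional
    compactum to [G] to a continuous family of paths from zero, relatively to a
    closed subspace ([path_extension]). For an absolute extensor this is because
    the product with an interval has dimension at most one
    ([AE1_path_extension]); for softness the paths are one-parameter subgroups
    ([zero_soft_path_extension]). The rest of the argument shows that a compact
    abelian group [G] with this property is a torus ([torus_of_path_extension]).

    It suffices that the group of continuous characters of [G] be free: by the
    theorem of Peter and Weyl, evaluation on a basis is then an isomorphism to a
    torus. Now [G] is the image, by limits, of the space [Z0] of its ultrafilters,
    a closed subspace of a Cantor cube, to which the doubling of [G] lifts as a map
    [S]. A family of paths over [Z0] from zero to the limits provides every
    character [chi] with a continuous logarithm [l]. The defect [2 * l - l o S] is
    an integer function, the winding number of the image by [chi] of a family of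
    loops. This family extends from [Z0] to the whole cube, hence so does the
    defect, additively in [chi]. If the extension vanishes, then [l] doubles along
    [S], but it is bounded, so [l] and [chi] are zero. Therefore the characters
    embed into the continuous integer functions on a Cantor cube
    ([character_embedding]). Such functions are embedded into a free abelian group
    by their iterated differences at the origin ([mcoef_inj]), and a subgroup of a
    free abelian group is free ([free_subgroup]).

    The theorem of Peter and Weyl ([compact_character]) is derived from an
    invariant mean on the underlying discrete group, which replaces the Haar
    measure: an operator with kernel [psi (x + y)] is compact and symmetric, its
    square has finite-dimensional eigenspaces that are stable under translations,
    and a common eigenvector of the translations is a character. *)

Set Implicit Arguments.
Unset Strict Implicit.
Unset Printing Implicit Defensive.

Import Order.TTheory GRing.Theory Num.Theory.
Import numFieldNormedType.Exports.

Local Open Scope classical_set_scope.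
Local Open Scope ring_scope.

(** * Compactness and continuity *)

Lemma near_all_seq (I : Type) (F : set_system I) (FF : Filter F)
    (A : eqType) (s : seq A) (P : A -> I -> Prop) :
  (forall a, \forall i \near F, P a i) ->
  \forall i \near F, forall a, a \in s -> P a i.
Proof.
move=> h; elim: s => [|b s IH]; first by apply: nearW.
apply: filterS2 (h b) IH => i Pb Ps a; rewrite inE => /predU1P[->//|].
exact: Ps.
Qed.

(** A property that is locally uniform in [x] is uniform over a compact set; the
    general filter allows pairs of parameters to be chosen together. *)
Lemma compact_tube (X : topologicalType) (K : set X) (I : Type)
    (F : set_system I) (FF : Filter F) (P : I -> X -> Prop) : compact K ->
  (forall x, K x -> \forall x' \near x & i \near F, P i x') ->
  \forall i \near F, forall x, K x -> P i x.
Proof.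
by move=> /compact_near_coveringP cK h; apply: filterS (cK _ _ _ FF h) => i.
Qed.

Lemma compact_finite_cover (X : topologicalType) (K : set X) (I : eqType)
    (P : I -> X -> Prop) : compact K ->
  (forall x, K x -> exists i, \forall x' \near x, P i x') ->
  exists s : seq I, forall x, K x -> exists2 i, i \in s & P i x.
Proof.
move=> cK h; pose B (s : seq I) := [set t : seq I | {subset s <= t}].
have FF : Filter (filter_from [set: seq I] B).
  apply: filter_from_filter; first by exists [::].
  move=> s t _ _; exists (s ++ t) => // u su.
  by split => /= x xs; apply: su; rewrite mem_cat xs ?orbT.
have PF : ProperFilter (filter_from [set: seq I] B).
  by apply: filter_from_proper => p _; exists p.
pose Q (s : seq I) x := exists2 i : I, i \in s & P i x.
have /(@compact_tube X K _ _ FF Q cK) hs : forall x, K x ->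
    \forall z \near x & s \near filter_from [set: seq I] B, Q s z.
  move=> x Kx; have [i iP] := h x Kx.
  exists (P i, B [:: i]); first by split => //; exists [:: i].
  case=> z s; rewrite /setX /= => -[Pz is_]; exists i => //.
  by apply: is_; rewrite inE.
by have [s sP] := @filter_ex _ _ PF _ hs; exists s.
Qed.

Lemma fctD_continuous (X : topologicalType) (G : topologicalZmodType)
    (f g : X -> G) :
  continuous f -> continuous g -> continuous (fun x => f x + g x).
Proof.
move=> cf cg x; apply: (@cvg_comp _ _ _ (fun x => (f x, g x))
  (fun p : G * G => p.1 + p.2) _ (nbhs (f x, g x))); last first.
  exact: (@add_continuous G (_, _)).
by apply: (@cvg_pair _ _ _ (nbhs x) (nbhs (f x)) (nbhs (g x))); [exact: cf|exact: cg].
Qed.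

Lemma fctB_continuous (X : topologicalType) (G : topologicalZmodType)
    (f g : X -> G) :
  continuous f -> continuous g -> continuous (fun x => f x - g x).
Proof.
move=> cf cg x; apply: (@cvg_comp _ _ _ (fun x => (f x, g x))
  (fun p : G * G => p.1 - p.2) _ (nbhs (f x, g x))); last first.
  exact: (@sub_continuous G (_, _)).
by apply: (@cvg_pair _ _ _ (nbhs x) (nbhs (f x)) (nbhs (g x))); [exact: cf|exact: cg].
Qed.

(** * The circle group *)

Section Circle.
Variable R : realType.
Local Notation T := (circle R).

Definition pr (x : R) : T := (\pi_(Quotient.quot (circle_integers R)) x)%qT.

Lemma prB x y : pr (x - y) = pr x - pr y.
Proof. exact: (raddfB (\pi_(Quotient.quot (circle_integers R)))%qT). Qed.

Lemma pr0 : pr 0 = 0.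
Proof. by rewrite -(subrr 0) prB subrr. Qed.

Lemma prN x : pr (- x) = - pr x.
Proof. by rewrite -sub0r prB pr0 sub0r. Qed.

Lemma prD x y : pr (x + y) = pr x + pr y.
Proof. by rewrite -{1}(opprK y) prB prN opprK. Qed.

Lemma pr_eq x y : pr x = pr y <-> exists k : int, x - y = k%:~R.
Proof.
have E := Quotient.idealrBE (circle_integers R) x y.
split => [xy|/intrP xy]; last by apply/eqP; rewrite -E.
by apply/intrP; rewrite -circle_integersE E; apply/eqP.
Qed.

Lemma pr_int (k : int) : pr k%:~R = 0.
Proof. by rewrite -pr0; apply/pr_eq; exists k; rewrite subr0. Qed.

Lemma pr_eq0 x : pr x = 0 -> exists k : int, x = k%:~R.
Proof. by rewrite -pr0 => /pr_eq[k]; rewrite subr0; exists k. Qed.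

Lemma pr_continuous : continuous pr.
Proof. exact/continuousP. Qed.

Lemma pr_sum (I : Type) (r : seq I) (P : pred I) (F : I -> R) :
  pr (\sum_(i <- r | P i) F i) = \sum_(i <- r | P i) pr (F i).
Proof. exact: (big_morph pr prD pr0). Qed.

Lemma pr_mulrn x n : pr (x *+ n) = pr x *+ n.
Proof. by elim: n => [|n IH]; rewrite ?mulr0n ?pr0// !mulrS prD IH. Qed.

Lemma pr_mulrz x (k : int) : pr (x *~ k) = pr x *~ k.
Proof.
by case: k => n; rewrite ?NegzE ?mulrNz ?prN -!pmulrn pr_mulrn.
Qed.

Lemma pr_surj (a : T) : exists x, pr x = a.
Proof. by exists (repr (a : Quotient.quot _)); exact: reprK. Qed.

(** A choice of representatives in [[-1/2, 1/2)] that is additive on small classes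
    and continuous away from the half turn, so that lifting a path to the line
    becomes a finite computation. *)
Definition angle (a : T) : R :=
  let x := repr (a : Quotient.quot (circle_integers R)) in
  x - (Num.floor (x + 2^-1))%:~R.

Lemma angleK a : pr (angle a) = a.
Proof. by rewrite /angle prB pr_int subr0; exact: reprK. Qed.

Lemma angle_itv a : - 2^-1 <= angle a < 2^-1.
Proof.
rewrite /angle; set x := repr _.
have := floor_itv (x + 2^-1); rewrite intrD => /andP[h1 h2].
lra.
Qed.

Lemma angle_uniq a x : pr x = a -> - 2^-1 <= x < 2^-1 -> angle a = x.
Proof.
move=> xa /andP[x1 x2]; have /andP[s1 s2] := angle_itv a.
have /pr_eq[k kE] : pr (angle a) = pr x by rewrite angleK xa.
suff k0 : k = 0 by rewrite k0 /= in kE; lra.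
have h1 : (-1 : R) < k%:~R by lra.
have h2 : k%:~R < (1 : R) by lra.
have : -1 < k by rewrite -(ltr_int R).
have : k < 1 by rewrite -(ltr_int R).
lia.
Qed.

Lemma angle_pr x : - 2^-1 <= x < 2^-1 -> angle (pr x) = x.
Proof. exact: angle_uniq. Qed.

Lemma angle0 : angle 0 = 0.
Proof. by apply: angle_uniq; [exact: pr0|lra]. Qed.

Lemma angle_eq0 a : angle a = 0 -> a = 0.
Proof. by move=> a0; rewrite -(angleK a) a0 pr0. Qed.

Lemma angleD a b : `|angle a + angle b| < 2^-1 -> angle (a + b) = angle a + angle b.
Proof.
move=> ab; apply: angle_uniq; first by rewrite prD !angleK.
by move: ab; rewrite ltr_norml => /andP[/ltW-> ->].
Qed.

Lemma angleN a : `|angle a| < 2^-1 -> angle (- a) = - angle a.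
Proof.
move=> h; apply: angle_uniq; first by rewrite prN angleK.
by move: h; rewrite ltr_norml => /andP[h1 h2]; lra.
Qed.

Lemma norm_angle_le a : `|angle a| <= 2^-1.
Proof. by have := angle_itv a; rewrite ler_norml => /andP[-> /ltW->]. Qed.

Lemma norm_angle_min x : `|angle (pr x)| <= `|x|.
Proof.
have [h|h] := ltP `|x| 2^-1; last exact: (le_trans (norm_angle_le _)).
by rewrite angle_pr//; move: h; rewrite ltr_norml => /andP[/ltW-> ->].
Qed.

Lemma norm_angleN a : `|angle (- a)| = `|angle a|.
Proof.
have le b : `|angle (- b)| <= `|angle b|.
  by rewrite -{1}(angleK b) -prN -(normrN (angle b)) norm_angle_min.
by apply/eqP; rewrite eq_le le /= -{1}(opprK a) le.
Qed.

Lemma norm_angleD a b : `|angle (a + b)| <= `|angle a| + `|angle b|.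
Proof.
rewrite -{1}(angleK a) -{1}(angleK b) -prD.
exact: (le_trans (norm_angle_min _)) (ler_normD _ _).
Qed.

Lemma norm_angle_dist a b : `| `|angle a| - `|angle b| | <= `|angle (a - b)|.
Proof.
rewrite ler_norml; apply/andP; split.
  have := norm_angleD (b - a) a; rewrite subrK -(norm_angleN (b - a)) opprB; lra.
have := norm_angleD (a - b) b; rewrite subrK; lra.
Qed.

#[local] Instance circle_nbhs_filter (a : T) : Filter (nbhs a).
Proof. exact: nbhs_filter. Qed.

Lemma pr_open (U : set R) : open U -> open (pr @` U).
Proof.
move=> oU; rewrite /open/= /quotient_open.
rewrite [X in open X](_ : _ = \bigcup_(k in [set: int])
    ((fun x => x + k%:~R) @^-1` U)).
  apply: bigcup_open => k _; apply: open_comp => // x _.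
  by apply: cvgD; [exact: cvg_id|exact: cvg_cst].
apply/seteqP; split => [x [y Uy /esym /pr_eq [k xyE]]|x [k _ /= Uk]].
  exists (- k) => //=; rewrite rmorphN /= -xyE opprB addrC subrK//.
exists (x + k%:~R) => //; apply/pr_eq; exists k.
by rewrite addrAC subrr add0r.
Qed.

Lemma pr_nbhs x (U : set R) : nbhs x U -> nbhs (pr x) (pr @` U).
Proof.
rewrite nbhsE => -[W [oW Wx] WU].
apply: (@filterS _ _ _ (pr @` W)); first exact: image_subset.
by apply: open_nbhs_nbhs; split; [exact: pr_open|exists x].
Qed.

Lemma angle_near (a : T) (e : R) : 0 < e -> \forall b \near a, `|angle (b - a)| < e.
Proof.
move=> e0; have [x xa] := pr_surj a; rewrite -xa.
have /pr_nbhs : nbhs x (ball x e) by exact: nbhsx_ballx.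
apply: filterS => _ [y xy <-]; rewrite -prB.
by apply: le_lt_trans (norm_angle_min _) _; rewrite distrC.
Qed.

Lemma angle_continuous a : `|angle a| < 2^-1 -> {for a, continuous angle}.
Proof.
move=> ha; apply/(@cvgrPdist_lt _ _ _ (nbhs a)) => e e0.
pose d := Num.min e (2^-1 - `|angle a|).
have d0 : 0 < d by rewrite lt_min e0 subr_gt0.
apply: filterS (angle_near a d0) => b; rewrite lt_min => /andP[h1 h2].
have -> : angle b = angle a + angle (b - a).
  rewrite -angleD ?subrKC//; apply: le_lt_trans (ler_normD _ _) _; lra.
by rewrite opprD addNKr normrN.
Qed.

Lemma norm_angle_continuous : continuous (fun a : T => `|angle a|).
Proof.
move=> a; apply/(@cvgrPdist_lt _ _ _ (nbhs a)) => e e0.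
apply: filterS (angle_near a e0) => b; apply: le_lt_trans.
by rewrite -(norm_angleN (b - a)) opprB norm_angle_dist.
Qed.

Lemma nbhs_angle (a : T) (U : set T) : nbhs a U ->
  exists2 e : R, 0 < e & forall b, `|angle (b - a)| < e -> U b.
Proof.
have [x <-] := pr_surj a => nU.
have /nbhs_ballP[e e0 eU] : nbhs x (pr @^-1` U) by exact: pr_continuous.
exists e => // b bxe; rewrite -(subrK (pr x) b) -(angleK (b - pr x)) -prD.
by apply: eU; rewrite /ball/= opprD addrCA subrr addr0 normrN.
Qed.

Lemma cvg_circle (X : Type) (F : set_system X) (FF : Filter F) (f : X -> T)
    (a : T) : (forall e : R, 0 < e -> \forall x \near F, `|angle (f x - a)| < e) ->
  f @ F --> a.
Proof.
by move=> h U /nbhs_angle[e e0 eU]; apply: filterS (h e e0) => x; exact: eU.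
Qed.

Lemma circle_hausdorff : hausdorff_space T.
Proof.
move=> a b /= ab; apply/subr0_eq/angle_eq0/normr0_eq0/eqP.
rewrite -[_ == _]negbK; apply/negP => h.
pose e := `|angle (a - b)| / 2.
have e0 : 0 < e by rewrite divr_gt0// lt0r h normr_ge0.
have [c [/= ca cb]] := ab _ _ (angle_near a e0) (angle_near b e0).
have := norm_angleD (a - c) (c - b); rewrite addrA subrK -(norm_angleN (a - c)) opprB.
move: ca cb; rewrite /e; lra.
Qed.

Lemma circle_compact : compact [set: T].
Proof.
have -> : [set: T] = pr @` `[- 2^-1, 2^-1].
  apply/seteqP; split => // a _; exists (angle a); last exact: angleK.
  by have /andP[h1 h2] := angle_itv a; rewrite /= in_itv/= h1 ltW.
apply: continuous_compact; last exact: segment_compact.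
exact/continuous_subspaceT/pr_continuous.
Qed.

End Circle.
Arguments pr {R}.
Arguments angle {R}.

(** * Winding numbers *)

Section Winding.
Variable R : realType.
Local Notation T := (circle R).
Implicit Types (u v : R -> T).

Definition wstep (k : nat) u : R :=
  \sum_(0 <= i < 2 ^ k) angle (u (i.+1%:R / 2 ^+ k) - u (i%:R / 2 ^+ k)).

(** The bound is a quarter of a turn because two steps must add up to less than
    half a turn, where angles are additive. *)
Definition fine (k : nat) u := forall j, (k <= j)%N -> forall i,
  (i < 2 ^ j)%N -> `|angle (u (i.+1%:R / 2 ^+ j) - u (i%:R / 2 ^+ j))| < 4^-1.

(** The net change of angle along a path on [[0, 1]]: all the dyadic subdivisions
    that are fine enough for the path give the same sum. *)
Definition winding u : R := wstep (xget 0%N [set k | fine k u]) u.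

Lemma fineW k k' u : (k <= k')%N -> fine k u -> fine k' u.
Proof. by move=> kk' fu j k'j; apply: fu; exact: leq_trans k'j. Qed.

Lemma sum_double (V : nmodType) (f : nat -> V) n :
  \sum_(0 <= i < n * 2) f i = \sum_(0 <= i < n) (f i.*2 + f i.*2.+1).
Proof.
elim: n => [|n IH]; first by rewrite mul0n !big_nil.
rewrite [RHS]big_nat_recr//= -IH mulSn add2n !big_nat_recr//= -addrA.
by rewrite muln2.
Qed.

Lemma wstep_fine k j u : fine k u -> (k <= j)%N -> wstep j u = wstep k u.
Proof.
move=> fu; elim: j => [|j IH]; first by rewrite leqn0 => /eqP->.
rewrite leq_eqVlt => /predU1P[->//|]; rewrite ltnS => kj; rewrite -IH//.
rewrite /wstep expnSr sum_double; apply: eq_big_nat => i /andP[_ ij].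
have E (n : nat) : n.*2%:R / 2 ^+ j.+1 = n%:R / 2 ^+ j :> R.
  rewrite exprS -muln2 natrM invfM [2^-1 * _]mulrC mulrA -(mulrA n%:R).
  by rewrite (mulrC 2) mulrA -mulrA divff ?mulr1// pnatr_eq0.
set a := u _ - u _; set b := u _ - u _.
have ha : `|angle a| < 4^-1.
  apply: fu; first exact: leqW.
  by rewrite expnSr muln2 ltn_double.
have hb : `|angle b| < 4^-1.
  rewrite /b; apply: fu; first exact: leqW.
  by rewrite expnSr muln2 ltn_Sdouble.
rewrite addrC -angleD; last by apply: le_lt_trans (ler_normD _ _) _; lra.
by rewrite /a /b -doubleS !E addrA subrK.
Qed.

Lemma windingE k u : fine k u -> winding u = wstep k u.
Proof.
move=> fu; rewrite /winding; case: xgetP => [k' _ fk'|/(_ k)//].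
by rewrite -(wstep_fine fk' (leq_maxl k' k)) -(wstep_fine fu (leq_maxr k' k)).
Qed.

Lemma winding_eq k u v : fine k u ->
  (forall t, 0 <= t <= 1 -> u t = v t) -> winding u = winding v.
Proof.
move=> fu uv; have uvE j i : (i <= 2 ^ j)%N ->
    v (i%:R / 2 ^+ j) = u (i%:R / 2 ^+ j).
  move=> ij; rewrite uv// divr_ge0 ?ler0n ?exprn_ge0 ?ler0n//=.
  by rewrite ler_pdivrMr ?exprn_gt0// mul1r -natrX ler_nat.
have fv : fine k v by move=> j kj i ij; rewrite !uvE ?(ltnW ij)//; exact: fu.
rewrite (windingE fu) (windingE fv) /wstep; apply: eq_big_nat => i /andP[_ ik].
by rewrite !uvE// ltnW.
Qed.

Lemma pr_winding k u : fine k u -> pr (winding u) = u 1 - u 0.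
Proof.
move=> fu; rewrite (windingE fu) /wstep pr_sum.
under eq_bigr do rewrite angleK.
rewrite (telescope_sumr (fun i => u (i%:R / 2 ^+ k)))//.
by rewrite mul0r natrX divff// expf_neq0// pnatr_eq0.
Qed.

Lemma windingB k u v : fine k u -> fine k v -> fine k (fun t => u t - v t) ->
  winding (fun t => u t - v t) = winding u - winding v.
Proof.
move=> fu fv fuv; rewrite !(@windingE k)// /wstep -sumrB.
apply: eq_big_nat => i /andP[_ ik].
have := fu k (leqnn k) i ik; have := fv k (leqnn k) i ik.
set a := u _ - u _; set b := v _ - v _ => hb ha.
have -> : u (i.+1%:R / 2 ^+ k) - v (i.+1%:R / 2 ^+ k) -
  (u (i%:R / 2 ^+ k) - v (i%:R / 2 ^+ k)) = a - b.
  by rewrite /a /b !opprD !opprK addrACA.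
have sb : angle (- b) = - angle b by apply: angleN; lra.
rewrite angleD sb//; apply: le_lt_trans (ler_normD _ _) _; rewrite normrN; lra.
Qed.

Lemma pow2_gt (e : R) : 0 < e -> \forall k \near \oo, (2 ^+ k)^-1 < e.
Proof.
move=> e0; have [n _ nP] := near_infty_natSinv_lt (PosNum e0).
exists n => // k /= nk; apply: le_lt_trans (nP k nk).
rewrite lef_pV2 ?posrE ?exprn_gt0// -natrX ler_nat.
exact: ltn_expl.
Qed.

(** Compactness of [[0, 1]] makes one subdivision fine enough for all the paths
    near a given one in a continuous family. *)
Lemma fine_near (X : topologicalType) (F : X -> R -> T) (x0 : X) :
  continuous (fun p : X * R => F p.1 p.2) ->
  exists k, \forall x \near x0, fine k (F x).
Proof.
move=> cF.
pose P (kx : nat * X) (t : R) := forall t', `|t' - t| <= (2 ^+ kx.1)^-1 ->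
  `|angle (F kx.2 t' - F kx.2 t)| < 4^-1.
have := @compact_tube R `[0, 1]%classic _
  (filter_prod \oo (nbhs x0)) _ P (segment_compact (a := 0) (b := 1)).
case=> [t _|[A B] /= [[K _ KA] nB] AB].
  have e8 : (0 : R) < 8^-1 by rewrite invr_gt0.
  have [[A B] /= [nA nB] AB] := cF (x0, t) _ (angle_near (F x0 t) e8).
  have /nbhs_ballP[d /= d0 dB] := nB.
  have d2 : 0 < d / 2 by rewrite divr_gt0.
  exists (ball t (d / 2), [set kx | (2 ^+ kx.1)^-1 < d / 2 /\ A kx.2]) => /=.
    split; first exact: nbhsx_ballx.
    exists ([set k | (2 ^+ k)^-1 < d / 2], A) => //=.
    by split => //; exact: pow2_gt.
  case=> t1 [k x] [/= tt1 [kd Ax]] t' tt'.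
  have h1 : `|angle (F x t1 - F x0 t)| < 8^-1.
    apply: (AB (x, t1)); split => //=; apply: dB; apply: le_ball tt1.
    lra.
  have h2 : `|angle (F x t' - F x0 t)| < 8^-1.
    apply: (AB (x, t')); split => //=; apply: dB.
    rewrite /ball/= in tt1 *; rewrite -(subrKA t1).
    apply: le_lt_trans (ler_normD _ _) _.
    rewrite /= in tt'; rewrite (distrC t1); lra.
  rewrite -(subrKA (F x0 t)) (le_lt_trans (norm_angleD _ _))//.
  by rewrite -(norm_angleN (F x0 t - _)) opprB; lra.
exists K; apply: filterS nB => x Bx j Kj i ij.
have hp : 0 < 2 ^+ j :> R by rewrite exprn_gt0.
have /(_ (i%:R / 2 ^+ j)) := AB (j, x) (conj (KA _ Kj) Bx).
apply => /=.
  rewrite in_itv/= divr_ge0 ?ler0n ?(ltW hp)//= ler_pdivrMr// mul1r.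
  by rewrite -natrX ler_nat ltnW.
by rewrite -mulrBl -natrB// subSnn mul1r ger0_norm// invr_ge0 ltW.
Qed.

Lemma path_fine u : continuous u -> exists k, fine k u.
Proof.
move=> cu; have [|k /nbhs_singleton] := @fine_near R (fun=> u) 0; last by exists k.
by move=> [x t]; apply: (@cvg_comp _ _ _ snd u _ (nbhs t)); [exact: cvg_snd|exact: cu].
Qed.

(** Near a given path one subdivision serves all the paths, and the sum over it
    has finitely many terms, each of them continuous. *)
Lemma winding_continuous (X : topologicalType) (F : X -> R -> T) :
  continuous (fun p : X * R => F p.1 p.2) ->
  continuous (fun x => winding (F x)).
Proof.
move=> cF x0; have [k fk] := fine_near x0 cF.
have ct t : (fun x => F x t) @ x0 --> F x0 t.
  apply: (@cvg_comp _ _ _ (fun x => (x, t)) (fun p => F p.1 p.2) _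
    (nbhs (x0, t))); last exact: (cF (x0, t)).
  by apply: (@cvg_pair _ _ _ (nbhs x0) (nbhs x0) (nbhs t)); [exact: cvg_id|exact: cvg_cst].
have fx0 := nbhs_singleton fk.
rewrite /continuous_at (windingE fx0).
apply: (@cvg_trans _ ((fun x => wstep k (F x)) @ x0)).
  by apply: near_eq_cvg; apply: filterS fk => x /windingE.
rewrite /wstep big_mkord; under eq_fun do rewrite big_mkord.
apply: (@cvg_big R _ +%R) => [|i _]; first exact: add_continuous.
have h := fx0 k (leqnn k) i (ltn_ord i).
apply: (@cvg_comp _ _ _ (fun x => F x (i.+1%:R / 2 ^+ k) - F x (i%:R / 2 ^+ k))
  angle _ (nbhs (F x0 (i.+1%:R / 2 ^+ k) - F x0 (i%:R / 2 ^+ k)))).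
  apply: (@cvg_comp _ _ _ (fun x => (F x (i.+1%:R / 2 ^+ k), F x (i%:R / 2 ^+ k)))
    (fun p : T * T => p.1 - p.2) _
    (nbhs (F x0 (i.+1%:R / 2 ^+ k), F x0 (i%:R / 2 ^+ k)))).
    by apply: (@cvg_pair _ _ _ (nbhs x0) (nbhs _) (nbhs _)); exact: ct.
  exact: (@sub_continuous T (_, _)).
by apply: angle_continuous; apply: lt_trans h _; lra.
Qed.

(** After subtraction of the homomorphism with slope [winding u], the path
    vanishes at all small dyadic numbers, hence everywhere by continuity. *)
Lemma hom_winding u : continuous u -> {morph u : s t / s + t} ->
  forall t, u t = pr (t * winding u).
Proof.
move=> cu uD t; have [k fk] := path_fine cu; set w := winding u.
have u0 : u 0 = 0 by apply: (addrI (u 0)); rewrite -uD !addr0.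
have uN x : u (- x) = - u x.
  by apply: (addrI (u x)); rewrite -uD !subrr.
have uB x y : u (x - y) = u x - u y by rewrite uD uN.
pose v x := u x - pr (x * w).
have vD x y : v (x + y) = v x + v y.
  by rewrite /v uD mulrDl prD opprD addrACA.
have vk j : (k <= j)%N -> v (2 ^+ j)^-1 = 0.
  move=> kj; have fj := fineW kj fk.
  have wE : w = 2 ^+ j * angle (u (2 ^+ j)^-1).
    rewrite /w (windingE fj) /wstep big_mkord (eq_bigr (fun=> angle (u (2 ^+ j)^-1))).
      by rewrite sumr_const card_ord -natrX -[LHS]mulr_natl.
    move=> i _; rewrite -uB; congr (angle (u _)).
    by rewrite -mulrBl -natrB// subSnn mul1r.
  by rewrite /v wE mulrA mulVf ?expf_neq0 ?pnatr_eq0// mul1r angleK subrr.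
have v0 : v 0 = 0 by rewrite /v u0 mul0r pr0 subrr.
have vN x : v (- x) = - v x.
  by apply: (addrI (v x)); rewrite -vD !subrr.
have vn x n : v x = 0 -> v (x *+ n) = 0.
  by move=> vx; elim: n => [|n IH]; rewrite ?mulr0n// mulrS vD vx IH addr0.
have vz x (n : int) : v x = 0 -> v (n%:~R * x) = 0.
  move=> vx; rewrite mulrzl; case: n => n; first exact: vn.
  by rewrite NegzE mulrNz vN -pmulrn vn ?oppr0.
have cv : v @ (0 : R) --> (0 : T).
  rewrite -v0; apply: (@fctB_continuous _ _ u (fun x => pr (x * w)) cu _ 0) => x.
  apply: (@cvg_comp _ _ _ (fun x => x * w) pr _ (nbhs (x * w))).
    by apply: cvgMl; exact: cvg_id.
  exact: pr_continuous.
suff : v t = 0 by rewrite /v => /subr0_eq.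
apply/angle_eq0/normr0_eq0/eqP.
rewrite eq_le normr_ge0 andbT; apply/ler_addgt0Pl => e e0; rewrite addr0.
have : \forall s \near (0 : R), `|angle (v s - 0)| < e by exact: (cv _ (angle_near 0 e0)).
move=> /nbhs_ballP[d /= d0 dv].
have [N _ NP] := pow2_gt d0.
pose j := maxn N k; have kj : (k <= j)%N by exact: leq_maxr.
have jd := NP j (leq_maxl N k); rewrite /= in jd.
have hp : 0 < 2 ^+ j :> R by rewrite exprn_gt0.
pose i := Num.floor (t * 2 ^+ j).
have /andP[i1 i2] := floor_itv (t * 2 ^+ j); rewrite -/i in i1 i2.
rewrite intrD in i2.
have -> : v t = v (t - i%:~R * (2 ^+ j)^-1).
  by rewrite vD vN vz ?vk// subr0.
have := dv (t - i%:~R * (2 ^+ j)^-1); rewrite subr0 => h; apply/ltW/h.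
rewrite /ball/= sub0r normrN; apply: le_lt_trans jd.
have -> : t - i%:~R * (2 ^+ j)^-1 = (t * 2 ^+ j - i%:~R) / 2 ^+ j.
  by rewrite mulrBl mulfK// gt_eqF.
rewrite normrM normfV (gtr0_norm hp) ler_pdivrMr// mulVf ?gt_eqF//.
rewrite ger0_norm ?subr_ge0//; lra.
Qed.

End Winding.

(** * Invariant means *)

Section Mean.
Variables (R : realType) (V : zmodType).
Implicit Types (f g : V -> R).

Definition bnd (X : Type) (f : X -> R) := exists C : R, forall x, `|f x| <= C.

Lemma ultra_bnd_cvg (I : Type) (U : set_system I) (UU : UltraFilter U)
  (f : I -> R) (C : R) : (forall i, `|f i| <= C) -> cvg (f @ U).
Proof.
move=> fC; have UF : (f @ U) `[- C, C]%classic.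
  by apply: (@filterE _ U) => i /=; rewrite in_itv/= -ler_norml.
have [l [_ /= fl]] := @segment_compact R (- C) C _ _ UF.
apply/cvg_ex; exists l => B lB.
have [//|UB] := in_ultra_setVsetC (f @^-1` B) UU.
by have [x []] := fl (~` B) B UB lB.
Qed.

Definition avg1 (n : nat) (g : V) f : V -> R :=
  fun x => (\sum_(k < n.+1) f (x + g *+ k)) / n.+1%:R.

(** The average over a box of generators [p.1] and side [p.2]: as both grow, the
    boxes exhaust the group in the sense of Folner. *)
Definition avg (p : seq V * nat) f : V -> R := foldr (avg1 p.2) f p.1.

Lemma avg1_bound n (g : V) f (C : R) : (forall x, `|f x| <= C) ->
  forall x, `|avg1 n g f x| <= C.
Proof.
move=> fC x; rewrite /avg1 normrM normfV [`|n.+1%:R|]ger0_norm ?ler0n//.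
rewrite ler_pdivrMr ?ltr0n//; apply: le_trans (ler_norm_sum _ _ _) _.
apply: le_trans (ler_sum _ (fun k _ => fC _)) _.
by rewrite sumr_const card_ord mulr_natr.
Qed.

Lemma avg_bound p f (C : R) : (forall x, `|f x| <= C) ->
  forall x, `|avg p f x| <= C.
Proof.
by case: p => s n fC; rewrite /avg/=; elim: s => //= g s IH; exact: avg1_bound.
Qed.

Lemma avg1_comb n (h : V) (a : R) f (b : R) g :
  avg1 n h (fun x => a * f x + b * g x) =
  fun x => a * avg1 n h f x + b * avg1 n h g x.
Proof.
apply/funext => x; rewrite /avg1 big_split/= -!mulr_sumr mulrDl !mulrA.
by [].
Qed.

Lemma avg_comb p (a : R) f (b : R) g :
  avg p (fun x => a * f x + b * g x) =
  fun x => a * avg p f x + b * avg p g x.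
Proof.
by case: p => s n; rewrite /avg/=; elim: s => //= h s ->; rewrite avg1_comb.
Qed.

Lemma avg_translate p (a : V) f :
  avg p (fun x => f (x + a)) = fun x => avg p f (x + a).
Proof.
case: p => s n; rewrite /avg/=; elim: s => //= h s ->.
apply/funext => x; rewrite /avg1; congr (_ / _).
by apply: eq_bigr => k _; rewrite addrAC.
Qed.

Lemma avg_ge0 p f : (forall x, 0 <= f x) -> forall x, 0 <= avg p f x.
Proof.
case: p => s n f0; rewrite /avg/=; elim: s => //= h s IH x.
by rewrite /avg1 divr_ge0// sumr_ge0.
Qed.

Lemma avg_cst p (c : R) x : avg p (fun=> c) x = c.
Proof.
case: p => s n; rewrite /avg/=; elim: s x => //= h s IH x.
rewrite /avg1 (eq_bigr (fun=> c)) => [|k _]; last exact: IH.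
by rewrite sumr_const card_ord -[c *+ _]mulr_natr mulfK ?pnatr_eq0.
Qed.

(** Averaging over a long progression with step [a] is nearly invariant under
    translation by [a], as only the two ends of the progression differ. *)
Lemma avg_near_invariant (p : seq V * nat) (a : V) f (C : R) :
  (forall x, `|f x| <= C) -> a \in p.1 ->
  forall x, `|avg p (fun x => f (x + a)) x - avg p f x| <= 2 * C / p.2.+1%:R.
Proof.
case: p => s n /= fC; elim: s => //= h s IH; rewrite inE => /predU1P[->|sa] x.
  rewrite -[avg _ _ x]/(avg1 n h (avg (s, n) (fun x => f (x + h))) x).
  rewrite -[avg _ f x]/(avg1 n h (avg (s, n) f) x) avg_translate.
  set F := avg (s, n) f.
  rewrite /avg1 -mulrBl normrM normfV [`|n.+1%:R|]ger0_norm ?ler0n//.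
  rewrite ler_pM2r ?invr_gt0 ?ltr0n// -sumrB.
  rewrite (eq_bigr (fun k : 'I_n.+1 =>
      F (x + h *+ k.+1) - F (x + h *+ k))); last first.
    by move=> k _; rewrite mulrSr addrA.
  rewrite -(big_mkord predT (fun k => F (x + h *+ k.+1) - F (x + h *+ k))).
  rewrite telescope_sumr// mulr0n addr0 mulr2n mulrDl !mul1r.
  by apply: le_trans (ler_normB _ _) _; rewrite lerD//; exact: avg_bound.
have -> : avg (h :: s, n) (fun x => f (x + a)) x - avg (h :: s, n) f x =
   avg1 n h (fun x => avg (s, n) (fun x => f (x + a)) x - avg (s, n) f x) x.
  rewrite /avg/= /avg1 -mulrBl -sumrB.
  by congr (_ / _); apply: eq_bigr => k _.
by apply: avg1_bound => y; exact: IH.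
Qed.

(** Amenability of abelian groups: the limit, along an ultrafilter, of averages
    over boxes with more and more generators and longer and longer sides. *)
Theorem invariant_mean : exists M : (V -> R) -> R,
  [/\ forall (a b : R) f g, bnd f -> bnd g ->
        M (fun x => a * f x + b * g x) = a * M f + b * M g,
      forall f, bnd f -> (forall x, 0 <= f x) -> 0 <= M f,
      forall c, M (fun=> c) = c
    & forall f (a : V), bnd f -> M (fun x => f (x + a)) = M f].
Proof.
pose B (p : seq V * nat) := [set q : seq V * nat |
  {subset p.1 <= q.1} /\ (p.2 <= q.2)%N].
have FF : Filter (filter_from [set: seq V * nat] B).
  apply: filter_from_filter; first by exists ([::], 0%N).
  move=> [s n] [t m] _ _; exists (s ++ t, maxn n m) => //.
  move=> [u k] [/= su]; rewrite geq_max => /andP[nk mk].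
  by split; split => //= x xs; apply: su; rewrite mem_cat xs ?orbT.
have PF : ProperFilter (filter_from [set: seq V * nat] B).
  by apply: filter_from_proper => p _; exists p; split.
have [U [UU FU]] := ultraFilterLemma PF.
pose M f := lim ((fun p => avg p f 0) @ U).
have cM f : bnd f -> (fun p => avg p f 0) @ U --> M f.
  move=> [C fC]; apply: (@ultra_bnd_cvg _ _ _ _ C) => p.
  exact: (avg_bound p fC 0).
exists M; split.
- move=> a b f g bf bg; apply/cvg_lim; first exact: Rhausdorff.
  have -> : (fun p => avg p (fun x => a * f x + b * g x) 0) =
     (fun p => a * avg p f 0 + b * avg p g 0).
    by apply/funext => p; rewrite avg_comb.
  by apply: cvgD; apply: cvgMr; exact: cM.
- move=> f bf f0; apply: (cvgr_to_ge (cM f bf)).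
  by apply: nearW => p; exact: avg_ge0.
- move=> c; apply/cvg_lim; first exact: Rhausdorff.
  have -> : (fun p => avg p (fun=> c) 0) = fun=> c.
    by apply/funext => p; rewrite avg_cst.
  exact: cvg_cst.
- move=> f a bf; apply/cvg_lim; first exact: Rhausdorff.
  have [C fC] := bf.
  have C0 : 0 <= C by apply: le_trans (fC 0).
  apply/cvgrPdist_lt => e e0.
  have : \forall p \near U, `|M f - avg p f 0| < e / 2.
    by move/cvgrPdist_lt : (cM f bf); apply; rewrite divr_gt0.
  have [N Ne] : exists N : nat, 2 * C / N.+1%:R < e / 2.
    exists (Num.truncn ((e / 2)^-1 * (2 * C))).
    rewrite ltr_pdivrMr ?ltr0n// -ltr_pdivrMl ?divr_gt0//.
    by apply: truncnS_gt.
  have : U (B ([:: a], N)) by apply: FU; exists ([:: a], N).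
  apply: filterS2 => p [/= ap Np] h.
  have ap1 : a \in p.1 by apply: ap; rewrite inE.
  have := avg_near_invariant fC ap1 0.
  have : 2 * C / p.2.+1%:R <= 2 * C / N.+1%:R.
    by rewrite ler_wpM2l ?mulr_ge0// lef_pV2 ?posrE ?ltr0n// ler_nat ltnS.
  set u := avg p _ 0; set v := avg p f 0 => h1 h2.
  rewrite -(subrKA v) (le_lt_trans (ler_normD _ _))// (splitr e) ltrD//.
  by rewrite distrC; apply: le_lt_trans h2 (le_lt_trans h1 Ne).
Qed.

End Mean.

(** * Characters of compact abelian groups *)

(** A nonzero subspace of least dimension that is stable under a commuting
    family lies in an eigenspace of each member, because the intersection with
    an eigenspace is again stable. *)
Lemma commuting_eigenvector (C : numClosedFieldType) (n : nat) (I : Type)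
    (D : I -> 'M[C]_n) : (0 < n)%N ->
  (forall a b, D a *m D b = D b *m D a) ->
  exists v : 'rV[C]_n, v != 0 /\
    forall a, exists mu, v *m D a = mu *: v.
Proof.
move=> n0 Dcomm.
pose P r := `[< exists W : 'M[C]_n, [/\ \rank W = r, W != 0
  & forall a, stablemx W (D a)] >].
have exP : exists r, P r.
  exists n; apply/asboolP; exists 1%:M; split; first exact: mxrank1.
    by rewrite -mxrank_eq0 mxrank1 -lt0n.
  by move=> a; exact: stableCmx.
case: (ex_minnP exP) => r /asboolP[W [Wr W0 Wst]] rmin.
have Weig a : exists mu, (W <= eigenspace (D a) mu)%MS.
  have r0 : (0 < \rank W)%N by rewrite lt0n mxrank_eq0.
  have [mu /eigenvalueP[u uB u0]] :=
    eigenvalue_closed (row_base W *m D a *m pinvmx (row_base W)) r0.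
  exists mu.
  have Bst : (row_base W *m D a <= row_base W)%MS.
    exact: etrans (stablemx_row_base W (D a)) (Wst a).
  have wE : u *m row_base W *m D a = mu *: (u *m row_base W).
    by rewrite scalemxAl -uB -[RHS]mulmxA mulmxKpV// mulmxA.
  pose W' := (W :&: eigenspace (D a) mu)%MS.
  have W'0 : W' != 0.
    apply: contra u0 => /eqP W'0.
    rewrite -(mulmx_free_eq0 u (row_base_free W)) -submx0 -W'0 sub_capmx.
    by rewrite (submx_trans (submxMl _ _)) ?eq_row_base//=; exact/eigenspaceP.
  have W'st b : stablemx W' (D b).
    rewrite sub_capmx (submx_trans (submxMr _ (capmxSl _ _)))//=.
    rewrite (submx_trans (submxMr _ (capmxSr _ _)))//.
    by apply: comm_mx_stable_eigenspace; exact: Dcomm.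
  have : (r <= \rank W')%N by apply: rmin; apply/asboolP; exists W'.
  rewrite -Wr => leW; have := mxrank_leqif_sup (capmxSl W (eigenspace (D a) mu)).
  move=> /geq_leqif; rewrite leW => /esym/submx_trans; apply.
  exact: capmxSr.
exists (nz_row W); split; first by rewrite nz_row_eq0.
move=> a; have [mu Wmu] := Weig a; exists mu; apply/eigenspaceP.
exact: submx_trans (nz_row_sub W) Wmu.
Qed.

Section Bounded.
Variables (R : realType) (X : Type).
Implicit Types (f g : X -> R).

Lemma bnd_cst (c : R) : bnd (fun _ : X => c).
Proof. by exists `|c|. Qed.

Lemma bndD f g : bnd f -> bnd g -> bnd (fun x => f x + g x).
Proof.
move=> [C fC] [D gD]; exists (C + D) => x.
by apply: le_trans (ler_normD _ _) _; exact: lerD.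
Qed.

Lemma bndM f g : bnd f -> bnd g -> bnd (fun x => f x * g x).
Proof.
move=> [C fC] [D gD]; exists (C * D) => x.
by rewrite normrM ler_pM.
Qed.

Lemma bndZ (a : R) f : bnd f -> bnd (fun x => a * f x).
Proof. exact: (bndM (bnd_cst a)). Qed.

Lemma bndN f : bnd f -> bnd (fun x => - f x).
Proof. by move=> [C fC]; exists C => x; rewrite normrN. Qed.

Lemma bndB f g : bnd f -> bnd g -> bnd (fun x => f x - g x).
Proof. by move=> bf bg; apply: bndD => //; exact: bndN. Qed.

Lemma bnd_comp (Y : Type) (h : Y -> X) f : bnd f -> bnd (fun y => f (h y)).
Proof. by move=> [C fC]; exists C. Qed.

Lemma bnd_sum (I : Type) (r : seq I) (F : I -> X -> R) :
  (forall i, bnd (F i)) -> bnd (fun x => \sum_(i <- r) F i x).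
Proof.
move=> bF; elim: r => [|i r IH].
  by exists 0 => x; rewrite big_nil normr0.
rewrite (_ : (fun x => _) = fun x => F i x + \sum_(j <- r) F j x).
  exact: bndD.
by apply/funext => x; rewrite big_cons.
Qed.

End Bounded.

(** The [L^2] theory of an invariant mean, and of the operator [hankel] attached
    to a function [psi] with totally bounded translates. Its kernel is
    [psi (x + y)] and not [psi (x - y)]: so it is symmetric without any evenness
    of [psi], and its square commutes with translations. *)
Section Convolution.
Variables (R : realType) (V : zmodType) (M : (V -> R) -> R).
Implicit Types (f g h : V -> R).
Hypothesis M_comb : forall (a b : R) f g, bnd f -> bnd g ->
  M (fun x => a * f x + b * g x) = a * M f + b * M g.
Hypothesis M_ge0 : forall f, bnd f -> (forall x, 0 <= f x) -> 0 <= M f.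
Hypothesis M_cst : forall c, M (fun=> c) = c.
Hypothesis M_translate :
  forall f (a : V), bnd f -> M (fun x => f (x + a)) = M f.

Lemma M_ext f g : f =1 g -> M f = M g.
Proof. by move/funext => ->. Qed.

Lemma MD f g : bnd f -> bnd g -> M (fun x => f x + g x) = M f + M g.
Proof.
move=> bf bg; rewrite -[M f]mul1r -[M g]mul1r -M_comb//.
by apply: M_ext => x; rewrite !mul1r.
Qed.

Lemma MZ (a : R) f : bnd f -> M (fun x => a * f x) = a * M f.
Proof.
move=> bf; rewrite -[RHS]addr0 -(mul0r (M f)) -M_comb//.
by apply: M_ext => x; rewrite mul0r addr0.
Qed.

Lemma MB f g : bnd f -> bnd g -> M (fun x => f x - g x) = M f - M g.
Proof.
move=> bf bg; rewrite MD//; last exact: bndN.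
congr (_ + _); rewrite -mulN1r -MZ//.
by apply: M_ext => x; rewrite mulN1r.
Qed.

Lemma M_sum (I : Type) (r : seq I) (F : I -> V -> R) :
  (forall i, bnd (F i)) ->
  M (fun x => \sum_(i <- r) F i x) = \sum_(i <- r) M (F i).
Proof.
move=> bF; elim: r => [|i r IH].
  by rewrite big_nil -[RHS]M_cst; apply: M_ext => x; rewrite big_nil.
rewrite big_cons -IH -MD//; last exact: bnd_sum.
by apply: M_ext => x; rewrite big_cons.
Qed.

Lemma M_le f g : bnd f -> bnd g -> (forall x, f x <= g x) -> M f <= M g.
Proof.
move=> bf bg fg; rewrite -subr_ge0 -MB//; apply: M_ge0; first exact: bndB.
by move=> x; rewrite subr_ge0.
Qed.

Lemma M_norm_le f (C : R) : (forall x, `|f x| <= C) -> `|M f| <= C.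
Proof.
move=> fC; have bf : bnd f by exists C.
rewrite ler_norml; apply/andP; split.
  rewrite -[leLHS]M_cst; apply: M_le => //; first exact: bnd_cst.
  by move=> x; have := fC x; rewrite ler_norml => /andP[].
rewrite -[leRHS]M_cst; apply: M_le => //; first exact: bnd_cst.
by move=> x; have := fC x; rewrite ler_norml => /andP[].
Qed.

Definition dot f g := M (fun x => f x * g x).

Lemma dotC f g : dot f g = dot g f.
Proof. by apply: M_ext => x; rewrite mulrC. Qed.

Lemma dot_ge0 f : bnd f -> 0 <= dot f f.
Proof. by move=> bf; apply: M_ge0; [exact: bndM|move=> x; exact: sqr_ge0]. Qed.

Lemma dot_comb (a b : R) f g h : bnd f -> bnd g -> bnd h ->
  dot (fun x => a * f x + b * g x) h = a * dot f h + b * dot g h.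
Proof.
move=> bf bg bh; rewrite -M_comb; [|exact: bndM|exact: bndM].
by apply: M_ext => x; rewrite mulrDl !mulrA.
Qed.

Lemma dot_sum (I : Type) (r : seq I) (a : I -> R) (F : I -> V -> R) h :
  (forall i, bnd (F i)) -> bnd h ->
  dot (fun x => \sum_(i <- r) a i * F i x) h = \sum_(i <- r) a i * dot (F i) h.
Proof.
move=> bF bh; transitivity (M (fun x => \sum_(i <- r) a i * (F i x * h x))).
  by apply: M_ext => x; rewrite mulr_suml; apply: eq_bigr => i _; rewrite mulrA.
rewrite M_sum; last by move=> i; apply: bndZ; exact: bndM.
by apply: eq_bigr => i _; rewrite MZ//; exact: bndM.
Qed.

Lemma dot_cauchy f g : bnd f -> bnd g -> dot f g ^+ 2 <= dot f f * dot g g.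
Proof.
move=> bf bg.
have quad (a b : R) :
    0 <= a ^+ 2 * dot f f + 2 * a * b * dot f g + b ^+ 2 * dot g g.
  have := dot_ge0 (bndD (bndZ a bf) (bndZ b bg)).
  rewrite dot_comb//; last by apply: bndD; exact: bndZ.
  rewrite (dotC f) (dotC g) !dot_comb// (dotC g f).
  by congr (0 <= _); ring.
have [f0|f0] := eqVneq (dot f f) 0; last first.
  have fp : 0 < dot f f by rewrite lt0r f0 dot_ge0.
  have := quad (dot f g) (- dot f f).
  rewrite (_ : _ + _ + _ = dot f f * (dot f f * dot g g - dot f g ^+ 2)).
    by rewrite pmulr_rge0// subr_ge0.
  by ring.
rewrite f0 mul0r; have [->|g0] := eqVneq (dot f g) 0; first by rewrite expr0n.
have := quad (- (dot g g + 1) / (2 * dot f g)) 1.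
rewrite f0 mulr0 add0r expr1n mul1r mulr1.
rewrite (_ : 2 * _ * _ = - (dot g g + 1)); last by field.
lra.
Qed.

Definition almost_periodic f := forall e : R, 0 < e -> exists s : seq V,
  forall x, exists2 a, a \in s & forall y, `|f (x + y) - f (a + y)| <= e.

Variable psi : V -> R.
Hypothesis psi_bnd : bnd psi.
Hypothesis psi_tb : almost_periodic psi.

(** Finitely many translates of the set where [f] is close to [f z] cover the
    group, so one of these sets has positive mean. *)
Lemma almost_periodic_faithful f : almost_periodic f -> bnd f ->
  dot f f = 0 -> forall z, f z = 0.
Proof.
move=> apf bf f0 z; apply/eqP/negPn/negP => fz.
have e0 : 0 < `|f z| / 2 by rewrite divr_gt0 ?normr_gt0.
have [s sP] := apf _ e0.
pose P a x : R := (`[< forall y, `|f (x + y) - f (a + y)| <= `|f z| / 2 >])%:R.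
have bP a : bnd (P a) by exists 1 => x; rewrite /P; case: asbool; rewrite ?normr1 ?normr0.
have P0 a : M (P a) = 0.
  apply/eqP; rewrite eq_le; apply/andP; split; last first.
    by apply: M_ge0 => // x; rewrite ler0n.
  have bt : bnd (fun x => f (x + (z - a)) * f (x + (z - a))).
    exact: (bnd_comp (fun x => x + (z - a)) (bndM bf bf)).
  have : (`|f z| / 2) ^+ 2 * M (P a) <= 0.
    rewrite -MZ// -f0 /dot -(M_translate (z - a) (bndM bf bf)).
    apply: M_le => //; first exact: bndZ.
    move=> x; rewrite /P; case: asboolP => [h|_]; last first.
      by rewrite mulr0; exact: sqr_ge0.
    rewrite mulr1 -expr2 -[leRHS]real_normK ?num_real//.
    rewrite ler_sqr ?nnegrE ?(ltW e0)//.
    have := h (z - a); rewrite subrKC => h'.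
    have := lerB_dist (f z) (f (x + (z - a))); rewrite distrC in h'; lra.
  by rewrite pmulr_rle0// exprn_gt0.
have : (1 : R) <= M (fun x => \sum_(a <- s) P a x).
  rewrite -[leLHS](M_cst 1); apply: M_le; [exact: bnd_cst|exact: bnd_sum|].
  move=> x; have [a /(nthP 0)[i si <-] h] := sP x.
  rewrite (big_nth 0) big_mkord (bigD1 (Ordinal si))//= {1}/P asboolT//.
  by rewrite lerDl sumr_ge0// => j _; rewrite /P ler0n.
by rewrite M_sum// big1 ?ler10// => a _.
Qed.

Definition hankel f : V -> R := fun x => M (fun y => psi (x + y) * f y).

Lemma psi_trans x : bnd (fun y => psi (x + y)).
Proof. exact: (bnd_comp (fun y => x + y)). Qed.

Lemma dot_psi_trans x : dot (fun y => psi (x + y)) (fun y => psi (x + y)) =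
  dot psi psi.
Proof.
rewrite /dot -(M_translate x (bndM psi_bnd psi_bnd)).
by apply: M_ext => y; rewrite addrC.
Qed.

Lemma hankel_comb (a b : R) f g : bnd f -> bnd g ->
  hankel (fun x => a * f x + b * g x) = fun x => a * hankel f x + b * hankel g x.
Proof.
move=> bf bg; apply/funext => x; rewrite /hankel -M_comb.
- by apply: M_ext => y; rewrite mulrDr !(mulrCA (psi _)).
- by apply: bndM => //; exact: psi_trans.
- by apply: bndM => //; exact: psi_trans.
Qed.

Lemma hankelZ (a : R) f : bnd f -> hankel (fun x => a * f x) = fun x => a * hankel f x.
Proof.
move=> bf; apply/funext => x; rewrite /hankel -MZ.
  by apply: M_ext => y; rewrite mulrCA.
by apply: bndM => //; exact: psi_trans.
Qed.

Lemma hankel_sq_le f x : bnd f -> hankel f x ^+ 2 <= dot psi psi * dot f f.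
Proof.
move=> bf; rewrite -(dot_psi_trans x).
by apply: dot_cauchy => //; exact: psi_trans.
Qed.

Lemma hankel_bnd f : bnd f -> bnd (hankel f).
Proof.
move=> bf; exists (Num.sqrt (dot psi psi * dot f f)) => x.
by rewrite -sqrtr_sqr ler_wsqrtr// hankel_sq_le.
Qed.

Lemma hankel_sup f (C : R) : (forall x, `|f x| <= C) ->
  forall x, hankel f x ^+ 2 <= dot psi psi * C ^+ 2.
Proof.
move=> fC x; have bf : bnd f by exists C.
apply: le_trans (hankel_sq_le x bf) _; rewrite ler_wpM2l ?dot_ge0//.
rewrite -[leRHS](M_cst); apply: M_le; [exact: bndM|exact: bnd_cst|].
move=> y; rewrite -expr2 -[leLHS]real_normK ?num_real//.
by rewrite ler_sqr ?nnegrE// (le_trans _ (fC y)).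
Qed.

(** The modulus of continuity of [hankel f] depends only on [psi] and on a bound
    of [f]. *)
Lemma hankel_ap f : bnd f -> almost_periodic (hankel f).
Proof.
move=> [C fC] e e0.
have C0 : 0 <= C := le_trans (normr_ge0 _) (fC 0).
have d0 : 0 < e / (C + 1) by rewrite divr_gt0// ltr_wpDl.
have [s sP] := psi_tb d0; exists s => x; have [a sa h] := sP x.
exists a => // y; rewrite /hankel -MB; last 2 first.
- by apply: bndM; [exact: psi_trans|exists C].
- by apply: bndM; [exact: psi_trans|exists C].
apply: M_norm_le => z; rewrite -mulrBl normrM -!addrA.
apply: le_trans (ler_pM _ _ (h (y + z)) (fC z)) _ => //.
by rewrite mulrAC ler_pdivrMr ?ltr_wpDl// ler_pM2l// lerDl.
Qed.

(** Fubini's theorem for the kernel: it is uniformly approximated by kernels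
    of finite rank, for which the exchange is linearity of the mean. *)
Lemma hankel_sym f g : bnd f -> bnd g -> dot (hankel f) g = dot f (hankel g).
Proof.
move=> bf bg; apply/eqP; rewrite -subr_eq0 -normr_le0.
have [C fC] := bf; have [D gD] := bg.
have C0 : 0 <= C := le_trans (normr_ge0 _) (fC 0).
have D0 : 0 <= D := le_trans (normr_ge0 _) (gD 0).
apply/ler_addgt0Pl => e e0; rewrite addr0.
have d0 : 0 < e / (2 * (C * D) + 1).
  by rewrite divr_gt0// ltr_wpDl// !mulr_ge0.
set d := e / _ in d0.
have [s sP] := psi_tb d0.
have /choice[c cP] : forall x, exists a, a \in s /\
    forall y, `|psi (x + y) - psi (a + y)| <= d.
  by move=> x; have [a ? ?] := sP x; exists a.
pose I x a : R := (c x == a)%:R.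
have bI a : bnd (fun x => I x a).
  by exists 1 => x; rewrite /I; case: eqP; rewrite ?normr1 ?normr0.
have sumI F x : F (c x) = \sum_(a <- undup s) I x a * F a.
  rewrite (bigD1_seq (c x)) ?undup_uniq ?mem_undup ?(cP x).1//=.
  rewrite /I eqxx mul1r big1 ?addr0// => a ca.
  by rewrite eq_sym (negPf ca) mul0r.
have bpc x : bnd (fun y => psi (c x + y)) by exact: psi_trans.
have bpc' y : bnd (fun x => psi (c x + y)).
  exact: (bnd_comp (fun x => c x + y)).
pose N := \sum_(a <- undup s) dot (fun x => I x a) g * hankel f a.
have L : `|dot (hankel f) g - N| <= C * D * d.
  have -> : N = M (fun x => hankel f (c x) * g x).
    rewrite (M_ext (g := fun x => \sum_(a <- undup s) hankel f a * (I x a * g x))).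
      rewrite M_sum => [|a]; last by apply: bndZ; exact: bndM.
      by apply: eq_bigr => a _; rewrite MZ 1?mulrC//; exact: bndM.
    by move=> x; rewrite (sumI (hankel f)) mulr_suml; apply: eq_bigr => a _; ring.
  rewrite -MB; last 2 first.
  - by apply: bndM => //; exact: hankel_bnd.
  - by apply: bndM => //; apply: (bnd_comp c); exact: hankel_bnd.
  apply: M_norm_le => x; rewrite -mulrBl normrM mulrAC ler_pM//.
  rewrite /hankel -MB; last 2 first.
  - by apply: bndM => //; exact: psi_trans.
  - exact: bndM.
  apply: M_norm_le => y; rewrite -mulrBl normrM mulrC ler_pM//.
  exact: (cP x).2.
have L' : `|dot f (hankel g) - N| <= C * D * d.
  have -> : N = M (fun y => f y * M (fun x => psi (c x + y) * g x)).
    transitivity (M (fun y => \sum_(a <- undup s)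
        dot (fun x => I x a) g * (psi (a + y) * f y))).
      rewrite M_sum => [|a]; last first.
        by apply: bndZ; apply: bndM => //; exact: psi_trans.
      apply: eq_bigr => a _; rewrite MZ//.
      by apply: bndM => //; exact: psi_trans.
    apply: M_ext => y.
    rewrite (M_ext (g := fun x => \sum_(a <- undup s) psi (a + y) * (I x a * g x))).
      rewrite M_sum => [|a]; last by apply: bndZ; exact: bndM.
      rewrite mulr_sumr; apply: eq_bigr => a _; rewrite MZ; last exact: bndM.
      by rewrite -/(dot (fun x => I x a) g); ring.
    move=> x; rewrite (sumI (fun a => psi (a + y))) mulr_suml.
    by apply: eq_bigr => a _; ring.
  have bh y : bnd (fun x => psi (c x + y) * g x) by exact: bndM.
  have bM : bnd (fun y => M (fun x => psi (c x + y) * g x)).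
    have [B pB] := psi_bnd; exists (B * D) => y.
    by apply: M_norm_le => x; rewrite normrM ler_pM.
  rewrite -MB; last 2 first.
  - by apply: bndM => //; exact: hankel_bnd.
  - exact: bndM.
  apply: M_norm_le => y; rewrite -mulrBr normrM -mulrA ler_pM//.
  rewrite /hankel -MB//; last by apply: bndM => //; exact: psi_trans.
  apply: M_norm_le => x; rewrite -mulrBl normrM mulrC ler_pM//.
  by rewrite (addrC y); exact: (cP x).2.
have : `|dot (hankel f) g - dot f (hankel g)| <= 2 * (C * D) * d.
  rewrite -(subrKA N) (le_trans (ler_normD _ _))//.
  rewrite (distrC N) (_ : 2 * (C * D) * d = C * D * d + C * D * d); last by ring.
  exact: lerD.
move/le_trans; apply; rewrite /d [leLHS]mulrA ler_pdivrMr ?ltr_wpDl ?mulr_ge0//.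
by rewrite mulrC ler_pM2l// lerDl.
Qed.

Lemma hankel_translate f (a : V) : bnd f ->
  hankel (fun x => f (x + a)) = fun x => hankel f (x - a).
Proof.
move=> bf; apply/funext => x; rewrite /hankel.
rewrite -(M_translate a (f := fun y => psi (x - a + y) * f y)).
  by apply: M_ext => y; rewrite -(addrA x) [- a + _]addrCA addNr addr0.
by apply: bndM => //; exact: psi_trans.
Qed.

Lemma dotZ (a : R) f : bnd f ->
  dot (fun x => a * f x) (fun x => a * f x) = a ^+ 2 * dot f f.
Proof.
move=> bf; rewrite /dot -MZ; last exact: bndM.
by apply: M_ext => x; ring.
Qed.

Lemma hankel_difference_le f (x a : V) (e : R) : bnd f -> dot f f <= 1 ->
  0 <= e -> (forall y, `|psi (x + y) - psi (a + y)| <= e) ->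
  `|hankel f x - hankel f a| <= e.
Proof.
move=> bf f1 e0 h; rewrite /hankel -MB; [|exact/bndM/bf/psi_trans..].
have bd : bnd (fun y => psi (x + y) - psi (a + y)) by exists e.
have := dot_cauchy bd bf; rewrite /dot.
rewrite (M_ext (f := fun y => (psi (x + y) - psi (a + y)) * f y)
  (g := fun y => psi (x + y) * f y - psi (a + y) * f y)); last first.
  by move=> y; rewrite mulrBl.
move=> hc; rewrite -ler_sqr ?nnegrE// real_normK ?num_real//.
apply: le_trans hc _; rewrite -[leRHS]mulr1 ler_pM//; try exact: dot_ge0.
rewrite -[leRHS](M_cst); apply: M_le; [exact: bndM|exact: bnd_cst|].
move=> y; rewrite -expr2 -[leLHS]real_normK ?num_real//.
by rewrite ler_sqr ?nnegrE.
Qed.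

(** The operator [hankel] is compact, so the supremum of the quadratic form of its
    square is an eigenvalue: the images under [hankel] of a maximizing sequence are
    equicontinuous, hence converge uniformly along an ultrafilter. *)
Lemma hankel_eigenfunction : (exists z, psi z != 0) -> exists (sigma : R) v,
  [/\ 0 < sigma, bnd v, exists x, v x != 0
    & forall x, hankel (hankel v) x = sigma * v x].
Proof.
move=> [z psiz]; pose B := dot psi psi.
have Bgt0 : 0 < B.
  rewrite lt0r dot_ge0// andbT; apply: contra psiz => /eqP B0.
  by apply/eqP/(almost_periodic_faithful _ psi_bnd B0).
have Sle f x : bnd f -> dot f f <= 1 -> hankel f x ^+ 2 <= B.
  move=> bf f1; apply: le_trans (hankel_sq_le x bf) _.
  by rewrite -[leRHS]mulr1 ler_wpM2l// ltW.
pose E := [set r | exists g, [/\ bnd g, dot g g <= 1 & r = dot (hankel g) (hankel g)]].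
have supE : has_sup E.
  split; first by exists (dot (hankel (fun=> 0)) (hankel (fun=> 0))), (fun=> 0); split => //;
    [exact: bnd_cst|rewrite /dot (M_ext (g := fun=> 0)) ?M_cst// => x; rewrite mul0r].
  exists B => _ [g [bg g1 ->]]; rewrite -[leRHS]M_cst; apply: M_le.
  - by apply: bndM; exact: hankel_bnd.
  - exact: bnd_cst.
  - by move=> x; rewrite -expr2; exact: Sle.
pose lam := sup E.
have Snorm h : bnd h -> dot (hankel h) (hankel h) <= lam * dot h h.
  move=> bh; have [h0|h0] := eqVneq (dot h h) 0.
    rewrite h0 mulr0 -[leRHS](M_cst 0); apply: M_le => [||x].
    - by apply: bndM; exact: hankel_bnd.
    - exact: bnd_cst.
    - by rewrite -expr2 (le_trans (hankel_sq_le x bh))// h0 mulr0.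
  have hp : 0 < dot h h by rewrite lt0r h0 dot_ge0.
  pose k := (Num.sqrt (dot h h))^-1.
  have k2 : k ^+ 2 = (dot h h)^-1 by rewrite exprVn sqr_sqrtr ?ltW.
  rewrite -ler_pdivrMr// mulrC -k2 -dotZ; last exact: hankel_bnd.
  apply: ub_le_sup; first exact: supE.2.
  exists (fun x => k * h x); split; [exact: bndZ| |by rewrite hankelZ].
  by rewrite dotZ// k2 mulVf.
have lam0 : 0 < lam.
  have bS := hankel_bnd psi_bnd.
  have : 0 < dot (hankel psi) (hankel psi).
    rewrite lt0r dot_ge0// andbT; apply/eqP => D0.
    have := almost_periodic_faithful (hankel_ap psi_bnd) bS D0 0.
    rewrite /hankel (M_ext (g := fun y => psi y * psi y)) => [B0|y].
      by move: Bgt0; rewrite /B /dot B0 ltxx.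
    by rewrite add0r.
  by move=> /lt_le_trans /(_ (Snorm _ psi_bnd)); rewrite pmulr_lgt0.
have /choice[g gP] : forall n : nat, exists g, [/\ bnd g, dot g g <= 1
    & lam - n.+1%:R^-1 < dot (hankel g) (hankel g)].
  move=> n; have n0 : 0 < n.+1%:R^-1 :> R by rewrite invr_gt0 ltr0n.
  have [_ [g [bg g1 ->]] h] := sup_adherent n0 supE.
  by exists g.
have bg n : bnd (g n) by have [] := gP n.
have g1 n : dot (g n) (g n) <= 1 by have [] := gP n.
have bSg n : bnd (hankel (g n)) by exact: hankel_bnd.
have bSSg n : bnd (hankel (hankel (g n))) by exact: hankel_bnd.
pose w n x := 1 * hankel (hankel (g n)) x + (- lam) * g n x.
have bw n : bnd (w n) by apply: bndD; exact: bndZ.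
(* A near maximizer of the form is nearly an eigenfunction. *)
have ww n : dot (w n) (w n) <= lam / n.+1%:R.
  rewrite dot_comb// (dotC _ (w n)) (dotC (g n) (w n)) !dot_comb//.
  rewrite (dotC (g n) (hankel _)) (hankel_sym (bSg n) (bg n)).
  have := Snorm _ (bSg n); have [_ _] := gP n.
  set D := dot (hankel (g n)) (hankel (g n)); set D2 := dot (hankel (hankel _)) _.
  have := g1 n; set D0 := dot (g n) _ => h0 h1 h2.
  have h3 : lam * (lam - n.+1%:R^-1) <= lam * D by rewrite ler_pM2l// ltW.
  have h4 : lam ^+ 2 * D0 <= lam ^+ 2 by rewrite ger_pMr ?exprn_gt0.
  move: h2 h3 h4; move: (n.+1%:R^-1) => q h2 h3 h4.
  have -> : 1 * (1 * D2 + - lam * D) + - lam * (1 * D + - lam * D0) =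
      D2 - 2 * (lam * D) + lam ^+ 2 * D0 by ring.
  move: h3; rewrite mulrBr -expr2; lra.
pose v_ n := hankel (g n).
have Sv n x : (hankel (hankel (v_ n)) x - lam * v_ n x) ^+ 2 <= B * (lam / n.+1%:R).
  have -> : hankel (hankel (v_ n)) x - lam * v_ n x = hankel (w n) x.
    by rewrite hankel_comb// mul1r mulNr.
  by apply: le_trans (hankel_sq_le x (bw n)) _; rewrite ler_wpM2l// ltW.
have [U [UU FU]] := ultraFilterLemma (@eventually_filter).
pose b := Num.sqrt B.
have b0 : 0 <= b by exact: sqrtr_ge0.
have b2 : b ^+ 2 = B by rewrite sqr_sqrtr ?ltW.
have v_b n x : `|v_ n x| <= b.
  by rewrite -ler_sqr ?nnegrE// b2 real_normK ?num_real// Sle.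
pose v x := lim ((fun n => v_ n x) @ U).
have vcvg x : (fun n => v_ n x) @ U --> v x.
  by apply: ultra_bnd_cvg => n; exact: v_b.
have vnear x e : 0 < e -> \forall n \near U, `|v_ n x - v x| <= e.
  by move=> e0; have /cvgrPdistC_le := vcvg x; exact.
have vunif e : 0 < e -> \forall n \near U, forall x, `|v_ n x - v x| <= e.
  move=> e0; have d0 : 0 < e / 5 by rewrite divr_gt0.
  have [s sP] := psi_tb d0.
  have hs : \forall n \near U, forall a, a \in s -> `|v_ n a - v a| <= e / 5.
    by apply: near_all_seq => a; exact: vnear.
  apply: filterS hs => n hn x; have [a sa hxa] := sP x.
  have [m [hx ha]] := filter_ex (filterI (vnear x _ d0) (vnear a _ d0)).
  have h1 k : `|v_ k x - v_ k a| <= e / 5.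
    by apply: hankel_difference_le => //; exact: ltW.
  have := hn _ sa; have := h1 n; have := h1 m; move: hx ha.
  rewrite !ler_norml => /andP[? ?] /andP[? ?] /andP[? ?] /andP[? ?] /andP[? ?].
  by apply/andP; split; lra.
have bv : bnd v.
  exists (b + 1) => x.
  have [n hn] := filter_ex (vnear x 1 ltr01).
  have := v_b n x; move: hn; rewrite !ler_norml => /andP[? ?] /andP[? ?].
  by apply/andP; split; lra.
have invn e : 0 < e -> \forall n \near U, (n.+1%:R^-1 : R) < e.
  by move=> e0; apply: FU; exact: (near_infty_natSinv_lt (PosNum e0)).
exists lam, v; split => //.
  apply: contrapT => /forallNP v0.
  have s2 : 0 < lam / 2 by rewrite divr_gt0.
  have ss2 : 0 < Num.sqrt (lam / 2) by rewrite sqrtr_gt0.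
  have [n [h1 h2]] := filter_ex (filterI (vunif _ ss2) (invn _ s2)).
  have [_ _ h3] := gP n.
  suff : dot (v_ n) (v_ n) <= lam / 2.
    apply/negP; rewrite -ltNge; apply: le_lt_trans h3.
    by rewrite lerBrDr -lerBrDl; apply: le_trans (ltW h2) _; lra.
  rewrite -[leRHS]M_cst; apply: M_le => [||x]; [exact: (bndM (bSg n) (bSg n))|exact: bnd_cst|].
  rewrite -expr2 -[leLHS]real_normK ?num_real// -(sqr_sqrtr (ltW s2)).
  rewrite ler_sqr ?nnegrE ?(ltW ss2)//.
  by have := h1 x; have /negP/negPn/eqP -> := v0 x; rewrite subr0.
move=> x; apply/eqP; rewrite -subr_eq0 -normr_le0; apply/ler_addgt0Pl => e e0.
rewrite addr0; pose d := e / (B + lam + 1).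
have d0 : 0 < d by rewrite divr_gt0// ltr_wpDl// addr_ge0// ltW.
have q0 : 0 < d ^+ 2 / (B * lam) by rewrite divr_gt0 ?exprn_gt0// mulr_gt0.
have [n [h1 h2]] := filter_ex (filterI (vunif _ d0) (invn _ q0)).
pose u y := 1 * v y + (-1) * v_ n y.
have ud y : `|u y| <= d by rewrite /u mul1r mulN1r distrC.
have bu : bnd u by exists d.
have SSu : `|hankel (hankel u) x| <= B * d.
  have Bd : 0 <= B * d by rewrite mulr_ge0// ltW.
  rewrite -ler_sqr ?nnegrE// real_normK ?num_real//.
  have Su y : `|hankel u y| <= b * d.
    have bd : 0 <= b * d by rewrite mulr_ge0// ltW.
    rewrite -ler_sqr ?nnegrE// real_normK ?num_real//.
    by rewrite exprMn b2; exact: hankel_sup.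
  apply: le_trans (hankel_sup Su x) _.
  by rewrite !exprMn b2 -/B le_eqVlt; apply/orP; left; apply/eqP; ring.
have Svn : `|hankel (hankel (v_ n)) x - lam * v_ n x| <= d.
  rewrite -ler_sqr ?nnegrE ?(ltW d0)// real_normK ?num_real//.
  apply: le_trans (Sv n x) _; rewrite mulrA.
  by move: h2; rewrite ltr_pdivlMr ?mulr_gt0// mulrC => /ltW.
have bvn : bnd (v_ n) by exact: bSg.
have -> : hankel (hankel v) x - lam * v x =
    hankel (hankel u) x + (hankel (hankel (v_ n)) x - lam * v_ n x) + lam * (v_ n x - v x).
  rewrite /u hankel_comb// hankel_comb//; [ring|exact: hankel_bnd..].
have := h1 x; have Bd : B * d + d + lam * d = e.
  rewrite /d; field; apply: lt0r_neq0; rewrite ltr_wpDl// addr_ge0// ltW//.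
move=> hx; apply: le_trans (ler_normD _ _) _; rewrite -Bd lerD//.
  by apply: le_trans (ler_normD _ _) _; rewrite lerD.
by rewrite normrM (gtr0_norm lam0) ler_pM2l.
Qed.

Lemma hankel_sum (m : nat) (a : 'I_m -> R) (F : 'I_m -> V -> R) :
  (forall i, bnd (F i)) ->
  hankel (fun x => \sum_i a i * F i x) = fun x => \sum_i a i * hankel (F i) x.
Proof.
move=> bF; apply/funext => x; rewrite /hankel.
rewrite (M_ext (g := fun y => \sum_i a i * (psi (x + y) * F i y))).
  rewrite M_sum => [|i]; last by apply: bndZ; apply: bndM => //; exact: psi_trans.
  by apply: eq_bigr => i _; rewrite MZ//; apply: bndM => //; exact: psi_trans.
by move=> y; rewrite mulr_sumr; apply: eq_bigr => i _; rewrite mulrCA.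
Qed.

Section Eigenspace.
Variable sigma : R.
Hypothesis sigma_gt0 : 0 < sigma.

Definition eigen f := bnd f /\ forall x, hankel (hankel f) x = sigma * f x.

Definition orthonormal (m : nat) (e : 'I_m -> V -> R) :=
  (forall i, eigen (e i)) /\ forall i j, dot (e i) (e j) = (i == j)%:R.

Lemma eigen_sum (m : nat) (a : 'I_m -> R) (e : 'I_m -> V -> R) :
  (forall i, eigen (e i)) -> eigen (fun x => \sum_i a i * e i x).
Proof.
move=> ee; have be i := (ee i).1; split.
  by apply: bnd_sum => i; exact: bndZ.
move=> x; rewrite hankel_sum// hankel_sum => [|i]; last exact: hankel_bnd.
by rewrite mulr_sumr; apply: eq_bigr => i _; rewrite (ee i).2 mulrCA.
Qed.

Lemma eigen_comb (a b : R) f g : eigen f -> eigen g ->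
  eigen (fun x => a * f x + b * g x).
Proof.
move=> [bf ef] [bg eg]; split; first by apply: bndD; exact: bndZ.
move=> x; rewrite hankel_comb// hankel_comb; [|exact: hankel_bnd..].
by rewrite ef eg; ring.
Qed.

Lemma eigen_translate f (a : V) : eigen f -> eigen (fun x => f (x + a)).
Proof.
move=> [bf ef]; split; first exact: (bnd_comp (fun x => x + a)).
move=> x; rewrite hankel_translate// (_ : (fun x => hankel f (x - a)) =
  fun x => hankel f (x + (- a)))// hankel_translate ?opprK; last exact: hankel_bnd.
exact: ef.
Qed.

Lemma eigen_null f : eigen f -> dot f f = 0 -> forall x, f x = 0.
Proof.
move=> [bf ef] f0 x.
have Sf : hankel f = fun=> 0.
  apply/funext => y; apply/eqP; rewrite -sqrf_eq0 eq_le sqr_ge0 andbT.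
  by rewrite (le_trans (hankel_sq_le y bf))// f0 mulr0.
apply/(mulfI (lt0r_neq0 sigma_gt0)); rewrite -ef Sf mulr0 /hankel.
by rewrite -[RHS]M_cst; apply: M_ext => y; rewrite mulr0.
Qed.

(** An orthonormal family of the eigenspace is dominated by its reproducing
    kernel, whose diagonal is bounded; hence the eigenspace has finite
    dimension. *)
Lemma orthonormal_bound (m : nat) (e : 'I_m -> V -> R) : orthonormal e ->
  m%:R <= dot psi psi / sigma.
Proof.
move=> [ee eo]; have be i := (ee i).1.
have Q x : \sum_i e i x * e i x <= dot psi psi / sigma.
  set q := \sum_i _; pose F y := \sum_i e i x * e i y.
  have eF : eigen F by exact: eigen_sum.
  have q0 : 0 <= q by apply: sumr_ge0 => i _; exact: sqr_ge0.
  have FF : dot F F = q.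
    rewrite dot_sum ?eF.1//; last exact: eF.1.
    apply: eq_bigr => i _; congr (_ * _); rewrite dotC dot_sum//.
    rewrite (bigD1 i)//= eo eqxx mulr1 big1 ?addr0// => j ji.
    by rewrite eo (negPf ji) mulr0.
  have SFF : dot (hankel F) (hankel F) = sigma * q.
    rewrite -hankel_sym//; [|exact/hankel_bnd/eF.1|exact: eF.1].
    by rewrite -FF -MZ; [apply: M_ext => y; rewrite eF.2 mulrA
      |apply: bndM; exact: eF.1].
  have := hankel_sq_le x (hankel_bnd eF.1); rewrite SFF eF.2 -/q -[F x]/q.
  have [->|qn] := eqVneq q 0; first by rewrite divr_ge0 ?dot_ge0// ltW.
  have qp : 0 < q by rewrite lt0r qn.
  rewrite exprMn expr2 -mulrA (mulrC (dot _ _)) -(mulrA sigma q).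
  rewrite ler_pM2l// expr2 mulrCA ler_pM2l// mulrC.
  by rewrite ler_pdivlMr.
rewrite -[leRHS](M_cst); apply: le_trans (M_le _ _ Q); last 2 first.
- by apply: bnd_sum => i; exact: bndM.
- exact: bnd_cst.
rewrite M_sum => [|i]; last exact: bndM.
rewrite (eq_bigr (fun=> 1)) => [|i _]; last by have := eo i i; rewrite eqxx.
by rewrite sumr_const card_ord.
Qed.

(** An orthonormal family of maximal length exists by [orthonormal_bound]; it
    spans, because the normalized remainder of an eigenfunction would extend it. *)
Lemma eigen_basis : exists m (e : 'I_m -> V -> R), orthonormal e /\
  forall f, eigen f -> forall x, f x = \sum_i dot f (e i) * e i x.
Proof.
pose P m := `[< exists e : 'I_m -> V -> R, orthonormal e >].
have P0 : exists m, P m.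
  exists 0%N; apply/asboolP; exists (fun i _ => 0).
  by split; case.
have Pbound m : P m -> (m <= Num.truncn (dot psi psi / sigma))%N.
  move=> /asboolP[e oe]; rewrite truncn_ge_nat.
    exact: orthonormal_bound oe.
  by rewrite divr_ge0 ?dot_ge0// ltW.
case: (ex_maxnP P0 Pbound) => m /asboolP[e oe] mmax.
exists m, e; split => // f ef x.
have [ee eo] := oe; have be i := (ee i).1; have bf := ef.1.
pose g y := \sum_i dot f (e i) * e i y.
have eg : eigen g by exact: eigen_sum.
have bg := eg.1.
pose r y := 1 * f y + (-1) * g y.
have er : eigen r by exact: eigen_comb.
have br := er.1.
have ge i : dot g (e i) = dot f (e i).
  rewrite dot_sum// (bigD1 i)//= eo eqxx mulr1 big1 ?addr0// => j ji.
  by rewrite eo (negPf ji) mulr0.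
have re i : dot r (e i) = 0 by rewrite dot_comb// ge; ring.
suff r0 : dot r r = 0.
  have := eigen_null er r0 x; rewrite /r mul1r mulN1r => /subr0_eq; exact.
apply/eqP/negPn/negP => rn.
have rp : 0 < dot r r by rewrite lt0r rn dot_ge0.
pose k := (Num.sqrt (dot r r))^-1.
have k2 : k ^+ 2 = (dot r r)^-1 by rewrite exprVn sqr_sqrtr ?ltW.
pose u y := k * r y.
have eu : eigen u.
  have := eigen_comb k 0 er er.
  by rewrite (_ : (fun y => _) = u)//; apply/funext => y; rewrite mul0r addr0.
have uu : dot u u = 1 by rewrite dotZ// k2 mulVf.
have ue i : dot u (e i) = 0.
  rewrite -(mulr0 k) -(re i) /dot -MZ; last exact: bndM.
  by apply: M_ext => y; rewrite mulrA.
pose e' (i : 'I_m.+1) := if unlift ord_max i is Some j then e j else u.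
suff : (m.+1 <= m)%N by rewrite ltnn.
apply: mmax; apply/asboolP; exists e'; split.
  by move=> i; rewrite /e'; case: unliftP.
move=> i j; rewrite /e'; case: unliftP => [i'|] ->; case: unliftP => [j'|] ->.
- by rewrite eo (inj_eq lift_inj).
- by rewrite dotC ue eq_sym (negPf (neq_lift _ _)).
- by rewrite ue (negPf (neq_lift _ _)).
- by rewrite eqxx.
Qed.

(** Translations act on an orthonormal basis of the eigenspace by commuting
    matrices, and the eigenvalues [mu] of a common complex eigenvector form a
    homomorphism to the nonzero complex numbers, with real part [c] and imaginary
    part [s]. Being bounded it has modulus one, here because its squared modulus
    has a positive mean that translations multiply by its values. *)
Lemma eigen_character : (exists f, eigen f /\ exists x, f x != 0) ->
  exists c s : V -> R, [/\
    forall x y, c (x + y) = c x * c y - s x * s y,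
    forall x y, s (x + y) = s x * c y + c x * s y,
    forall x, c x ^+ 2 + s x ^+ 2 = 1, eigen c & eigen s].
Proof.
move=> [f0 [ef0 [x0 fx0]]].
have [m [e [[ee eo] span]]] := eigen_basis.
have be i := (ee i).1.
have m0 : (0 < m)%N.
  rewrite lt0n; apply: contra fx0 => /eqP m0.
  by rewrite span// big1// => i; move: (ltn_ord i); rewrite {2}m0.
pose D (a : V) := \matrix_(i, j) dot (fun x => e i (x + a)) (e j).
have eD a i x : e i (x + a) = \sum_j D a i j * e j x.
  rewrite (span (fun x => e i (x + a))); last exact: eigen_translate.
  by apply: eq_bigr => j _; rewrite mxE.
have DM a b : D (a + b) = D a *m D b.
  apply/matrixP => i k; rewrite !mxE.
  rewrite (_ : (fun x => e i (x + (a + b))) =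
      fun x => \sum_j D a i j * e j (x + b)).
    rewrite dot_sum//; last by move=> j; exact: (bnd_comp (fun x => x + b)).
    by apply: eq_bigr => j _; rewrite [D b _ _]mxE.
  by apply/funext => x; rewrite (addrC a) addrA eD.
pose rc := @real_complex R : R -> R[i].
have [v [v0 vD]] : exists v : 'rV[R[i]]_m, v != 0 /\
    forall a, exists mu, v *m map_mx rc (D a) = mu *: v.
  apply: commuting_eigenvector => // a b.
  by rewrite -!map_mxM -!DM addrC.
have /choice[mu muP] := vD.
have muM a b : mu (a + b) = mu a * mu b.
  have [j vj] : exists j, v 0 j != 0 by apply/rV0Pn.
  apply: (mulIf vj); have := muP (a + b).
  rewrite DM map_mxM mulmxA muP -scalemxAl muP scalerA mulrC.
  by move/rowP => /(_ j); rewrite !mxE.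
pose p x := \sum_i complex.Re (v 0 i) * e i x.
pose q x := \sum_i complex.Im (v 0 i) * e i x.
have ep : eigen p by exact: eigen_sum.
have eq : eigen q by exact: eigen_sum.
pose c x := complex.Re (mu x); pose s x := complex.Im (mu x).
have vDR a j : \sum_i complex.Re (v 0 i) * D a i j =
    c a * complex.Re (v 0 j) - s a * complex.Im (v 0 j).
  have /rowP/(_ j) := muP a; rewrite !mxE => /(congr1 (@complex.Re R)).
  rewrite raddf_sum/= => h; transitivity (complex.Re (mu a * v 0 j)); last first.
    by rewrite /c /s; case: (mu a) (v 0 j) => ? ? [].
  rewrite -h; apply: eq_bigr => i _; rewrite [map_mx _ _ _ _]mxE.
  by case: (v 0 i) => x y /=; rewrite mulr0 subr0.
have vDI a j : \sum_i complex.Im (v 0 i) * D a i j =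
    s a * complex.Re (v 0 j) + c a * complex.Im (v 0 j).
  have /rowP/(_ j) := muP a; rewrite !mxE => /(congr1 (@complex.Im R)).
  rewrite raddf_sum/= => h; transitivity (complex.Im (mu a * v 0 j)); last first.
    by rewrite /c /s; case: (mu a) (v 0 j) => ? ? [] ? ? /=; rewrite addrC.
  rewrite -h; apply: eq_bigr => i _; rewrite [map_mx _ _ _ _]mxE.
  by case: (v 0 i) => x y /=; rewrite mulr0 add0r.
have pE x a : p (x + a) = c a * p x - s a * q x.
  rewrite /p /q !mulr_sumr -sumrB.
  under eq_bigr do rewrite eD mulr_sumr.
  rewrite exchange_big; apply: eq_bigr => j _ /=.
  by rewrite !mulrA -mulrBl -vDR mulr_suml; apply: eq_bigr => i _; rewrite mulrA.
have qE x a : q (x + a) = s a * p x + c a * q x.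
  rewrite /p /q !mulr_sumr -big_split/=.
  under eq_bigr do rewrite eD mulr_sumr.
  rewrite exchange_big; apply: eq_bigr => j _ /=.
  by rewrite !mulrA -mulrDl -vDI mulr_suml; apply: eq_bigr => i _; rewrite mulrA.
pose N0 := p 0 ^+ 2 + q 0 ^+ 2.
have N0_neq0 : N0 != 0.
  apply/negP; rewrite paddr_eq0 ?sqr_ge0// !sqrf_eq0 => /andP[/eqP p0 /eqP q0].
  have dotv (w : 'I_m -> R) j : dot (fun x => \sum_i w i * e i x) (e j) = w j.
    rewrite dot_sum// (bigD1 j)//= eo eqxx mulr1 big1 ?addr0// => i ij.
    by rewrite eo (negPf ij) mulr0.
  have pz x : p x = 0 by rewrite -(add0r x) pE p0 q0 !mulr0 subrr.
  have qz x : q x = 0 by rewrite -(add0r x) qE p0 q0 !mulr0 addr0.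
  move/rV0Pn : v0 => [j]; apply/negP; rewrite negbK.
  have : complex.Re (v 0 j) = 0.
    rewrite -(dotv (fun i => complex.Re (v 0 i)) j) -[RHS]M_cst.
    by apply: M_ext => x; rewrite -/(p x) pz mul0r.
  have : complex.Im (v 0 j) = 0.
    rewrite -(dotv (fun i => complex.Im (v 0 i)) j) -[RHS]M_cst.
    by apply: M_ext => x; rewrite -/(q x) qz mul0r.
  by case: (v 0 j) => ? ? /= -> ->.
have cE : c = fun a => (p 0 / N0) * p a + (q 0 / N0) * q a.
  apply/funext => a; rewrite -[a in RHS]add0r pE qE /N0; field.
  exact: N0_neq0.
have sE : s = fun a => (- q 0 / N0) * p a + (p 0 / N0) * q a.
  apply/funext => a; rewrite -[a in RHS]add0r pE qE /N0; field.
  exact: N0_neq0.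
have ec : eigen c by rewrite cE; exact: eigen_comb.
have es : eigen s by rewrite sE; exact: eigen_comb.
have cD x y : c (x + y) = c x * c y - s x * s y.
  by rewrite /c /s muM; case: (mu x) (mu y) => ? ? [].
have sD x y : s (x + y) = s x * c y + c x * s y.
  by rewrite /c /s muM; case: (mu x) (mu y) => ? ? [] ? ? /=; rewrite addrC.
have c0 : c 0 = 1 by rewrite cE mulrAC -!expr2 (mulrAC (q 0)) -mulrDl -!expr2 divff.
have s0 : s 0 = 0 by rewrite sE; ring.
pose N x := c x * c x + s x * s x.
have NM x y : N (x + y) = N y * N x by rewrite /N cD sD; ring.
have bN : bnd N by apply: bndD; apply: bndM; rewrite ?ec.1 ?es.1//; exact: ec.1 || exact: es.1.
have NV x : N x * N (- x) = 1.
  by rewrite -NM addNr /N c0 s0; ring.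
have N_ge0 x : 0 <= N x by rewrite addr_ge0// -expr2 sqr_ge0.
have [K NK] := bN.
have K0 : 0 < K.
  apply: lt_le_trans (NK 0); rewrite normr_gt0; apply/eqP => N00.
  by have := NV 0; rewrite N00 mul0r => /esym/eqP; rewrite oner_eq0.
have MN : 0 < M N.
  apply: (@lt_le_trans _ _ K^-1); first by rewrite invr_gt0.
  rewrite -[leLHS]M_cst; apply: M_le; [exact: bnd_cst|by []|].
  move=> x; rewrite -[leLHS]mul1r ler_pdivrMr// -(NV x) ler_wpM2l//.
  exact: le_trans (ler_norm _) (NK _).
exists c, s; split; [exact: cD|exact: sD| |exact: ec|exact: es] => x.
have : N x * M N = M N.
  by rewrite -MZ// -[RHS](M_translate x bN); apply: M_ext => y; rewrite NM.
rewrite -[RHS]mul1r => /(mulIf (lt0r_neq0 MN)).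
by rewrite /N -!expr2.
Qed.

End Eigenspace.

(** The eigenvalue equation forces the Fourier coefficient of [psi] at the
    character to be nonzero. *)
Theorem character_of_function : (exists z, psi z != 0) ->
  exists c s : V -> R, [/\
    forall x y, c (x + y) = c x * c y - s x * s y,
    forall x y, s (x + y) = s x * c y + c x * s y,
    forall x, c x ^+ 2 + s x ^+ 2 = 1, bnd c /\ bnd s
    & dot psi c != 0 \/ dot psi s != 0].
Proof.
move=> /hankel_eigenfunction[sigma [v [sigma0 bv vn ev]]].
have [|c [s [cD sD cs ec es]]] := @eigen_character sigma sigma0.
  by exists v.
exists c, s; split => //; first by split; [exact: ec.1|exact: es.1].
apply/orP; rewrite -negb_and; apply/negP => /andP[/eqP al /eqP be].
have c0 : c 0 = 1.
  have := cs 0; have := cD 0 0; have := sD 0 0; rewrite addr0; nra.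
have s0 : s 0 = 0 by have := cs 0; rewrite c0; nra.
have cN x : c (- x) = c x.
  have := cD x (- x); have := sD x (- x); rewrite subrr c0 s0 => e1 e2.
  rewrite -[LHS]mul1r -(cs x).
  rewrite (_ : _ * _ = c x * (c x * c (- x) - s x * s (- x)) +
    s x * (s x * c (- x) + c x * s (- x))); last by ring.
  by rewrite -e1 -e2; ring.
have sN x : s (- x) = - s x.
  have := cD x (- x); have := sD x (- x); rewrite subrr c0 s0 => e1 e2.
  rewrite -[LHS]mul1r -(cs x).
  rewrite (_ : _ * _ = c x * (s x * c (- x) + c x * s (- x)) -
    s x * (c x * c (- x) - s x * s (- x))); last by ring.
  by rewrite -e1 -e2; ring.
have Sc : hankel c = fun=> 0.
  apply/funext => x; rewrite /hankel.
  rewrite (M_ext (g := fun y => c x * (psi (x + y) * c (x + y)) +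
      s x * (psi (x + y) * s (x + y)))); last first.
    move=> y; have -> : c y = c x * c (x + y) + s x * s (x + y).
      by rewrite -{1}(addKr x y) cD cN sN; ring.
    ring.
  have b1 := bnd_comp (fun y => y + x) (bndM psi_bnd ec.1).
  have b2 := bnd_comp (fun y => y + x) (bndM psi_bnd es.1).
  rewrite (M_ext (g := fun y => c x * (psi (y + x) * c (y + x)) +
      s x * (psi (y + x) * s (y + x)))); last first.
    by move=> y; rewrite (addrC y).
  rewrite M_comb// (M_translate x (bndM psi_bnd ec.1)).
  rewrite (M_translate x (bndM psi_bnd es.1)).
  by rewrite -/(dot psi c) -/(dot psi s) al be; ring.
have := ec.2 0; rewrite c0 mulr1 Sc /hankel.
rewrite (M_ext (g := fun=> 0)) ?M_cst => [|y]; last by rewrite mulr0.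
by move=> /esym/eqP; rewrite gt_eqF.
Qed.

End Convolution.

Section Angle.
Variable R : realType.
Local Notation T := (circle R).

Lemma angle_exists (c s : R) : c ^+ 2 + s ^+ 2 = 1 ->
  exists t : R, cos (2 * pi * t) = c /\ sin (2 * pi * t) = s.
Proof.
move=> cs1.
have p0 : 2 * pi != 0 :> R by rewrite mulf_neq0 ?pnatr_eq0// gt_eqF ?pi_gt0.
have c1 : -1 <= c <= 1.
  by rewrite -ler_norml -(ler_pXn2r (n := 2)) ?nnegrE// expr1n
    real_normK ?num_real// -cs1 lerDl sqr_ge0.
have s2 : s ^+ 2 = 1 - c ^+ 2 by rewrite -cs1 addrC addKr.
have [s0|s0] := leP 0 s.
  exists (acos c / (2 * pi)); rewrite mulrC divfK// acosK ?in_itv//=.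
  by rewrite sin_acos// -s2 sqrtr_sqr ger0_norm.
exists (- acos c / (2 * pi)); rewrite mulrC divfK// cosN sinN acosK ?in_itv//=.
by rewrite sin_acos// -s2 sqrtr_sqr ltr0_norm// opprK.
Qed.

Lemma cosD_int (x : R) (k : int) : cos (2 * pi * (x + k%:~R)) = cos (2 * pi * x).
Proof.
have D n (y : R) : cos (2 * pi * (y + n%:R)) = cos (2 * pi * y).
  elim: n => [|n IH]; first by rewrite addr0.
  rewrite -(natr1 n) addrA mulrDr mulr1 -[in RHS]IH.
  by rewrite [X in _ + X](mulr_natl pi 2) cosD2pi.
case: k => n; first exact: D.
by rewrite NegzE -[in RHS](subrK (n.+1%:R) x) D mulrNz.
Qed.

Lemma cos_angle_pr (x : R) : cos (2 * pi * `|angle (pr x)|) = cos (2 * pi * x).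
Proof.
have /pr_eq[k kE] : pr x = pr (angle (pr x)) by rewrite angleK.
rewrite -[in RHS](subrKC (angle (pr x)) x) kE cosD_int.
rewrite -[LHS]cos_norm -[RHS]cos_norm; congr cos.
by rewrite !normrM normr_id.
Qed.

(** Since cosine is decreasing on [[0, pi]], the distance of an angle to zero
    is controlled by its cosine. *)
Lemma cos_gt_angle (x e : R) : 0 < e < 2^-1 ->
  cos (2 * pi * e) < cos (2 * pi * x) -> `|angle (pr x)| < e.
Proof.
move=> /andP[e0 e1]; rewrite -(cos_angle_pr x).
have p0 : 0 < 2 * pi :> R by rewrite mulr_gt0 ?pi_gt0.
have I (y : R) : 0 <= y -> y <= 2^-1 -> 2 * pi * y \in `[0, pi].
  move=> y0 y1; rewrite in_itv/=; apply/andP; split.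
    by apply: mulr_ge0 => //; exact: ltW.
  by have := ler_wpM2l (ltW p0) y1; rewrite [leRHS]mulrAC divff ?mul1r ?pnatr_eq0.
have Ie := I _ (ltW e0) (ltW e1).
have Ix := I _ (normr_ge0 _) (norm_angle_le (pr x)).
by rewrite (ltr_cos Ix Ie) ltr_pM2l.
Qed.

Lemma cos1_pr0 (x : R) : cos (2 * pi * x) = 1 -> pr x = 0.
Proof.
move=> c1; apply/angle_eq0/normr0_eq0/eqP.
rewrite eq_le normr_ge0 andbT; apply/ler_addgt0Pl => e e0; rewrite addr0.
pose d := Num.min e 4^-1.
have d0 : 0 < d by rewrite lt_min e0 invr_gt0 ltr0n.
have dle : d <= 4^-1 by rewrite ge_min lexx orbT.
apply: (@le_trans _ _ d); last by rewrite ge_min lexx.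
apply/ltW/cos_gt_angle; first by rewrite d0 (le_lt_trans dle)//; lra.
rewrite c1 -[ltRHS]cos0; have p0 : 0 < 2 * pi :> R by rewrite mulr_gt0 ?pi_gt0.
have I0 : 0 \in `[0, (pi : R)] by rewrite in_itv/= lexx pi_ge0.
have I1 : 2 * pi * d \in `[0, (pi : R)].
  rewrite in_itv/=; apply/andP; split.
    by apply: mulr_ge0; exact: ltW.
  by have := ler_wpM2l (ltW p0) dle; have := pi_ge0 R; lra.
by rewrite (ltr_cos I0 I1) mulr_gt0.
Qed.

End Angle.

Section CompactGroup.
Variables (R : realType) (H : topologicalZmodType).
Hypothesis cH : compact [set: H].
Implicit Type phi : H -> R.

Lemma addl_cvg (a x : H) : (fun d => a + d) @ x --> a + x.
Proof.
by apply: (@cvg_comp _ _ _ (fun d => (a, d)) (fun p => p.1 + p.2) _ (nbhs (a, x)));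
  [apply: cvg_pair; [exact: cvg_cst|exact: cvg_id]
  |exact: (@add_continuous H (a, x))].
Qed.

Lemma uniformly_continuous phi (e : R) : continuous phi -> 0 < e ->
  \forall d \near (0 : H), forall x, `|phi (x + d) - phi x| <= e.
Proof.
move=> cphi e0.
suff : \forall d \near (0 : H), forall x, [set: H] x ->
    `|phi (x + d) - phi x| <= e.
  by apply: filterS => d h x; exact: h.
apply: compact_tube => // x _.
have e2 : 0 < e / 2 by rewrite divr_gt0.
have /cvgrPdist_lt/(_ _ e2) c1 := cphi x.
have c2 : \forall x' \near x & d \near (0 : H), `|phi x - phi (x' + d)| < e / 2.
  have : (fun p : H * H => p.1 + p.2) @ (x, 0 : H) --> x.
    by have := @add_continuous H (x, 0); rewrite /continuous_at /= addr0.
  by move=> /(_ _ c1).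
have c1' : \forall x' \near x & d \near (0 : H), `|phi x - phi x'| < e / 2.
  exists ([set x' | `|phi x - phi x'| < e / 2], setT) => [|[x' d] []//].
  by split => //=; exact: filterT.
apply: filterS2 c1' c2 => -[x' d] /= h1 h2.
rewrite -(subrKA (phi x)) (le_trans (ler_normD _ _))// (splitr e) lerD// ltW//.
by rewrite distrC.
Qed.

Lemma continuous_almost_periodic phi : continuous phi -> almost_periodic phi.
Proof.
move=> cphi e e0.
have [x _|s sP] := @compact_finite_cover H setT H
    (fun a x => forall y, `|phi (x + y) - phi (a + y)| <= e) cH; last first.
  by exists s => x; exact: sP.
exists x; have xx : (fun x' => - x + x') @ x --> (0 : H).
  by have := @addl_cvg (- x) x; rewrite addNr.
have : \forall x' \near x, forall z, `|phi (z + (- x + x')) - phi z| <= e.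
  exact: (xx _ (uniformly_continuous cphi e0)).
apply: filterS => x' h y.
have := h (x + y); rewrite (_ : x + y + (- x + x') = x' + y)//.
by rewrite addrA (addrC (x + y)) addKr addrC.
Qed.

Lemma continuous_bnd phi : continuous phi -> bnd phi.
Proof.
move=> cphi; have [s sP] := continuous_almost_periodic cphi ltr01.
exists (\sum_(a <- s) `|phi a| + 1) => x.
have [a sa /(_ 0)] := sP x; rewrite !addr0 => h.
rewrite (big_rem a)//= -addrA.
have := ler_normD (phi a) (phi x - phi a); rewrite subrKC => h1.
have : 0 <= \sum_(y <- rem a s) `|phi y| by exact: sumr_ge0.
lra.
Qed.

(** The character [chi] is found in the spectrum of the difference [psi] of [phi]
    and of its translate by [x0]. Its Fourier coefficient for [psi] is nonzero:
    this makes [chi] continuous, as the coefficient of a translate of [psi] is a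
    continuous function of the translation; it makes [chi x0] nonzero, as
    otherwise the coefficients of [phi] and of its translate would cancel; and it
    makes [chi] trivial on the periods of [phi]. The last point gives the
    characters of a quotient group without forming the quotient. *)
Theorem compact_character phi (x0 : H) : continuous phi ->
  phi x0 != phi 0 -> exists chi : H -> circle R,
    [/\ {morph chi : x y / x + y}, continuous chi, chi x0 != 0
      & forall d, (forall x, phi (x + d) = phi x) -> chi d = 0].
Proof.
move=> cphi phi0.
have [M [Mc Mge0 Mcst Mtr]] := @invariant_mean R H.
have bphi := continuous_bnd cphi.
pose psi x := phi x - phi (x + x0).
have cpsi : continuous psi.
  move=> x; apply: cvgB; first exact: cphi.
  apply: (@cvg_comp _ _ _ (fun y => y + x0) phi _ (nbhs (x + x0))).
    rewrite addrC (_ : (fun y => y + x0) = fun y => x0 + y).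
      exact: addl_cvg.
    by apply/funext => y; rewrite addrC.
  exact: cphi.
have bpsi := continuous_bnd cpsi.
have [|c [s [cD sD cs [bc bs] ab]]] :=
    character_of_function Mc Mge0 Mcst Mtr bpsi (continuous_almost_periodic cpsi).
  by exists 0; rewrite /psi add0r subr_eq0 eq_sym.
have /choice[t tP] : forall x, exists t : R,
    cos (2 * pi * t) = c x /\ sin (2 * pi * t) = s x.
  by move=> x; apply: angle_exists; exact: cs.
pose chi x : circle R := pr (t x).
have chiD : {morph chi : x y / x + y}.
  move=> x y; apply/subr0_eq; rewrite /chi -prD -prB; apply: cos1_pr0.
  rewrite (mulrBr (2 * pi)) cosB !(mulrDr (2 * pi)) cosD sinD !(tP _).1 !(tP _).2.
  by rewrite -cD -sD -!expr2 cs.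
have c1 x : chi x = 0 -> c x = 1 /\ s x = 0.
  move=> /pr_eq0[k tk]; have c1 : c x = 1.
    by rewrite -(tP x).1 tk -(add0r k%:~R) cosD_int mulr0 cos0.
  split=> //; apply/eqP; rewrite -sqrf_eq0.
  by have := cs x; rewrite c1 expr1n -[RHS]addr0 => /addrI ->.
have bM (f g : H -> R) : bnd f -> bnd g -> bnd (fun x => f x * g x).
  exact: bndM.
(* The Fourier coefficient of a translate is that of the function, rotated. *)
have rot f a : bnd f ->
   M (fun x => f (x + a) * c x) =
     c a * M (fun x => f x * c x) + s a * M (fun x => f x * s x) /\
   M (fun x => f (x + a) * s x) =
     c a * M (fun x => f x * s x) - s a * M (fun x => f x * c x).
  move=> bf.
  have cE x : c x = c a * c (x + a) + s a * s (x + a).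
    rewrite cD sD -[LHS]mul1r -(cs a); ring.
  have sE x : s x = c a * s (x + a) + (- s a) * c (x + a).
    rewrite cD sD -[LHS]mul1r -(cs a); ring.
  rewrite -(Mtr _ a (bM f c bf bc)) -(Mtr _ a (bM f s bf bs)) -mulNr.
  have b1 := bnd_comp (fun x => x + a) (bM f c bf bc).
  have b2 := bnd_comp (fun x => x + a) (bM f s bf bs).
  rewrite -!Mc//.
  split; congr M; apply/funext => x; first by rewrite cE; ring.
  by rewrite sE; ring.
have psiM (g : H -> R) : bnd g -> M (fun x => psi x * g x) =
    M (fun x => phi x * g x) - M (fun x => phi (x + x0) * g x).
  move=> bg; rewrite -(MB Mc); [|exact: bM|].
    by congr M; apply/funext => x; rewrite -mulrBl.
  by apply: bM => //; exact: (bnd_comp (fun x => x + x0)).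
exists chi; split => //.
- pose al := M (fun x => psi x * c x); pose be := M (fun x => psi x * s x).
  pose N := al ^+ 2 + be ^+ 2.
  have N0 : N != 0.
    rewrite /N paddr_eq0 ?sqr_ge0// !sqrf_eq0 negb_and; exact/orP.
  pose A a := M (fun x => psi (x + a) * c x).
  pose B a := M (fun x => psi (x + a) * s x).
  have cvgAB (g : H -> R) : bnd g -> (fun a => M (fun x => psi (x + a) * g x)) @
      (0 : H) --> M (fun x => psi x * g x).
    move=> bg; have [C gC] := bg; apply/cvgrPdist_le => e e0.
    have C0 : 0 <= C := le_trans (normr_ge0 _) (gC 0).
    have d0 : 0 < e / (C + 1) by rewrite divr_gt0// ltr_wpDl.
    apply: filterS (uniformly_continuous cpsi d0) => a h.
    rewrite -(MB Mc); [|exact: bM|]; last first.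
      by apply: bM => //; exact: (bnd_comp (fun x => x + a)).
    apply: (M_norm_le Mc Mge0 Mcst) => x; rewrite -mulrBl normrM distrC.
    apply: le_trans (ler_pM _ _ (h x) (gC x)) _ => //.
    by rewrite mulrAC ler_pdivrMr ?ltr_wpDl// ler_pM2l// lerDl.
  have cE : c = fun a => (al * A a + be * B a) / N.
    apply/funext => a; rewrite /A /B (rot psi a bpsi).1 (rot psi a bpsi).2.
    by rewrite -/al -/be /N; field.
  have ccvg : c @ (0 : H) --> (1 : R).
    rewrite -(divff N0) {1}cE {1}/N; apply: cvgMl.
    apply: cvgD; apply: cvgMr; exact: cvgAB.
  have chi0 : chi @ (0 : H) --> (0 : circle R).
    apply: cvg_circle => e e0; pose d := Num.min e 4^-1.
    have d0 : 0 < d by rewrite lt_min e0 invr_gt0 ltr0n.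
    have dle : d <= 4^-1 by rewrite ge_min lexx orbT.
    have d2 : 0 < d < 2^-1 by rewrite d0 (le_lt_trans dle)//; lra.
    have cd1 : cos (2 * pi * d) < 1.
      rewrite lt_neqAle cos_le1 andbT; apply/eqP => /cos1_pr0 prd.
      have := @angle_pr R d; rewrite prd angle0 => h.
      by move: d0; rewrite -h ?ltxx//; lra.
    have cd2 : 0 < 1 - cos (2 * pi * d) by rewrite subr_gt0.
    have /cvgrPdist_lt/(_ _ cd2) := ccvg; apply: filterS => x hx.
    rewrite subr0 (@lt_le_trans _ _ d)//; last by rewrite ge_min lexx.
    apply: cos_gt_angle => //; rewrite (tP x).1.
    by move: hx; rewrite ltr_norml => /andP[]; lra.
  move=> x; have xx : (fun y => - x + y) @ x --> (0 : H).
    by have := @addl_cvg (- x) x; rewrite addNr.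
  apply: cvg_circle => e e0.
  have h1 : \forall y \near (0 : H), `|angle (chi y)| < e.
    have : \forall y \near (0 : H), `|angle (chi y - 0)| < e.
      exact: (chi0 _ (angle_near 0 e0)).
    apply: filterS => y.
    by rewrite subr0.
  have : \forall y \near x, `|angle (chi (- x + y))| < e by exact: (xx _ h1).
  apply: filterS => y.
  suff -> : chi y - chi x = chi (- x + y) by [].
  by rewrite -{1}(addNKr x y) chiD addrC addKr.
- apply/eqP => /c1[cx0 sx0].
  move: ab; rewrite /dot (psiM c bc) (psiM s bs).
  rewrite (rot phi x0 bphi).1 (rot phi x0 bphi).2 cx0 sx0 !mul1r !mul0r addr0.
  by rewrite subr0 !subrr eqxx => -[].
- move=> d dP; apply: cos1_pr0; rewrite (tP d).1.
  have [] := rot phi d bphi; rewrite (_ : (fun x => phi (x + d) * c x) =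
    (fun x => phi x * c x)); last by apply/funext => x; rewrite dP.
  rewrite (_ : (fun x => phi (x + d) * s x) =
    (fun x => phi x * s x)); last by apply/funext => x; rewrite dP.
  set P := M (fun x => phi x * c x); set Q := M (fun x => phi x * s x).
  move=> e1 e2.
  have PQ : P ^+ 2 + Q ^+ 2 != 0.
    rewrite paddr_eq0 ?sqr_ge0// !sqrf_eq0; apply/negP => /andP[/eqP P0 /eqP Q0].
    have [r1 r2] := rot phi x0 bphi.
    move: ab; rewrite /dot (psiM c bc) (psiM s bs) r1 r2 -/P -/Q P0 Q0.
    by rewrite !(mulr0, addr0, subr0) eqxx => -[].
  apply: (mulIf PQ); rewrite mul1r.
  transitivity ((c d * P + s d * Q) * P + (c d * Q - s d * P) * Q); first by ring.
  by rewrite -e1 -e2 !expr2.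
Qed.

End CompactGroup.

(** * Subgroups of free abelian groups *)

Lemma well_founded_order (X : eqType) : exists le : rel X,
  [/\ reflexive le, antisymmetric le, transitive le, total le &
    forall P : X -> Prop,
      (forall x, (forall y, le y x -> y != x -> P y) -> P x) -> forall x, P x].
Proof.
have [le wo] := wochoice.well_ordering_principle X.
have min (A : pred X) x : A x -> exists m, A m /\ forall y, A y -> le m y.
  move=> Ax; have [|m [[Am mle] _]] := wo A; first by exists x.
  by exists m.
have refl : reflexive le.
  move=> x; have [m [/eqP -> h]] := min (pred1 x) x (eqxx x).
  by apply: h; rewrite /= eqxx.
have tot : total le.
  move=> x y; have [|m [/= /pred2P[]-> h]] := min (pred2 x y) x.
  - by rewrite /= eqxx.
  - by rewrite h//= eqxx orbT.
  - by rewrite [le y x]h ?orbT//= eqxx.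
have anti : antisymmetric le.
  move=> x y /andP[xy yx].
  have [|m [_ uniqm]] := wo (pred2 x y); first by exists x; rewrite inE eqxx.
  have mx : wochoice.minimum_of le (pred2 x y) x.
    by split; [rewrite inE eqxx|move=> z /pred2P[]->].
  have my : wochoice.minimum_of le (pred2 x y) y.
    by split; [rewrite inE eqxx orbT|move=> z /pred2P[]->].
  by rewrite -(uniqm _ mx) -(uniqm _ my).
have trans : transitive le.
  move=> y x z xy yz.
  have [|m [/= /or3P[]/eqP-> h]] := min (pred3 x y z) x.
  - by rewrite /= eqxx.
  - by apply: h; rewrite /= eqxx !orbT.
  - have yx : le y x by apply: h; rewrite /= eqxx.
    by rewrite (anti x y)// xy yx.
  - have zy : le z y by apply: h; rewrite /= eqxx orbT.
    by rewrite (anti z y)// zy yz.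
exists le; split => // P Pind x; apply: contrapT => nPx.
have [|m [/= /asboolP nPm h]] := min (fun y => `[< ~ P y >]) x.
  exact/asboolP.
apply: nPm; apply: Pind => y ym ynm; apply: contrapT => nPy.
have my : le m y by apply: h; exact/asboolP.
by move/eqP : ynm; apply; apply: anti; rewrite ym my.
Qed.

Lemma max_seq (X : eqType) (le : rel X) (s : seq X) : reflexive le ->
  transitive le -> total le -> s != [::] ->
  exists2 m, m \in s & forall y, y \in s -> le y m.
Proof.
move=> refl trans tot; elim: s => // x [|z s] IH _.
  by exists x; rewrite ?inE// => y; rewrite inE => /eqP->.
have [//|m ms mle] := IH; have [xm|mx] := orP (tot x m).
  exists m; first by rewrite inE ms orbT.
  by move=> y; rewrite inE => /predU1P[->//|]; exact: mle.
exists x; first by rewrite inE eqxx.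
move=> y; rewrite inE => /predU1P[->//|/mle ym].
exact: trans ym mx.
Qed.

Section FreeSubgroup.
Variables (X : eqType) (W : zmodType) (A : set W) (nu : W -> X -> int).
Hypothesis A0 : A 0.
Hypothesis AB : forall a b, A a -> A b -> A (a - b).
Hypothesis nuB : forall a b x, A a -> A b -> nu (a - b) x = nu a x - nu b x.
Hypothesis nu_fin : forall a, A a -> exists s : seq X,
  forall x, nu a x != 0 -> x \in s.
Hypothesis nu_inj : forall a, A a -> (forall x, nu a x = 0) -> a = 0.

Let nu0 x : nu 0 x = 0.
Proof. by rewrite -(subrr 0) nuB// subrr. Qed.

Let AN a : A a -> A (- a).
Proof. by move=> Aa; rewrite -sub0r; exact: AB. Qed.

Let nuN a x : A a -> nu (- a) x = - nu a x.
Proof. by move=> Aa; rewrite -sub0r nuB// nu0 sub0r. Qed.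

Let AD a b : A a -> A b -> A (a + b).
Proof. by move=> Aa Ab; rewrite -(opprK b); apply: AB => //; exact: AN. Qed.

Let nuD a b x : A a -> A b -> nu (a + b) x = nu a x + nu b x.
Proof.
by move=> Aa Ab; have := AN Ab => ANb; rewrite -{1}(opprK b) nuB// nuN// opprK.
Qed.

Let AMn a n : A a -> A (a *+ n) /\ forall x, nu (a *+ n) x = nu a x *+ n.
Proof.
move=> Aa; elim: n => [|n [IH1 IH2]]; first by rewrite mulr0n; split.
split; first by rewrite mulrS; exact: AD.
by move=> x; rewrite mulrS nuD// IH2 mulrS.
Qed.

Let AMz a k : A a -> A (a *~ k) /\ forall x, nu (a *~ k) x = nu a x * k.
Proof.
move=> Aa; have [An nun] : A (a *+ `|k|%N) /\
    forall x, nu (a *+ `|k|%N) x = nu a x *+ `|k|%N by exact: AMn.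
case: k An nun => n /= An nun.
  by rewrite -pmulrn; split => // x; rewrite nun -mulr_natr natz.
rewrite NegzE mulrNz -pmulrn; split; first exact: AN.
by move=> x; rewrite nuN// nun mulrN -mulr_natr natz.
Qed.

Let A_sum (s : seq X) (b : X -> W) (k : X -> int) :
  (forall x, x \in s -> A (b x)) ->
  A (\sum_(x <- s) b x *~ k x) /\
  forall y, nu (\sum_(x <- s) b x *~ k x) y = \sum_(x <- s) nu (b x) y * k x.
Proof.
elim: s => [|x s IH] Ab.
  by rewrite big_nil; split => // y; rewrite big_nil.
have [|As nus] := IH; first by move=> y ys; apply: Ab; rewrite inE ys orbT.
have [Ax nux] := AMz (k x) (Ab x (mem_head _ _)).
rewrite big_cons; split; first exact: AD.
by move=> y; rewrite big_cons nuD// nux nus.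
Qed.

(** The subgroup theorem for free abelian groups, for a group [A] embedded by
    coordinates [nu] of finite support. The index set is well ordered. For each
    index [x], the values at [x] of the elements of [A] whose support ends at [x]
    form an ideal of the integers; [b x] realizes its generator, whenever the
    ideal is nonzero. Subtracting multiples of the [b x] shortens the support, so
    they generate [A] by well-founded induction, and they are independent because
    their last indices are distinct. *)
Theorem free_subgroup : exists (good : set X) (b : X -> W),
  [/\ forall x, good x -> A (b x),
      forall P : set W, P 0 -> (forall a c, P a -> P c -> P (a - c)) ->
        (forall x, good x -> P (b x)) -> A `<=` P
    & forall (s : seq X) (k : X -> int), uniq s ->
        (forall x, x \in s -> good x) -> \sum_(x <- s) b x *~ k x = 0 ->
        forall x, x \in s -> k x = 0].
Proof.
have [le [refl anti trans tot lind]] := well_founded_order X.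
have max s := @max_seq X le s refl trans tot.
pose below x a := A a /\ forall y, nu a y != 0 -> le y x.
pose good x := exists2 a, below x a & nu a x != 0.
have bP x : exists a, good x -> [/\ below x a, nu a x != 0 &
    forall c, below x c -> exists q : int, nu c x = nu a x * q].
  have [gx|] := pselect (good x); last by exists 0.
  pose Q n := `[< exists2 a, below x a & (0 < n)%N && (`|nu a x|%N == n) >].
  have exQ : exists n, Q n.
    have [a ba ax] := gx; exists `|nu a x|%N; apply/asboolP; exists a => //.
    by rewrite absz_gt0 ax eqxx.
  case: (ex_minnP exQ) => n /asboolP[a ba /andP[n0 /eqP an]] nmin.
  have ax0 : nu a x != 0 by rewrite -absz_gt0 an.
  exists a => _; split => // c bc; exists (nu c x %/ nu a x)%Z.
  rewrite {1}(divz_eq (nu c x) (nu a x)) mulrC.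
  suff -> : (nu c x %% nu a x)%Z = 0 by rewrite addr0.
  apply/eqP/negPn/negP => r0.
  set q := (nu c x %/ nu a x)%Z.
  have [Aq nuq] := AMz q ba.1.
  have rE : nu (c - a *~ q) x = (nu c x %% nu a x)%Z.
    by rewrite (nuB _ bc.1 Aq) nuq /modz mulrC.
  have : Q `|(nu c x %% nu a x)%Z|%N.
    apply/asboolP; exists (c - a *~ q); last by rewrite rE absz_gt0 r0 eqxx.
    split; first by apply: AB => //; exact: bc.1.
    move=> y; rewrite (nuB _ bc.1 Aq) nuq => h.
    have [cy|] := eqVneq (nu c y) 0; last exact: bc.2.
    apply: ba.2; apply: contra h => /eqP ->.
    by rewrite cy mul0r subrr.
  move=> /nmin; rewrite leqNgt => /negP; apply.
  by rewrite -an -ltz_nat !abszE ger0_norm ?modz_ge0 ?ltz_mod.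
have /choice[b bgood] := bP.
exists good, b; split.
- by move=> x /bgood[[]].
- move=> P P0 PB Pb.
  have PN a : P a -> P (- a) by move=> Pa; rewrite -sub0r; exact: PB.
  have PD a c : P a -> P c -> P (a + c).
    by move=> Pa Pc; rewrite -(opprK c); apply: PB => //; exact: PN.
  have PM a (k : int) : P a -> P (a *~ k).
    move=> Pa; have PMn n : P (a *+ n).
      by elim: n => [|n IH]; rewrite ?mulr0n ?mulrS//; exact: PD.
    by case: k => n; rewrite ?NegzE ?mulrNz -pmulrn//; exact: PN.
  suff main x a : below x a -> P a.
    move=> a Aa; have [s sP] := nu_fin Aa.
    have [s0|s0] := eqVneq s [::].
      rewrite (nu_inj Aa)// => x; apply/eqP/negPn/negP => /sP.
      by rewrite s0.
    have [m _ mle] := max _ s0; apply: (main m); split => // y /sP.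
    exact: mle.
  move: x a; apply: lind => x IH.
  have IH' a : below x a -> nu a x = 0 -> P a.
    move=> [Aa ax] a0; have [s sP] := nu_fin Aa.
    pose s' := [seq y <- s | nu a y != 0].
    have [s0|/max[m]] := eqVneq s' [::].
      rewrite (nu_inj Aa)// => y; apply/eqP/negPn/negP => ay.
      have : y \in s' by rewrite mem_filter ay sP.
      by rewrite s0.
    rewrite mem_filter => /andP[am _] mle; apply: (IH m).
    - exact: ax.
    - by apply: contra am => /eqP ->; rewrite a0.
    - split=> // y ay; apply: mle; rewrite mem_filter ay; exact: sP.
  move=> a ba; have [a0|a0] := eqVneq (nu a x) 0; first exact: IH'.
  have gx : good x by exists a.
  have [bb b0 bdiv] := bgood x gx.
  have [q qE] := bdiv a ba.
  have [Aq nuq] := AMz q bb.1.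
  rewrite -(subrK (b x *~ q) a); apply: PD; last by apply: PM; exact: Pb.
  apply: IH'; last by rewrite (nuB _ ba.1 Aq) nuq qE subrr.
  split; first by apply: AB => //; exact: ba.1.
  move=> y; rewrite (nuB _ ba.1 Aq) nuq => h.
  have [ay|] := eqVneq (nu a y) 0; last exact: ba.2.
  apply: bb.2; apply: contra h => /eqP ->.
  by rewrite ay mul0r subrr.
- move=> s k us sgood sum0 x xs; apply/eqP/negPn/negP => kx.
  pose s' := [seq y <- s | k y != 0].
  have [m ms mle] : exists2 m, m \in s' & forall y, y \in s' -> le y m.
    apply: max; apply/eqP => s0.
    have : x \in s' by rewrite mem_filter kx.
    by rewrite s0.
  move: ms; rewrite mem_filter => /andP[km ms].
  have [|_ nus] := @A_sum s b k; first by move=> y /sgood/bgood[[]].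
  have := nus m; rewrite sum0 nu0 (bigD1_seq m)//= big1_seq ?addr0.
    have [_ bm _] := bgood m (sgood m ms).
    by move=> /esym/eqP; rewrite mulf_eq0 (negPf bm) (negPf km).
  move=> y /andP[ym ys].
  have [->|ky] := eqVneq (k y) 0; first by rewrite mulr0.
  have [[_ bym] _ _] := bgood y (sgood y ys).
  have [->|/bym my] := eqVneq (nu (b y) m) 0; first by rewrite mul0r.
  have yle : le y m by apply: mle; rewrite mem_filter ky.
  by move/eqP : ym; case; apply: anti; rewrite yle my.
Qed.

End FreeSubgroup.

(** * Integer functions on Cantor cubes *)

Lemma ptws_nbhs (J : eqType) (Y : topologicalType) (x : {ptws J -> Y})
    (U : set {ptws J -> Y}) : nbhs x U ->
  exists s : seq J, forall y : {ptws J -> Y}, {in s, (x : J -> Y) =1 y} -> U y.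
Proof.
pose B (s : seq J) := [set y : {ptws J -> Y} | {in s, (x : J -> Y) =1 y}].
have FF : Filter (filter_from [set: seq J] B).
  apply: filter_from_filter; first by exists [::].
  move=> s t _ _; exists (s ++ t) => // y xy.
  by split => i ij; apply: xy; rewrite mem_cat ij ?orbT.
suff Fx : filter_from [set: seq J] B --> x.
  by move=> /Fx[s _ sU]; exists s => y; exact: sU.
apply/cvg_sup => j V [_ [[W oW <-] /= Wx WV]].
exists [:: j] => // y xy; apply: WV => /=.
by rewrite -[y j]xy ?inE.
Qed.

Section Cube.
Variable J : eqType.
Local Notation cube := {ptws J -> bool}.
Implicit Types (n : (J -> bool) -> int) (x y : J -> bool) (s t : seq J).

Definition depends s n := forall x y, {in s, x =1 y} -> n x = n y.

Definition upd x (j : J) (b : bool) : J -> bool :=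
  fun i => if i == j then b else x i.

Definition jump (j : J) n : (J -> bool) -> int :=
  fun x => n (upd x j true) - n (upd x j false).

(** The iterated differences at the origin are the coefficients of an integer
    function in the basis of products of coordinates. *)
Fixpoint mcoef n t : int :=
  if t is j :: t' then mcoef (jump j n) t' else n (fun=> false).

Lemma mcoefB n m t : mcoef (fun x => n x - m x) t = mcoef n t - mcoef m t.
Proof.
elim: t n m => //= j t IH n m; rewrite -IH; congr mcoef.
by apply/funext => x; rewrite /jump; lia.
Qed.

Lemma mcoef0 t : mcoef (fun=> 0) t = 0.
Proof. by have := mcoefB (fun=> 0) (fun=> 0) t; rewrite !subrr. Qed.

Lemma depends_jump s n j : depends s n ->
  depends [seq i <- s | i != j] (jump j n).
Proof.
move=> ns x y xy; rewrite /jump; congr (_ - _); apply: ns => i si;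
  by rewrite /upd; case: eqVneq => // ij; apply: xy; rewrite mem_filter ij.
Qed.

Lemma jump_notin s n j : depends s n -> j \notin s -> jump j n = fun=> 0.
Proof.
move=> ns js; apply/funext => x; apply/eqP; rewrite subr_eq0; apply/eqP.
by apply: ns => i si; rewrite /upd; case: eqP => // ij; rewrite -ij si in js.
Qed.

Lemma mcoef_supp s n t : depends s n -> mcoef n t != 0 ->
  uniq t /\ {subset t <= s}.
Proof.
elim: t s n => //= j t IH s n ns.
have [js|js] := boolP (j \in s); last by rewrite (jump_notin ns js) mcoef0 eqxx.
move=> /(IH _ _ (depends_jump ns))[ut ts]; split.
  rewrite ut andbT; apply/negP => /ts; by rewrite mem_filter eqxx.
by move=> i; rewrite inE => /predU1P[->//|/ts]; rewrite mem_filter => /andP[].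
Qed.

Fixpoint words s (k : nat) : seq (seq J) :=
  if k is k'.+1 then [::] :: [seq j :: t | j <- s, t <- words s k']
  else [:: [::]].

Lemma words_mem s k t : {subset t <= s} -> (size t <= k)%N -> t \in words s k.
Proof.
elim: k t => [|k IH] [|j t] //= ts tk.
rewrite inE /=; apply: allpairs_f; first by apply: ts; rewrite inE eqxx.
by apply: IH => // i it; apply: ts; rewrite inE it orbT.
Qed.

Lemma mcoef_fin s n : depends s n ->
  exists S : seq (seq J), forall t, mcoef n t != 0 -> t \in S.
Proof.
move=> ns; exists (words s (size s)) => t /(mcoef_supp ns)[ut ts].
by apply: words_mem => //; exact: uniq_leq_size.
Qed.

(** By induction on [s]: when all the coefficients vanish, so do the differences
    in the coordinate [j], and a function without differences in [j] does not
    depend on [j]. *)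
Lemma mcoef_inj s n : depends s n -> (forall t, mcoef n t = 0) ->
  forall x, n x = 0.
Proof.
elim: s n => [|j s IH] n ns n0 x.
  by rewrite (ns x (fun=> false))//; exact: (n0 [::]).
have d0 y : jump j n y = 0.
  apply: IH => [z w zw|t]; last exact: (n0 (j :: t)).
  apply: (depends_jump ns) => i; rewrite mem_filter inE => /andP[ij].
  by rewrite (negPf ij)/=; exact: zw.
apply: IH => // y z yz; pose y' := upd y j (z j).
have yy' : n y = n y'.
  have updE : upd y j (y j) = y.
    by apply/funext => i; rewrite /upd; case: eqP => // ->.
  have /eqP := d0 y; rewrite subr_eq0 => /eqP e.
  by rewrite -[in LHS]updE /y'; case: (y j) (z j) => [] [].
rewrite yy'; apply: ns => i; rewrite inE /y' /upd.
by case: eqVneq => [->//|_ /=]; exact: yz.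
Qed.

Lemma cube_compact : compact [set: cube].
Proof.
have -> : [set: cube] = [set f : cube | forall j, [set: bool] (f j)].
  by apply/seteqP; split.
exact: (@tychonoff J (fun=> bool) (fun=> setT)) (fun=> bool_compact).
Qed.

Lemma cube_hausdorff : hausdorff_space cube.
Proof.
exact: (@hausdorff_product J (fun=> bool)) (fun=> discrete_hausdorff).
Qed.

(** Near each point finitely many coordinates determine the function, and
    finitely many points suffice by compactness. *)
Lemma continuous_depends (n : cube -> int) :
  (forall x : cube, \forall y \near x, n y = n x) -> exists s, depends s n.
Proof.
move=> nloc; pose P s (x : cube) := forall y : cube, {in s, x =1 y} -> n x = n y.
have [x _|S SP] := @compact_finite_cover cube setT _ P cube_compact.
  have [s sP] := ptws_nbhs (nloc x); exists s.
  suff : \forall z \near x, forall j, j \in s -> (x : J -> bool) j = z j.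
    apply: filterS => z xz y zy; rewrite !sP// => i si.
    by rewrite xz//; exact: zy.
  apply: (@near_all_seq cube (nbhs x) _ J s
    (fun j (z : J -> bool) => (x : J -> bool) j = z j)) => j.
  have : nbhs (x j) [set x j] by exact: discrete_set1.
  move=> /(@proj_continuous J (fun=> bool) j x).
  by apply: filterS => z /=; rewrite /proj => ->.
exists (flatten S) => x y xy; have [s sS] := SP x I; apply=> i si.
by apply: xy; apply/flattenP; exists s.
Qed.

End Cube.

(** * Subspaces and zero-dimensional compacta *)

Section SetType.
Variables (X : topologicalType) (A : set X).

Lemma val_continuous : continuous (\val : A -> X).
Proof. exact: (@initial_continuous A X set_val). Qed.

Lemma continuous_set_type (Y : topologicalType) (f : Y -> A) :
  continuous (fun y => \val (f y)) -> continuous f.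
Proof.
move=> cf y U [_ [[W oW <-] /= Wfy WU]].
have : nbhs y ((fun y => \val (f y)) @^-1` W).
  by apply: cf; apply: open_nbhs_nbhs.
by apply: filterS => z Wz; exact: WU.
Qed.

Lemma hausdorff_set_type : hausdorff_space X -> hausdorff_space A.
Proof.
move=> hX p q pq; apply/val_inj/hX => U V pU qV.
have [z [Uz Vz]] := pq _ _ (val_continuous pU) (val_continuous qV).
by exists (\val z).
Qed.

Lemma compact_set_type : compact A -> compact [set: A].
Proof.
move=> cA F PF _; have FA : (\val @ F) A.
  by apply: (@filterE _ F) => z; exact: set_valP.
have [p [Ap pF]] := cA _ _ FA.
exists (exist _ p (mem_set Ap)); split => // U V FU [_ [[W oW <-] /= Wp WV]].
have FU' : (\val @ F) (\val @` U).
  by apply: (@filterS _ F _ U) => // z Uz; exists z.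
have [_ [[z Uz <-] Wz]] := pF _ W FU' (open_nbhs_nbhs (conj oW Wp)).
by exists z; split => //; exact: WV.
Qed.

Lemma zero_dimensional_set_type : zero_dimensional X -> zero_dimensional A.
Proof.
move=> zX x y xy; have /zX[U [cU Ux Uy]] : \val x != \val y.
  by apply: contra xy => /eqP/val_inj->.
exists (\val @^-1` U); split => //.
by apply: preimage_clopen => //; exact: val_continuous.
Qed.

End SetType.

Lemma closed_compactum (X : topologicalType) (A : set X) :
  compactum X -> closed A -> compactum A.
Proof.
move=> [cX hX] cA; split; last exact: hausdorff_set_type.
by apply/compact_set_type/(subclosed_compact cA cX).
Qed.

Lemma compactum_setX (X Y : topologicalType) : compactum X -> compactum Y ->
  compactum (X * Y)%type.
Proof.
move=> [cX hX] [cY hY]; split; first by rewrite -setXTT; exact: compact_setX.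
move=> [x y] [x' y'] h; congr pair; [apply: hX|apply: hY] => U V nU nV.
  have [[a b] [/= [Ua _] [Va _]]] := h (U `*` setT) (V `*` setT)
    (ex_intro2 _ _ (U, setT) (conj nU filterT) (@subset_refl _ _))
    (ex_intro2 _ _ (V, setT) (conj nV filterT) (@subset_refl _ _)).
  by exists a.
have [[a b] [/= [_ Ub] [_ Vb]]] := h (setT `*` U) (setT `*` V)
  (ex_intro2 _ _ (setT, U) (conj filterT nU) (@subset_refl _ _))
  (ex_intro2 _ _ (setT, V) (conj filterT nV) (@subset_refl _ _)).
by exists b.
Qed.

Lemma clopen_if_continuous (X Y : topologicalType) (C : set X) (f g : X -> Y) :
  clopen C -> (forall x, C x -> {for x, continuous f}) ->
  (forall x, ~ C x -> {for x, continuous g}) ->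
  continuous (fun x => if `[< C x >] then f x else g x).
Proof.
move=> [oC cC] cf cg x; have [Cx|Cx] := pselect (C x).
  rewrite /continuous_at asboolT//.
  apply: (@cvg_trans _ (f @ x)); last exact: cf.
  apply: near_eq_cvg; have : nbhs x C by exact: open_nbhs_nbhs.
  by apply: filterS => y Cy; rewrite asboolT.
rewrite /continuous_at asboolF//.
apply: (@cvg_trans _ (g @ x)); last exact: cg.
apply: near_eq_cvg; have : nbhs x (~` C).
  by apply: open_nbhs_nbhs; split => //; exact: closed_openC.
by apply: filterS => y Cy; rewrite asboolF.
Qed.

Lemma functionally_open_open (R : realType) (X : topologicalType) (U : set X) :
  functionally_open R U -> open U.
Proof.
move=> [phi cphi ->]; have -> : [set x | phi x != 0] = phi @^-1` [set~ 0].
  by apply/seteqP; split => x /= /eqP.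
apply: open_comp; first by move=> x _; exact: cphi.
by apply: closed_openC; exact: closed_eq.
Qed.

Lemma clopen_functionally_open (R : realType) (X : topologicalType)
  (C : set X) : clopen C -> functionally_open R C.
Proof.
move=> cC; exists (fun x => if `[< C x >] then 1 else 0).
  by apply: clopen_if_continuous => // x _; exact: cst_continuous.
by apply/seteqP; split => x /=; case: asboolP; rewrite ?eqxx ?oner_eq0.
Qed.

Section ZeroDimensional.
Variables (R : realType) (Z : topologicalType).
Hypotheses (cZ : compactum Z) (zZ : zero_dimensional Z).

Lemma clopen_nbhs (z : Z) (U : set Z) : nbhs z U ->
  exists C, [/\ clopen C, C z & C `<=` U].
Proof.
by move=> /(zero_dimensional_cvg cZ.2 zZ cZ.1)[C [Cz cC] CU]; exists C.
Qed.

(** A finite clopen cover is made disjoint by removing from each member the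
    previous ones. *)
Lemma clopen_partition (P : set Z -> Prop) :
  (forall C D, D `<=` C -> P C -> P D) ->
  (forall z, exists C, [/\ clopen C, C z & P C]) ->
  exists m (E : nat -> set Z), [/\ forall i, clopen (E i),
    forall i, (i < m)%N -> P (E i),
    forall i j z, E i z -> E j z -> i = j
    & forall z, exists2 i, (i < m)%N & E i z].
Proof.
move=> Psub Pex.
pose Q (C : set Z) z := [/\ clopen C, C z & P C].
have [z _|s cov] := @compact_finite_cover Z setT _ Q cZ.1.
  have [C [cC Cz PC]] := Pex z; exists C.
  have : nbhs z C by apply: open_nbhs_nbhs; split => //; exact: cC.1.
  by apply: filterS => z' Cz'.
pose s' := [seq C <- s | `[< clopen C /\ P C >]].
have sD i : (i < size s')%N -> clopen (nth set0 s' i) /\ P (nth set0 s' i).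
  by move=> /(mem_nth set0); rewrite mem_filter => /andP[/asboolP].
pose E i := [set z | nth set0 s' i z /\ forall j, (j < i)%N -> ~ nth set0 s' j z].
have clo i : clopen (nth set0 s' i).
  have [si|si] := ltnP i (size s'); first by have [] := sD i si.
  by rewrite nth_default//; exact: clopen0.
exists (size s'), E; split.
- move=> i; rewrite (_ : E i = nth set0 s' i `&`
      ~` \big[setU/set0]_(j < i) nth set0 s' j).
    apply: clopenI => //; apply: (clopenC set0).
    apply: (big_ind (@clopen Z)); [exact: clopen0|exact: clopenU|].
    by move=> j _; exact: clo.
  rewrite -bigcup_mkord; apply/seteqP; split => z /= [iz h]; split => //.
    by move=> [j ji jz]; exact: (h j ji).
  by move=> j ji jz; apply: h; exists j.
- by move=> i si; apply: (Psub (nth set0 s' i)); [move=> z []|exact: (sD i si).2].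
- move=> i j z [iz hi] [jz hj]; case: (ltngtP i j) => // h.
    by case: (hj _ h).
  by case: (hi _ h).
- move=> z; have [C Cs [cC Cz PC]] := cov z I.
  have {}Cs : C \in s' by rewrite mem_filter Cs andbT; exact/asboolP.
  have exi : exists i, (i < size s')%N && `[< nth set0 s' i z >].
    exists (index C s'); rewrite index_mem Cs/=; apply/asboolP.
    by rewrite nth_index.
  case: (ex_minnP exi) => i /andP[si /asboolP iz] imin; exists i => //.
  split=> // j ji jz; have := imin j; rewrite (ltn_trans ji si)/= => /(_ _).
  by rewrite leqNgt ji => h; have := h (asboolT jz).
Qed.

Lemma zero_dimensional_dim0 : dim_le R 0 Z.
Proof.
move=> U [Ufin Ufo Ucov].
have [||m [E [Eclo EP Edis Ecov]]] :=
    @clopen_partition (fun C => exists2 A, U A & C `<=` A).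
- by move=> C D DC [A UA CA]; exists A => //; exact: subset_trans CA.
- move=> z; have : [set: Z] z by [].
  rewrite -Ucov => -[A UA Az].
  have nA : nbhs z A.
    by apply: open_nbhs_nbhs; split => //; exact: functionally_open_open (Ufo A UA).
  have [C [cC Cz CA]] := clopen_nbhs nA.
  by exists C; split => //; exists A.
exists (E @` `I_m); split.
- split; first exact/finite_image/finite_II.
    by move=> _ [i _ <-]; exact: clopen_functionally_open.
  apply/seteqP; split => // z _; have [i im Eiz] := Ecov z.
  by exists (E i) => //; exists i.
- by move=> _ [i im <-]; exact: EP.
- move=> B Binj BE; apply/seteqP; split => // z Bz.
  have [i _ iE] := BE ord0; have [j _ jE] := BE ord_max.
  have ij : i = j by apply: (Edis i j z); rewrite ?iE ?jE; exact: Bz.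
  by have /Binj : B ord0 = B ord_max by rewrite -iE -jE ij.
Qed.

End ZeroDimensional.

Definition unit_itv (R : realType) : set R := `[0, 1]%classic.

Notation unit_interval R := (set_type (@unit_itv R)).

Lemma unit_interval_compactum (R : realType) : compactum (unit_interval R).
Proof.
split; first exact/compact_set_type/segment_compact.
exact/hausdorff_set_type/Rhausdorff.
Qed.

(** On the product with an interval, a clopen partition of the base and, over
    each of its members, a chain of intervals of which only consecutive ones
    meet, give a cover of order one. *)
Theorem zero_dimensional_dim1 (R : realType) (Z : topologicalType) :
  compactum Z -> zero_dimensional Z -> dim_le R 1 (Z * unit_interval R)%type.
Proof.
move=> cZ zZ U [Ufin Ufo Ucov].
pose P (C : set Z) := exists n : nat, forall t : unit_interval R, exists2 A, U A &
  forall z (t' : unit_interval R), C z -> `|\val t' - \val t| <= n.+1%:R^-1 ->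
    A (z, t').
have [C D DC [n nP]|z|m [E [Eclo EP Edis Ecov]]] := @clopen_partition Z cZ P.
- exists n => t; have [A UA AP] := nP t; exists A => // z t' Dz.
  exact/AP/DC.
(* Filtering the small clopen neighborhoods of [z] lets the compactness of the
   interval choose one of them together with a mesh, uniformly in the time. *)
- pose F := filter_from [set D : set Z | clopen D /\ D z]
    (fun D => [set C : set Z | C `<=` D]).
  have FF : Filter F.
    apply: filter_from_filter; first by exists setT; split => //; exact: clopenT.
    move=> C D [cC Cz] [cD Dz]; exists (C `&` D).
      by split => //; exact: clopenI.
    by move=> B BCD; split => y /BCD[].
  pose Q (nC : nat * set Z) (t : unit_interval R) := exists2 A, U A &
    forall z (t' : unit_interval R), nC.2 z ->
      `|\val t' - \val t| <= nC.1.+1%:R^-1 -> A (z, t').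
  have := @compact_tube (unit_interval R) setT _ (filter_prod \oo F) _ Q
    (unit_interval_compactum R).1.
  case=> [t _|[A B] /= [[n _ nA] [D [cD Dz] DB]] AB]; last first.
    exists D; split => //; exists n => t.
    by apply: (AB (n, D)) => //; split; [apply: nA => /=|apply: DB => /=].
  have : [set: Z * unit_interval R] (z, t) by [].
  rewrite -Ucov => -[A UA Azt].
  have : nbhs (z, t) A.
    by apply: open_nbhs_nbhs; split => //; exact: functionally_open_open (Ufo A UA).
  move=> [[B1 B2] /= [nB1 nB2] B12A].
  have [D [cD Dz DB1]] := clopen_nbhs cZ zZ nB1.
  have [_ [[W oW <-] /= Wt WB2]] := nB2.
  have /nbhs_ballP[d /= d0 dW] : nbhs (\val t) W by exact: open_nbhs_nbhs.
  have d2 : 0 < d / 2 by rewrite divr_gt0.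
  exists ([set t' | `|\val t' - \val t| < d / 2],
      [set nC : nat * set Z | nC.1.+1%:R^-1 < d / 2 /\ nC.2 `<=` D]) => /=.
    split; last first.
      exists ([set n | n.+1%:R^-1 < d / 2], [set C | C `<=` D]) => //=.
      by split; [exact: (near_infty_natSinv_lt (PosNum d2))|exists D].
    have : \forall t' \near t, ball (\val t) (d / 2) (\val t').
      exact: (val_continuous (nbhsx_ballx (\val t) _ d2)).
    apply: filterS => t'.
    by rewrite /ball/= distrC.
  move=> [t1 [n C]] [/= h1 [h2 h3]]; exists A => // z' t' Cz' h.
  apply: (B12A (z', t')); split => /=; first exact/DB1/h3.
  apply/WB2/dW; rewrite /ball/= distrC -(subrKA (\val t1)).
  apply: le_lt_trans (ler_normD _ _) _.
  by rewrite (splitr d) ler_ltD// (le_trans h)// ltW.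
have /choice[N NP] : forall i, exists n : nat, (i < m)%N ->
    forall t : unit_interval R, exists2 A, U A &
    forall z (t' : unit_interval R), E i z -> `|\val t' - \val t| <= n.+1%:R^-1 ->
      A (z, t').
  move=> i; have [im|im] := ltnP i m; last by exists 0%N.
  by have [n nP] := EP i im; exists n.
pose W (ik : nat * nat) : set (Z * unit_interval R) := [set p | E ik.1 p.1 /\
  `|\val p.2 - ik.2%:R / (N ik.1).+1%:R| < (N ik.1).+1%:R^-1].
pose s := flatten [seq [seq (i, k) | k <- iota 0 (N i).+2] | i <- iota 0 m].
have sE i k : ((i, k) \in s) = (i < m)%N && (k < (N i).+2)%N.
  apply/flattenP/andP => [[_ /mapP[j jm ->] /mapP[k' kN [-> ->]]]|[im kN]].
    by rewrite mem_iota in jm; rewrite mem_iota in kN.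
  exists [seq (i, k) | k <- iota 0 (N i).+2].
    by apply/mapP; exists i; rewrite ?mem_iota.
  by apply/mapP; exists k; rewrite ?mem_iota.
have Npos i : 0 < (N i).+1%:R :> R by rewrite ltr0n.
exists (W @` [set` s]); split.
- split; first exact/finite_image/finite_seq.
    move=> _ [[i k] _ <-].
    exists (fun p : Z * unit_interval R => if `[< (E i `*` setT) p >] then
      Num.max 0 ((N i).+1%:R^-1 - `|\val p.2 - k%:R / (N i).+1%:R|) else 0).
      apply: clopen_if_continuous; last by move=> p _; exact: cst_continuous.
        rewrite (_ : _ `*` _ = fst @^-1` (E i)); last first.
          by apply/seteqP; split => p //= [].
        apply: preimage_clopen => // p; exact: cvg_fst.
      move=> p _; apply: (@continuous_max _ _ (cst 0) (fun p : Z * unit_interval R =>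
        (N i).+1%:R^-1 - `|\val p.2 - k%:R / (N i).+1%:R|)).
        exact: cst_continuous.
      apply: cvgB; first exact: cvg_cst.
      apply: cvg_norm; apply: cvgB; last exact: cvg_cst.
      apply: (@cvg_comp _ _ _ snd \val _ (nbhs p.2)); first exact: cvg_snd.
      exact: val_continuous.
    apply/seteqP; split => -[z t] /=.
      move=> [/= Ez h]; rewrite asboolT//= gt_eqF// lt_max subr_gt0 h.
      by rewrite orbT.
    case: asboolP => [[/= Ez _]|_]; last by rewrite eqxx.
    move=> h; split => //=; rewrite ltNge; apply/negP => h'.
    by move/eqP : h; apply; apply/max_idPl; rewrite subr_le0.
  apply/seteqP; split => // -[z t] _; have [i im Eiz] := Ecov z.
  have t01 := set_valP t; rewrite /unit_itv /= in_itv/= in t01.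
  have /andP[t0 t1] := t01.
  pose k := Num.truncn (\val t * (N i).+1%:R).
  have k0 : 0 <= \val t * (N i).+1%:R by rewrite mulr_ge0// ler0n.
  have /andP[k1 k2] := truncn_itv k0; rewrite -/k in k1 k2.
  exists (W (i, k)).
    exists (i, k) => //=; rewrite sE im/= !ltnS -(ler_nat R).
    by apply: le_trans k1 _; rewrite ler_piMl.
  split => //=; rewrite -[\val t](mulfK (lt0r_neq0 (Npos i))) -mulrBl.
  rewrite normrM normfV (gtr0_norm (Npos i)) ltr_pdivrMr// mulVf ?lt0r_neq0//.
  rewrite ger0_norm ?subr_ge0//; move: k2; rewrite -natr1; lra.
- move=> _ [[i k] /= iks <-]; move: iks; rewrite sE => /andP[im kN].
  have tI : k%:R / (N i).+1%:R \in @unit_itv R.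
    rewrite inE /unit_itv/= in_itv/= divr_ge0 ?ler0n//= ler_pdivrMr// mul1r.
    by rewrite ler_nat.
  have [A UA AP] := NP i im (exist _ (k%:R / (N i).+1%:R) tI).
  by exists A => // -[z t] [/= Ez h]; apply: AP => //; exact: ltW.
- move=> B Binj BV; apply/seteqP; split => // -[z t] Bz.
  have /choice[ik ikP] : forall j, exists ik, [set` s] ik /\ W ik = B j.
    by move=> j; have [ik ? ?] := BV j; exists ik.
  have ikW j : W (ik j) (z, t) by rewrite (ikP j).2; exact: Bz.
  have i1 j j' : (ik j).1 = (ik j').1 by apply: Edis (ikW j).1 (ikW j').1.
  pose M := (N (ik ord0).1).+1.
  have M0 : 0 < M%:R :> R by rewrite ltr0n.
  have kM j : `|\val t * M%:R - (ik j).2%:R| < 1.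
    have := (ikW j).2; rewrite /= (i1 j ord0) -/M => h.
    rewrite -(divfK (lt0r_neq0 M0) (ik j).2%:R) -mulrBl normrM (gtr0_norm M0).
    by rewrite -ltr_pdivlMr// mul1r.
  have kk j j' : ((ik j).2 < (ik j').2 + 2)%N.
    rewrite -(ltr_nat R) natrD; move: (kM j) (kM j').
    by rewrite !ltr_norml => /andP[? ?] /andP[? ?]; lra.
  have kinj j j' : j != j' -> (ik j).2 != (ik j').2.
    apply: contra => /eqP kE; apply/eqP/Binj; rewrite -!(ikP _).2.
    by congr W; rewrite [LHS]surjective_pairing [RHS]surjective_pairing kE (i1 j j').
  pose o (n : nat) (h : (n < 3)%N) := Ordinal h.
  have := kinj (@o 0%N isT) (@o 1%N isT) isT.
  have := kinj (@o 0%N isT) (@o 2%N isT) isT.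
  have := kinj (@o 1%N isT) (@o 2%N isT) isT.
  have := kk (@o 0%N isT) (@o 1%N isT); have := kk (@o 1%N isT) (@o 0%N isT).
  have := kk (@o 0%N isT) (@o 2%N isT); have := kk (@o 2%N isT) (@o 0%N isT).
  have := kk (@o 1%N isT) (@o 2%N isT); have := kk (@o 2%N isT) (@o 1%N isT).
  lia.
Qed.

(** * The space of ultrafilters *)

Section Ultrafilters.
Variable X : topologicalType.
Hypothesis cX : compactum X.
Local Notation cube := {ptws set X -> bool}.

Definition ultra (u : set X -> bool) :=
  [/\ u setT, ~~ u set0, forall A B, u A -> u B -> u (A `&` B),
    forall A B, A `<=` B -> u A -> u B & forall A, u A || u (~` A)].

(** The Stone space of the underlying set of [X]: a zero-dimensional compactum,
    closed in a Cantor cube, that maps onto [X] by limits, and to which every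
    continuous self-map of [X] lifts. *)
Definition ultra_space : set cube := [set u : cube | ultra u].

Lemma cylinder_clopen (A : set X) (b : bool) :
  clopen [set u : cube | u A = b].
Proof.
have -> : [set u : cube | u A = b] = (fun u : cube => u A) @^-1` [set b] by [].
apply: preimage_clopen; last exact: (@proj_continuous (set X) (fun=> bool) A).
by split; [exact: discrete_open|exact: discrete_closed].
Qed.

Lemma ultra_space_closed : closed ultra_space.
Proof.
have cl A : closed [set u : cube | u A] := (cylinder_clopen A true).2.
have cln A : closed [set u : cube | ~~ u A].
  rewrite (_ : mkset _ = [set u : cube | u A = false]).
    exact: (cylinder_clopen A false).2.
  by apply/seteqP; split => u /=; [exact: negbTE|move=> ->].
have clI (A : Type) (F : A -> set cube) : (forall a, closed (F a)) ->
    closed [set u | forall a, F a u].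
  move=> cF; rewrite (_ : mkset _ = \bigcap_(a in setT) F a).
    by apply: closed_bigI => a _; exact: cF.
  by apply/seteqP; split => u h a => //; exact: h.
rewrite (_ : ultra_space = [set u : cube | u setT] `&` [set u | ~~ u set0] `&`
  [set u | forall AB : set X * set X, (([set u | ~~ u AB.1] `|`
     [set u | ~~ u AB.2]) `|` [set u | u (AB.1 `&` AB.2)]) u] `&`
  [set u | forall AB : {AB : set X * set X | AB.1 `<=` AB.2},
     ([set u | ~~ u (sval AB).1] `|` [set u | u (sval AB).2]) u] `&`
  [set u | forall A, ([set u | u A] `|` [set u | u (~` A)]) u]).
  by do ?[apply: closedI]; do ?[exact: cl|exact: cln];
    apply: clI => A; do ?[apply: closedU]; do ?[exact: cl|exact: cln].
apply/seteqP; split => u /=.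
  move=> [uT u0 uI uS uC]; do ?split => //.
  - move=> [A B] /=; case: (boolP (u A)) => uA; last by left; left.
    case: (boolP (u B)) => uB; last by left; right.
    by right; exact: uI.
  - move=> [[A B] /= AB]; case: (boolP (u A)) => uA; last by left.
    by right; exact: uS uA.
  - by move=> A; apply/orP.
move=> [[[[uT u0] uI] uS] uC]; split => //.
- move=> A B uA uB; have [[]|//] := uI (A, B); rewrite ?uA ?uB//.
- by move=> A B AB uA; have [] := uS (exist _ (A, B) AB); rewrite /= ?uA.
- by move=> A; apply/orP; exact: uC.
Qed.

Lemma ultra_meet u A B : ultra u -> u A -> u B -> A `&` B !=set0.
Proof.
move=> [_ u0 uI _ _] uA uB; apply/set0P/negP => /eqP AB.
by move/negP : u0; apply; rewrite -AB; exact: uI.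
Qed.

Lemma ultra_limit_exists u : ultra u -> exists x : X, forall U, nbhs x U -> u U.
Proof.
move=> uu; have [uT u0 uI uS uC] := uu.
pose F := [set A : set X | u A].
have FF : ProperFilter F.
  split; last by split; [exact: uT|move=> A B; exact: uI|move=> A B; exact: uS].
  exact/negP.
have [x [_ xF]] := cX.1 F FF uT.
exists x => U nU; have /orP[//|uU] := uC U.
by have [y []] := xF _ _ uU nU.
Qed.

Lemma ultra_limit_unique u (x y : X) : ultra u -> (forall U, nbhs x U -> u U) ->
  (forall U, nbhs y U -> u U) -> x = y.
Proof.
move=> uu ux uy; apply: cX.2 => U V nU nV.
exact: ultra_meet uu (ux U nU) (uy V nV).
Qed.

Lemma ultra_limit_ex (u : ultra_space) :
  exists x : X, forall U, nbhs x U -> (\val u : cube) U.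
Proof. exact/ultra_limit_exists/(set_valP u). Qed.

Definition ultra_limit (u : ultra_space) : X := sval (cid (ultra_limit_ex u)).

Lemma ultra_limitP (u : ultra_space) (U : set X) :
  nbhs (ultra_limit u) U -> (\val u : cube) U.
Proof. exact: (svalP (cid (ultra_limit_ex u))). Qed.

Lemma ultra_limitE (u : ultra_space) (x : X) :
  (forall U, nbhs x U -> (\val u : cube) U) -> ultra_limit u = x.
Proof.
move=> ux; apply: (ultra_limit_unique (set_valP u)) ux.
exact: ultra_limitP.
Qed.

Lemma ultra_limit_surj x : exists u, ultra_limit u = x.
Proof.
pose p : cube := fun A => `[< A x >].
have pu : ultra_space p.
  split; rewrite /p.
  - exact/asboolP.
  - by apply/asboolP.
  - by move=> A B /asboolP Ax /asboolP Bx; exact/asboolP.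
  - by move=> A B AB /asboolP Ax; exact/asboolP/AB.
  - by move=> A; apply/orP; have [?|?] := pselect (A x);
      [left|right]; exact/asboolP.
exists (exist _ p (mem_set pu)); apply: ultra_limitE => U nU /=.
by apply/asboolP; exact: nbhs_singleton nU.
Qed.

Lemma ultra_limit_continuous : continuous ultra_limit.
Proof.
move=> u U nU.
have [V nV VU] := @compact_regular X (ultra_limit u) setT cX.2 cX.1 filterT _ nU.
have uV := ultra_limitP nV.
have : nbhs (\val u : cube) [set v : cube | v V = true].
  by apply: open_nbhs_nbhs; split => //; exact: (cylinder_clopen V true).1.
move/val_continuous; apply: (@filterS _ (nbhs u)) => v /= vV.
apply: VU => W nW.
exact: ultra_meet (set_valP v) vV (ultra_limitP nW).
Qed.

(** The lift takes the direct images of ultrafilters. *)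
Lemma ultra_map (d : X -> X) : continuous d ->
  exists S : ultra_space -> ultra_space, continuous S /\
    forall u, ultra_limit (S u) = d (ultra_limit u).
Proof.
move=> cd; pose m (u : cube) : cube := fun A => u (d @^-1` A).
have mu (u : ultra_space) : ultra_space (m (\val u)).
  have [uT u0 uI uS uC] := set_valP u; rewrite /m; split => //.
  - by move=> A B; exact: uI.
  - by move=> A B AB; apply: uS => x; exact: AB.
pose Sf (u : ultra_space) : ultra_space := exist _ (m (\val u)) (mem_set (mu u)).
exists Sf; split.
  apply: continuous_set_type => u; have Fu : Filter (nbhs u) by exact: nbhs_filter.
  apply/cvg_sup => A.
  move=> V [_ [[W oW <-] /= Wx WV]].
  have cu : {for u, continuous (fun v : ultra_space => (\val v : cube) (d @^-1` A))}.
    apply: (@cvg_comp _ _ _ \val (fun v : cube => v (d @^-1` A)) _ (nbhs (\val u))).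
      exact: val_continuous.
    exact: (@proj_continuous (set X) (fun=> bool) (d @^-1` A)).
  have : \forall v \near u, W ((\val v : cube) (d @^-1` A)).
    by apply: cu; exact: open_nbhs_nbhs.
  by apply: (@filterS _ (nbhs u)) => v Wv; exact: WV.
move=> u; apply: ultra_limitE => U nU /=.
by rewrite /m; apply: ultra_limitP; exact: cd.
Qed.

End Ultrafilters.

(** * Characters of torus groups *)

Lemma mulrn_fct (X : Type) (V : zmodType) (f : X -> V) (n : nat) (x : X) :
  (f *+ n) x = f x *+ n.
Proof. by elim: n => [|n IH]; rewrite ?mulr0n// !mulrS -IH. Qed.

Lemma mulrz_fct (X : Type) (V : zmodType) (f : X -> V) (k : int) (x : X) :
  (f *~ k) x = f x *~ k.
Proof.
by case: k => n; rewrite ?NegzE ?mulrNz -!pmulrn -?mulrn_fct.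
Qed.

Lemma compact_bijection_continuous (X Y : topologicalType) (f : X -> Y)
    (g : Y -> X) : compact [set: X] -> hausdorff_space Y -> continuous f ->
  cancel f g -> cancel g f -> continuous g.
Proof.
move=> cX hY cf fK gK; apply/continuousP => U oU.
have -> : g @^-1` U = ~` (f @` (~` U)).
  apply/seteqP; split => y /=.
    by move=> Ugy [x nUx xy]; apply: nUx; rewrite -(fK x) xy.
  by move=> h; apply: contrapT => nU; apply: h; exists (g y).
apply: closed_openC; apply: compact_closed => //.
apply: continuous_compact; first exact: continuous_subspaceT.
by apply: (subclosed_compact _ cX) => //; exact: open_closedC.
Qed.

Section CircleHoms.
Variable R : realType.
Local Notation T := (circle R).

(** As long as the multiples stay small, the angle doubles with the element. *)
Lemma no_small_subgroup (a : T) :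
  (forall n, `|angle (a *+ n)| < 4^-1) -> a = 0.
Proof.
move=> an; apply/angle_eq0/normr0_eq0/eqP.
rewrite eq_le normr_ge0 andbT; apply/ler_addgt0Pl => e e0; rewrite addr0.
have dbl m : `|angle (a *+ 2 ^ m)| = 2 ^+ m * `|angle a|.
  elim: m => [|m IH]; first by rewrite mul1r.
  rewrite expnS mulnC mulrnA [X in angle X]mulr2n angleD; last first.
    by have := an (2 ^ m)%N; have := ler_normD (angle (a *+ 2 ^ m)) (angle (a *+ 2 ^ m)); lra.
  by rewrite -mulr2n normrMn IH -[LHS]mulr_natl mulrA -exprS.
have [N _ /(_ N (leqnn N))/= h] := pow2_gt e0.
have p : 0 < 2 ^+ N :> R by rewrite exprn_gt0.
apply/ltW/(lt_trans _ h); rewrite -[ltRHS]mul1r ltr_pdivlMr// mulrC -dbl.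
by apply: lt_trans (an _) _; lra.
Qed.

Lemma hom_circle (chi : T -> T) : {morph chi : x y / x + y} -> continuous chi ->
  exists n : int, forall a, chi a = a *~ n.
Proof.
move=> chiD cchi; pose u (t : R) := chi (pr t).
have cu : continuous u.
  move=> t; apply: (@cvg_comp _ _ _ pr chi _ (nbhs (pr t))).
    exact: pr_continuous.
  exact: cchi.
have uD : {morph u : s t / s + t} by move=> s t; rewrite /u prD chiD.
have chi0 : chi 0 = 0 by apply: (addrI (chi 0)); rewrite -chiD !addr0.
have uw := hom_winding cu uD.
have [n wn] : exists n : int, winding u = n%:~R.
  apply: pr_eq0; rewrite -[X in pr X]mul1r -uw /u.
  by have := @pr_int R 1; rewrite mulr1z => ->.
exists n => a; rewrite -{1}(angleK a) -[chi _]/(u (angle a)) uw wn mulrzr pr_mulrz.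
by rewrite angleK.
Qed.

End CircleHoms.

Section Torus.
Variables (R : realType) (K : Type).
Local Notation T := (circle R).
Local Notation torus := (torus R K).

Lemma torus_proj_continuous (k : K) : continuous (fun x : torus => x k).
Proof. exact: (@proj_continuous {classic K} (fun=> T) k). Qed.

Lemma torus_continuous (X : topologicalType) (f : X -> torus) :
  (forall k, continuous (fun x => f x k)) -> continuous f.
Proof.
move=> cf x; have Fx : Filter (nbhs x) by exact: nbhs_filter.
apply/cvg_sup => k V [_ [[W oW <-] /= Wx WV]].
have : \forall y \near x, W (f y k) by apply: (cf k); exact: open_nbhs_nbhs.
by apply: filterS => y Wy; exact: WV.
Qed.

Lemma torus_compact : compact [set: torus].
Proof.
have -> : [set: torus] = [set f : torus | forall j, [set: T] (f j)].
  by apply/seteqP; split.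
exact: (@tychonoff {classic K} (fun=> T) (fun=> setT)) (fun=> @circle_compact R).
Qed.

Lemma torus_hausdorff : hausdorff_space torus.
Proof.
exact: (@hausdorff_product {classic K} (fun=> T)) (fun=> @circle_hausdorff R).
Qed.

Definition delta (k : {classic K}) (a : T) : torus :=
  fun k' : {classic K} => if k' == k then a else 0.

(** A neighborhood of zero contains the elements with finitely many prescribed
    zero coordinates; these form a subgroup, and the circle has no small
    subgroups. *)
Lemma torus_character (chi : torus -> T) : {morph chi : x y / x + y} ->
  continuous chi -> exists (s : seq {classic K}) (n : {classic K} -> int),
    uniq s /\ forall x : torus, chi x = \sum_(k <- s) x k *~ n k.
Proof.
move=> chiD cchi.
have chi0 : chi 0 = 0 by apply: (addrI (chi 0)); rewrite -chiD !addr0.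
have chin x n : chi (x *+ n) = chi x *+ n.
  by elim: n => [|n IH]; rewrite ?mulr0n// !mulrS chiD IH.
have e4 : (0 : R) < 4^-1 by rewrite invr_gt0.
have n0 : \forall x \near (0 : torus), `|angle (chi x - 0)| < 4^-1.
  have h : nbhs (chi 0) [set b | `|angle (b - 0)| < 4^-1] by rewrite chi0; exact: angle_near.
  exact: (cchi 0 _ h).
have [s sP] := @ptws_nbhs {classic K} T 0 _ n0.
have ker (x : torus) : (forall k, k \in s -> x k = 0) -> chi x = 0.
  move=> x0; apply: no_small_subgroup => n; rewrite -chin -[chi _]subr0.
  apply: sP => k ks; rewrite -[RHS]/((x *+ n) k).
  by rewrite [RHS](@mulrn_fct K T x n k) x0// mul0rn.
have dD k a b : delta k (a + b) = delta k a + delta k b.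
  by apply/funext => k'; rewrite /delta [RHS]/+%R/=; case: eqP => //; rewrite addr0.
have hk (k : {classic K}) : exists n : int, forall a, chi (delta k a) = a *~ n.
  apply: (@hom_circle R (fun a => chi (delta k a))).
    by move=> a b; rewrite dD chiD.
  move=> a; apply: (@cvg_comp _ _ _ (delta k) chi _ (nbhs (delta k a))); last exact: cchi.
  apply: torus_continuous => k'; rewrite /delta.
  by case: (_ == _); [move=> b; exact: cvg_id|exact: cst_continuous].
have /choice[n nP] := hk.
exists (undup s), n; split; first exact: undup_uniq.
move=> x; pose y : torus := \sum_(k <- undup s) delta k (x k).
have -> : x = (x - y) + y by rewrite subrK.
have yE k : k \in undup s -> y k = x k.
  move=> ks; rewrite /y fct_sumE (bigD1_seq k) ?undup_uniq//=.
  rewrite {1}/delta eqxx big1 ?addr0// => j jk.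
  by rewrite /delta eq_sym (negPf jk).
rewrite chiD ker ?add0r => [|k ks]; last first.
  by rewrite -[LHS]/(x k - y k) yE ?subrr// mem_undup.
rewrite /y (big_morph chi chiD chi0) -/y; apply: eq_big_seq => k ks.
by rewrite nP subrK.
Qed.

End Torus.

(** * Groups with the path extension property are tori *)

Section Separation.
Variable R : realType.

Lemma compact_bnd (X : topologicalType) (f : X -> R) : compact [set: X] ->
  continuous f -> bnd f.
Proof.
move=> cX cf; have [x _|s sP] := @compact_finite_cover X setT nat
    (fun n x => `|f x| <= n%:R) cX.
  exists (Num.truncn (`|f x| + 1)).+1.
  have /cvgrPdist_lt/(_ _ ltr01) := cf x; apply: filterS => x' h.
  apply/ltW/(lt_trans _ (truncnS_gt _)).
  by rewrite -ltrBlDl (le_lt_trans (lerB_dist _ _))// distrC.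
exists (\sum_(n <- s) n%:R) => x; have [n ns /le_trans] := sP x I; apply.
by rewrite (big_rem n)//= lerDl sumr_ge0.
Qed.

Lemma compactum_urysohn (X : topologicalType) (A B : set X) :
  compactum X -> closed A -> closed B -> A `&` B = set0 ->
  exists phi : X -> R,
    [/\ continuous phi, forall x, A x -> phi x = 0 & forall x, B x -> phi x = 1].
Proof.
move=> [cX hX] cA cB AB; have nX : normal_space X by exact: compact_normal.
have [phi [cphi pA pB _]] := @urysohn_ext_itv X R nX A B 0 1 cA cB AB ltr01.
by exists phi; split => // x; [move=> Ax; apply: pA|move=> Bx; apply: pB]; exists x.
Qed.

Lemma compactum_tietze (Z : topologicalType) (Z0 : set Z) (f : Z0 -> R) :
  compactum Z -> closed Z0 -> continuous f ->
  exists2 psi : Z -> R, continuous psi & forall z : Z0, psi (\val z) = f z.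
Proof.
move=> cZ clZ0 cf.
have nZ : normal_space Z by apply: compact_normal; [exact: cZ.2|exact: cZ.1].
have [C fC] := compact_bnd (compact_set_type (subclosed_compact clZ0 cZ.1
  (@subsetT _ _))) cf.
pose f' (z : Z) : R := if pselect (Z0 z) is left zp
  then f (exist _ z (mem_set zp)) else 0.
have f'E (z : Z0) : f' (\val z) = f z.
  rewrite /f'; case: pselect => [zp|[]]; last exact: set_valP.
  by congr f; exact: val_inj.
have cf' : {within Z0, continuous f'}.
  apply/subspace_sigL_continuousP.
  by have -> : sigL Z0 f' = f by apply/funext => z; exact: f'E.
have C1 : 0 < `|C| + 1 by rewrite ltr_wpDl.
have f'C z : Z0 z -> `|f' z| <= `|C| + 1.
  move=> zp; rewrite (f'E (exist _ z (mem_set zp))).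
  by apply: le_trans (fC _) _; apply: ler_wpDr => //; exact: ler_norm.
have [psi [psiE cpsi _]] := continuous_bounded_extension nZ clZ0 C1 cf' f'C.
by exists psi => // z; rewrite -psiE ?f'E// inE; exact: set_valP.
Qed.

(** Characters separate points from closed subgroups. The mean over the subgroup
    of the translates of a nonnegative function that vanishes on it is an
    invariant function; it differs at [y] and at zero, because the mean of a
    nonzero nonnegative continuous function is positive. *)
Lemma annihilator (H K : topologicalZmodType) (Phi : K -> H) (y : H) :
  compact [set: H] -> hausdorff_space H -> compact [set: K] ->
  {morph Phi : k l / k + l} -> continuous Phi -> ~ range Phi y ->
  exists chi : H -> circle R, [/\ {morph chi : x z / x + z}, continuous chi,
    chi y != 0 & forall k, chi (Phi k) = 0].
Proof.
move=> cH hH cK PhiD cPhi ny.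
have Phi0 : Phi 0 = 0 by apply: (addrI (Phi 0)); rewrite -PhiD !addr0.
have cD : closed (range Phi).
  apply: compact_closed => //; apply: continuous_compact => //.
  exact: continuous_subspaceT.
have cy : closed [set y] by apply: compact_closed => //; exact: compact_set1.
have Dy : range Phi `&` [set y] = set0.
  by apply/seteqP; split => // x [Dx /= xy]; apply: ny; rewrite -xy.
have [phi0 [cphi0 phi00 /(_ y erefl) phi01]] :=
  compactum_urysohn (conj cH hH) cD cy Dy.
have [M [Mc Mge0 Mcst Mtr]] := @invariant_mean R K.
pose phi1 x := phi0 x * phi0 x.
have cphi1 : continuous phi1 by move=> x; apply: cvgM; exact: cphi0.
have bphi1 := compact_bnd cH cphi1.
pose phi x := M (fun k => phi1 (x + Phi k)).
have b1 x : bnd (fun k => phi1 (x + Phi k)) by exact: (bnd_comp (fun k => x + Phi k)).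
have cphi : continuous phi.
  move=> x; apply/cvgrPdist_le => e e0.
  have xx : (fun x' => - x + x') @ x --> (0 : H).
    by have := @addl_cvg H (- x) x; rewrite addNr.
  have : \forall x' \near x, forall z, `|phi1 (z + (- x + x')) - phi1 z| <= e.
    exact: (xx _ (uniformly_continuous cH cphi1 e0)).
  apply: filterS => x' h; rewrite /phi -(MB Mc)//.
  apply: (M_norm_le Mc Mge0 Mcst) => k; rewrite distrC.
  have := h (x + Phi k); rewrite (_ : x + Phi k + (- x + x') = x' + Phi k)//.
  by rewrite addrA (addrC (x + _)) addKr addrC.
have phiy : phi y != phi 0.
  have -> : phi 0 = 0.
    rewrite -[RHS](Mcst 0); congr M; apply/funext => k.
    by rewrite add0r /phi1 phi00 ?mul0r//; exists k.
  apply/eqP => phiy0.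
  pose f k := phi0 (y + Phi k).
  have cf : continuous f.
    move=> k; apply: (@cvg_comp _ _ _ (fun k => y + Phi k) phi0 _ (nbhs (y + Phi k))).
      apply: (@cvg_comp _ _ _ Phi (fun z => y + z) _ (nbhs (Phi k))).
        exact: cPhi.
      exact: addl_cvg.
    exact: cphi0.
  have := almost_periodic_faithful Mc Mge0 Mcst Mtr (continuous_almost_periodic cK cf)
    (compact_bnd cK cf) phiy0 0.
  by rewrite /f Phi0 addr0 phi01 => /eqP; rewrite oner_eq0.
have [chi [chiD cchi chiy chiP]] := compact_character cH cphi phiy.
exists chi; split => // k; apply: chiP => x.
rewrite /phi -[RHS](Mtr _ k (b1 x)); congr M; apply/funext => l.
by rewrite PhiD -addrA (addrC (Phi k)).
Qed.

End Separation.

(** The consequence of either extension property that makes [G] a torus. The class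
    [P] is that of the paths from zero for absolute extensors, and that of the
    one-parameter subgroups for softness; evaluation at time one then lifts maps
    of zero-dimensional compacta, relatively to closed subspaces. *)
Definition path_extension (R : realType) (G : topologicalZmodType)
    (P : (R -> G) -> Prop) :=
  forall Z : topologicalType, compactum Z -> zero_dimensional Z ->
  forall Z0 : set Z, closed Z0 ->
  forall (H0 : Z0 -> R -> G) (h : Z -> G),
    continuous (fun p : Z0 * R => H0 p.1 p.2) ->
    (forall z, P (H0 z)) -> (forall z, H0 z 0 = 0) -> continuous h ->
    (forall z : Z0, H0 z 1 = h (\val z)) ->
  exists H : Z -> R -> G,
    [/\ continuous (fun p : Z * R => H p.1 p.2), forall z, P (H z),
      forall z, H z 0 = 0, forall z, H z 1 = h z
    & forall (z : Z0) t, 0 <= t <= 1 -> H (\val z) t = H0 z t].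

Section PathExtension.
Variables (R : realType) (G : topologicalZmodType).
Hypotheses (cG : compact [set: G]) (hG : hausdorff_space G).
Variable P : (R -> G) -> Prop.
Hypothesis PB : forall p q, P p -> P q -> P (fun t => p t - q t).
Hypothesis Pext : path_extension P.
Local Notation T := (circle R).

Definition characters : set (G -> T) :=
  [set chi : G -> T | {morph chi : x y / x + y} /\ continuous chi].

Lemma characters0 : characters 0.
Proof.
split; last exact: cst_continuous.
by move=> x y; rewrite /0%R/= addr0.
Qed.

Lemma charactersB chi xi : characters chi -> characters xi -> characters (chi - xi).
Proof.
move=> [chiD cchi] [xiD cxi]; split.
  by move=> x y; rewrite -![(chi - xi) _]/(chi _ - xi _) chiD xiD opprD addrACA.
exact: fctB_continuous cchi cxi.
Qed.

Lemma character_comp (X : topologicalType) (chi : G -> T) (F : X -> G) : characters chi ->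
  continuous F -> continuous (fun x => chi (F x)).
Proof.
move=> [_ cchi] cF x; apply: (@cvg_comp _ _ _ F chi _ (nbhs (F x))).
  exact: cF.
exact: cchi.
Qed.

Lemma path_of_family (X : topologicalType) (Y : topologicalType)
    (F : X -> R -> Y) (x : X) :
  continuous (fun p : X * R => F p.1 p.2) -> continuous (F x).
Proof.
move=> cF t; apply: (@cvg_comp _ _ _ (fun t => (x, t)) (fun p => F p.1 p.2) _
  (nbhs (x, t))); last exact: (cF (x, t)).
by apply: (@cvg_pair _ _ _ (nbhs t) (nbhs x) (nbhs t)); [exact: cvg_cst|exact: cvg_id].
Qed.

Lemma winding_sub (u v : R -> T) : continuous u -> continuous v ->
  winding (fun t => u t - v t) = winding u - winding v.
Proof.
move=> cu cv.
have cuv := fctB_continuous cu cv.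
have [k1 f1] := path_fine cu; have [k2 f2] := path_fine cv.
have [k3 f3] := path_fine cuv.
by apply: (@windingB _ (k1 + (k2 + k3))%N); apply: fineW _ _;
  [| exact: f1| |exact: f2| |exact: f3]; lia.
Qed.

Lemma pr_winding_path (u : R -> T) : continuous u ->
  pr (winding u) = u 1 - u 0.
Proof. by move=> /path_fine[k]; exact: pr_winding. Qed.

(** The space [Z0] of ultrafilters maps onto [G] by [q] and carries a lift [S] of
    the doubling of [G]. Paths [H1 z] from zero to [q z] turn a character [chi]
    into a bounded function [l] with [pr (l z) = chi (q z)]. The loops [H2]
    compare [H1 (S z)] with twice [H1 z], so their winding numbers under [chi]
    are [2 * l z - l (S z)]. Extended from [Z0] to the Cantor cube [Z] that
    contains it, these winding numbers are integers, and additive in [chi]. When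
    they all vanish, [l] doubles along [S]; being bounded it is zero, and so is
    [chi]. *)
Lemma character_embedding : exists (J : eqType) (n : (G -> T) -> (J -> bool) -> int),
  [/\ forall chi xi x, characters chi -> characters xi -> n (chi - xi) x = n chi x - n xi x,
    forall chi, characters chi -> exists s, depends s (n chi)
  & forall chi, characters chi -> (forall x, n chi x = 0) -> chi = 0].
Proof.
pose J : eqType := set G; pose Z := {ptws J -> bool}.
pose Z0 : set Z := @ultra_space G.
have cZ : compactum Z by split; [exact: cube_compact|exact: cube_hausdorff].
have zZ : zero_dimensional Z.
  exact: (@zero_dimension_prod (set G) (fun=> bool))
    (fun=> discrete_zero_dimension).
have clZ0 : closed Z0 := @ultra_space_closed G.
have cZ0 : compactum Z0 by exact: closed_compactum.
have zZ0 : zero_dimensional Z0 by exact: zero_dimensional_set_type.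
pose q : Z0 -> G := ultra_limit (conj cG hG).
have cq : continuous q by exact: ultra_limit_continuous.
have [|S [cS qS]] := @ultra_map G (conj cG hG) (fun x => x + x).
  by apply: fctD_continuous => x; exact: cvg_id.
have no (z : (set0 : set Z0)) : False by case: (set_valP z).
have [H1 [cH1 PH1 H10 H11 _]] : exists H : Z0 -> R -> G,
    [/\ continuous (fun p : Z0 * R => H p.1 p.2), forall z, P (H z),
      forall z, H z 0 = 0, forall z, H z 1 = q z
    & forall (z : (set0 : set Z0)) t, 0 <= t <= 1 -> H (\val z) t = 0].
  apply: (Pext cZ0 zZ0 (@closed0 _) (H0 := fun z _ => 0)) => //.
  - by move=> [z t]; case: (no z).
pose H2 (z : Z0) t := H1 z t - (H1 (S z) t - H1 z t).
have cH1S : continuous (fun p : Z0 * R => H1 (S p.1) p.2).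
  move=> p; apply: (@cvg_comp _ _ _ (fun p : Z0 * R => (S p.1, p.2))
    (fun p => H1 p.1 p.2) _ (nbhs (S p.1, p.2))); last exact: (cH1 (_, _)).
  apply: (@cvg_pair _ _ _ (nbhs p) (nbhs (S p.1)) (nbhs p.2)).
    apply: (@cvg_comp _ _ _ fst S _ (nbhs p.1)); first exact: cvg_fst.
    exact: cS.
  exact: cvg_snd.
have cH2 : continuous (fun p : Z0 * R => H2 p.1 p.2).
  exact: fctB_continuous cH1 (fctB_continuous cH1S cH1).
have [H [cH PH H0 H1' HE]] : exists H : Z -> R -> G,
    [/\ continuous (fun p : Z * R => H p.1 p.2), forall z, P (H z),
      forall z, H z 0 = 0, forall z, H z 1 = 0
    & forall (z : Z0) t, 0 <= t <= 1 -> H (\val z) t = H2 z t].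
  apply: (Pext cZ zZ clZ0 cH2).
  - by move=> z; apply: (PB (PH1 _)); exact: (PB (PH1 _) (PH1 _)).
  - by move=> z; rewrite /H2 !H10 !subr0.
  - exact: cst_continuous.
  - by move=> z; rewrite /H2 !H11 /q qS addrK subrr.
pose w (chi : G -> T) (z : Z) := winding (fun t => chi (H z t)).
pose n chi (z : Z) : int := Num.floor (w chi z).
have cw chi : characters chi -> continuous (w chi).
  move=> cc; apply: winding_continuous.
  exact: (character_comp cc cH).
have cpath (X : topologicalType) (F : X -> R -> G) x chi :
    continuous (fun p : X * R => F p.1 p.2) -> characters chi ->
    continuous (fun t => chi (F x t)).
  by move=> cF cc; apply: (character_comp cc); exact: path_of_family.
have wn chi z : characters chi -> w chi z = (n chi z)%:~R.
  move=> cc; have [k kE] : exists k : int, w chi z = k%:~R.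
    apply: pr_eq0; rewrite pr_winding_path; last exact: (cpath Z H z chi cH cc).
    by rewrite H0 H1' subrr.
  by rewrite /n kE intrKfloor.
exists J, n; split.
- move=> chi xi z cc cx; apply: (@intr_inj R).
  rewrite rmorphB/= -!wn//; last exact: charactersB.
  by rewrite /w -(winding_sub (cpath Z H z chi cH cc) (cpath Z H z xi cH cx)).
- move=> chi cc; apply: continuous_depends => z.
  have : \forall z' \near z, `|w chi z - w chi z'| < 1.
    by have /cvgrPdist_lt/(_ _ ltr01) := cw chi cc z.
  apply: filterS => z'.
  rewrite !wn// -intrB -intr_norm ltrz1 => h; lia.
- move=> chi cc n0; pose l (z : Z0) := winding (fun t => chi (H1 z t)).
  have lS z : l (S z) = 2 * l z.
    have : w chi (\val z) = 0 by rewrite wn// n0.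
    have c1 := cpath _ _ z _ cH1 cc; have c2 := cpath _ _ (S z) _ cH1 cc.
    have chiB x y : chi (x - y) = chi x - chi y.
      by apply: (addIr (chi y)); rewrite -cc.1 !subrK.
    have [k fk] := path_fine (cpath Z H (\val z) chi cH cc).
    rewrite /w (winding_eq fk (v := fun t => chi (H1 z t) -
      (chi (H1 (S z) t) - chi (H1 z t)))); last first.
      by move=> t t01; rewrite HE// /H2 !chiB.
    have c21 := fctB_continuous c2 c1.
    rewrite (winding_sub c1 c21) (winding_sub c2 c1) -!/(l _) => /eqP.
    by rewrite subr_eq0 mulr_natl mulr2n => /eqP {2}->; rewrite addrC subrK.
  have [C lC] : bnd l.
    apply: compact_bnd cZ0.1 _; apply: winding_continuous.
    exact: (character_comp cc cH1).
  have l0 z : l z = 0.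
    apply/normr0_eq0/eqP; rewrite eq_le normr_ge0 andbT.
    apply/ler_addgt0Pl => e e0; rewrite addr0.
    have lSn m y : l (iter m S y) = 2 ^+ m * l y.
      by elim: m => [|m IH]; rewrite ?mul1r//= lS IH exprS mulrA.
    have C0 : 0 <= C by apply: le_trans (lC z).
    have d0 : 0 < e / (C + 1) by rewrite divr_gt0// ltr_wpDl.
    have [N _ /(_ N (leqnn N))/= h] := pow2_gt d0.
    have p : 0 < 2 ^+ N :> R by rewrite exprn_gt0.
    have := lC (iter N S z); rewrite lSn normrM (ger0_norm (ltW p)) => h1.
    have C1 : 0 < C + 1 by rewrite ltr_wpDl.
    have h2 : C + 1 < 2 ^+ N * e by rewrite -ltr_pdivrMl// -ltr_pdivlMr.
    rewrite -(ler_pM2l p) (le_trans h1)// (le_trans _ (ltW h2))//.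
    by rewrite lerDl.
  apply/funext => x; have [z <-] := ultra_limit_surj (conj cG hG) x.
  rewrite -/(q z) -[LHS]subr0.
  have chi0 : chi 0 = 0 by apply: (addrI (chi 0)); rewrite -cc.1 !addr0.
  have := pr_winding_path (cpath _ _ z _ cH1 cc).
  by rewrite -/(l z) l0 pr0 H10 H11 chi0 => <-.
Qed.

(** By [character_embedding] the characters of [G] are a subgroup of a free abelian
    group, hence free. Evaluation on a basis is injective, since characters
    separate points. It is onto, since a character of the torus that is trivial
    on the image is a relation between the elements of the basis. *)
Theorem torus_of_path_extension : torus_group R G.
Proof.
have [J [n [nB nfin ninj]]] := character_embedding.
have [|||||good [b [gb gen ind]]] := @free_subgroup (seq J) (G -> T) characters
    (fun chi t => mcoef (n chi) t).
- exact: characters0.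
- exact: charactersB.
- move=> chi xi t cc cx; rewrite -mcoefB; congr mcoef; apply/funext => x.
  exact: nB.
- by move=> chi cc; have [s sP] := nfin chi cc; exact: mcoef_fin sP.
- move=> chi cc c0; apply: (ninj chi cc); have [s sP] := nfin chi cc.
  exact: mcoef_inj sP c0.
pose K : Type := set_type good.
pose Phi (g : G) : torus R K := fun k : K => b (\val k) g.
have bchar (k : K) : characters (b (\val k)) by apply: gb; exact: set_valP.
have PhiD : {morph Phi : x y / x + y}.
  by move=> x y; apply/funext => k; rewrite /Phi (bchar k).1.
have cPhi : continuous Phi.
  by apply: torus_continuous => k; exact: (bchar k).2.
have Phi0 : Phi 0 = 0 by apply: (addrI (Phi 0)); rewrite -PhiD !addr0.
have ker g : Phi g = 0 -> g = 0.
  move=> Phig; apply: contrapT => g0.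
  have [||chi [chiD cchi chig _]] :=
    @annihilator R G G (fun=> 0) g cG hG cG _ (@cst_continuous _ _ _).
  - by move=> x y; rewrite addr0.
  - by move=> [x _ /esym].
  suff : chi g = 0 by move/eqP : chig.
  apply: (gen (fun xi => xi g = 0)) => //.
  - by move=> xi ze; rewrite -[(xi - ze) g]/(xi g - ze g) => -> ->; rewrite subr0.
  - move=> t gt; have := congr1 (fun f : torus R K => f (exist _ t (mem_set gt))) Phig.
    by rewrite /Phi.
have surj y : range Phi y.
  apply: contrapT => ny.
  have [chi [chiD cchi chiy chiP]] := @annihilator R _ _ Phi y (@torus_compact R K)
    (@torus_hausdorff R K) cG PhiD cPhi ny.
  have [s [m [us chiE]]] := torus_character chiD cchi.
  have [k0 k0s mk0] : exists2 k, k \in s & m k != 0.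
    apply: contrapT => nk; move/eqP : chiy; apply; rewrite chiE big1_seq// => k /andP[_ ks].
    have [->|mk] := eqVneq (m k) 0; first by rewrite mulr0z.
    by case: nk; exists k.
  pose v (k : {classic K}) : seq J := \val (k : K).
  have vinj : injective v by exact: val_inj.
  pose mm (t : seq J) : int :=
    if pselect (good t) is left gt then m (exist _ t (mem_set gt) : K) else 0.
  have mmE (k : {classic K}) : mm (v k) = m k.
    rewrite /mm /v; case: pselect => [gt|[]]; last exact: set_valP.
    by congr m; exact: val_inj.
  have uv : uniq [seq v k | k <- s] by rewrite (@map_inj_uniq {classic K} _ v vinj).
  have := ind [seq v k | k <- s] mm uv _ _ (v k0) (map_f v k0s).
  rewrite mmE => h; move/eqP : mk0; apply; apply: h.
    by move=> _ /mapP[k _ ->]; exact: set_valP.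
  rewrite big_map; apply/funext => g; rewrite fct_sumE.
  rewrite -[RHS](chiP g) chiE; apply: eq_bigr => k _.
  by rewrite mulrz_fct mmE.
have /choice[Psi PsiP] : forall y, exists g, Phi g = y.
  by move=> y; have [g _ gy] := surj y; exists g.
have inj : injective Phi.
  move=> x y xy; apply/subr0_eq/ker; apply: (addIr (Phi y)).
  by rewrite -PhiD subrK xy add0r.
have PhiK : cancel Phi Psi by move=> g; apply: inj; rewrite PsiP.
exists K, Phi, Psi; split => //.
exact: (compact_bijection_continuous cG (@torus_hausdorff R K) cPhi PhiK PsiP).
Qed.

End PathExtension.

(** * Both extension properties lift homotopies *)

(** Paths are functions on the whole line; those made on [[0, 1]] are continued by
    constants. *)
Definition clamp (R : realType) (t : R) : R := Num.max 0 (Num.min t 1).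

Section FromAE1.
Variable R : realType.

Lemma clamp_itv (t : R) : @unit_itv R (clamp t).
Proof.
by rewrite /unit_itv /clamp /= in_itv/= le_max lexx ge_max ler01 ge_min lexx orbT.
Qed.

Lemma clamp_id (t : R) : 0 <= t <= 1 -> clamp t = t.
Proof. by move=> /andP[t0 t1]; rewrite /clamp (min_idPl t1) (max_idPr t0). Qed.

Lemma clamp_continuous : continuous (@clamp R).
Proof.
move=> t; apply: (@continuous_max _ _ (cst 0) (fun t : R => Num.min t 1)).
  exact: cst_continuous.
by apply: (@continuous_min _ _ id (cst 1)); [exact: cvg_id|exact: cst_continuous].
Qed.

Definition to_unit (t : R) : unit_interval R :=
  exist _ (clamp t) (mem_set (clamp_itv t)).

Lemma to_unit_continuous : continuous to_unit.
Proof. by apply: continuous_set_type; exact: clamp_continuous. Qed.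

(** The homotopy problem on [Z] is an extension problem on the one-dimensional
    compactum [Z * [0, 1]], with data on the two ends and over [Z0]. *)
Lemma AE1_path_extension (G : topologicalZmodType) : AE1_compactum R G ->
  path_extension (fun p : R -> G => p 0 = 0).
Proof.
move=> [cG AE] Z cZ zZ Z0 clZ0 H0 h cH0 _ H00 ch H01.
pose Y := (Z * unit_interval R)%type.
have cY : compactum Y by exact: (compactum_setX cZ (unit_interval_compactum R)).
have dY : dim_le R 1 Y by exact: zero_dimensional_dim1.
pose A1 : set Y := fst @^-1` Z0.
pose A2 : set Y := [set p | \val p.2 = 0].
pose A3 : set Y := [set p | \val p.2 = 1].
pose f (p : Y) : G := if pselect (Z0 p.1) is left zp
  then H0 (exist _ p.1 (mem_set zp)) (\val p.2)
  else if \val p.2 == 1 then h p.1 else 0.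
have cval2 : continuous (fun p : Y => \val p.2 : R).
  move=> p; apply: (@cvg_comp _ _ _ snd \val _ (nbhs p.2)); first exact: cvg_snd.
  exact: val_continuous.
have cfst : continuous (fst : Y -> Z) by move=> p; exact: cvg_fst.
have clA1 : closed A1.
  by apply: preimage_closed => //; exact: cfst.
have clA2 : closed A2.
  by apply: (@preimage_closed Y R (fun p => \val p.2) [set 0]) => //; exact: closed_eq.
have clA3 : closed A3.
  by apply: (@preimage_closed Y R (fun p => \val p.2) [set 1]) => //; exact: closed_eq.
have cf1 : {within A1, continuous f}.
  apply/subspace_sigL_continuousP.
  pose z0 (a : A1) : Z0 := exist _ (\val a).1 (mem_set (set_valP a)).
  have cz0 : continuous z0.
    apply: continuous_set_type => b.
    apply: (@cvg_comp _ _ _ \val fst _ (nbhs (\val b))); last exact: cfst.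
    exact: val_continuous.
  have -> : sigL A1 f = fun a => H0 (z0 a) (\val (\val a).2).
    apply/funext => a; rewrite /sigL/= /f; case: pselect => [zp|[]].
      by congr (H0 _ _); exact: val_inj.
    exact: (set_valP a).
  move=> a; apply: (@cvg_comp _ _ _ (fun a => (z0 a, \val (\val a).2 : R))
    (fun p => H0 p.1 p.2) _ (nbhs (z0 a, \val (\val a).2 : R))); last exact: (cH0 (_, _)).
  apply: (@cvg_pair _ _ _ (nbhs a) (nbhs _) (nbhs _)).
    exact: cz0.
  apply: (@cvg_comp _ _ _ \val (fun p : Y => \val p.2 : R) _ (nbhs (\val a))).
    exact: val_continuous.
  exact: cval2.
have f0 p : \val p.2 = 0 -> f p = 0.
  move=> p0; rewrite /f p0; case: pselect => [zp|_]; first exact: H00.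
  by rewrite eq_sym oner_eq0.
have f1 p : \val p.2 = 1 -> f p = h p.1.
  move=> p1; rewrite /f p1; case: pselect => [zp|_]; first exact: H01.
  by rewrite eqxx.
have cf2 : {within A2, continuous f}.
  apply/subspace_sigL_continuousP.
  have -> : sigL A2 f = fun=> 0.
    by apply/funext => a; rewrite /sigL/= f0//; exact: (set_valP a).
  exact: cst_continuous.
have cf3 : {within A3, continuous f}.
  apply/subspace_sigL_continuousP.
  have -> : sigL A3 f = fun a => h (\val a).1.
    by apply/funext => a; rewrite /sigL/= f1//; exact: (set_valP a).
  move=> a; apply: (@cvg_comp _ _ _ (fun a : A3 => (\val a).1) h _
    (nbhs (\val a).1)); last exact: ch.
  apply: (@cvg_comp _ _ _ \val fst _ (nbhs (\val a))); last exact: cfst.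
  exact: val_continuous.
have clA : closed (A1 `|` A2 `|` A3) by do ?[apply: closedU].
have cf : {within A1 `|` A2 `|` A3, continuous f}.
  apply: withinU_continuous => //; first exact: closedU.
  exact: withinU_continuous.
have [g cg gE] := AE Y cY dY _ clA (sigL _ f)
  ((subspace_sigL_continuousP _ _).1 cf).
have gf p : (A1 `|` A2 `|` A3) p -> g p = f p.
  by move=> Ap; exact: (gE (exist _ p (mem_set Ap))).
have g0 z : g (z, to_unit 0) = 0.
  have e : clamp (0 : R) = 0 by apply: clamp_id; rewrite lexx ler01.
  by rewrite gf ?f0//=; left; right.
have g1 z : g (z, to_unit 1) = h z.
  have e : clamp (1 : R) = 1 by apply: clamp_id; rewrite lexx ler01.
  by rewrite gf ?f1//=; right.
exists (fun z t => g (z, to_unit t)); split => //.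
- move=> p; apply: (@cvg_comp _ _ _ (fun p : Z * R => (p.1, to_unit p.2)) g _
    (nbhs (p.1, to_unit p.2))); last exact: cg.
  apply: (@cvg_pair _ _ _ (nbhs p) (nbhs p.1) (nbhs _)); first exact: cvg_fst.
  apply: (@cvg_comp _ _ _ snd to_unit _ (nbhs p.2)); first exact: cvg_snd.
  exact: to_unit_continuous.
- move=> z t t01; rewrite gf; last by left; left; exact: set_valP.
  rewrite /f /=; case: pselect => [zp|[]]; last exact: set_valP.
  by rewrite clamp_id//; congr (H0 _ _); exact: val_inj.
Qed.

End FromAE1.

Section OneParameterSubgroups.
Variables (R : realType) (G : topologicalZmodType).

(** Half of the exponential law: over a compact set of times, closeness is uniform
    in the time. *)
Lemma family_continuous (X : topologicalType) (F : X -> R -> G) :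
  continuous (fun p : X * R => F p.1 p.2) ->
  continuous (F : X -> {family compact, R -> group_uniform G}).
Proof.
move=> cF x; have Fx : Filter (nbhs x) by exact: nbhs_filter.
apply/fam_cvgP => K cK W /uniform_nbhs[E [[U nU UE] EW]].
pose P (x' : X) (t : R) := U (F x t - F x' t).
have : \forall x' \near x, forall t, K t -> P x' t.
  apply: (@compact_tube R K X (nbhs x) Fx P cK) => t _.
  pose D (p : R * X) := F x p.1 - F p.2 p.1.
  have cD : continuous D.
    apply: fctB_continuous => p.
      apply: (@cvg_comp _ _ _ (fun p : R * X => (x, p.1)) (fun p => F p.1 p.2) _
        (nbhs (x, p.1))); last exact: (cF (_, _)).
      by apply: (@cvg_pair _ _ _ (nbhs p) (nbhs x) (nbhs p.1)); [exact: cvg_cst|exact: cvg_fst].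
    apply: (@cvg_comp _ _ _ (fun p : R * X => (p.2, p.1)) (fun p => F p.1 p.2) _
      (nbhs (p.2, p.1))); last exact: (cF (_, _)).
    by apply: (@cvg_pair _ _ _ (nbhs p) (nbhs p.2) (nbhs p.1)); [exact: cvg_snd|exact: cvg_fst].
  have := cD (t, x) U; rewrite /D /= subrr => /(_ nU) [[A B] /= [nA nB] AB].
  by exists (A, B).
by apply: filterS => x' h; apply: EW => t Kt; apply: UE; exact: h.
Qed.

(** The other half of the exponential law: the line is locally compact, and
    uniform closeness on [[t - 1, t + 1]] controls the values at times near [t]. *)
Lemma eval_continuous :
  continuous (fun p : L R G * R => (\val p.1 : R -> G) p.2).
Proof.
move=> [f t] W /= nW; have [fD cf] := set_valP f.
pose K : set R := `[t - 1, t + 1]%classic.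
have cK : compact K by exact: segment_compact.
have := @sub_continuous G ((\val f : R -> G) t, 0) W.
rewrite /= subr0 => /(_ nW) [[A B] /= [nA nB] AB].
pose E := [set xy : group_uniform G * group_uniform G | B (xy.1 - xy.2)].
have entE : entourage E by exists B.
have nE := fam_nbhs (\val f : {family compact, R -> group_uniform G}) entE cK.
have ng : \forall g \near f, forall s, K s -> E ((\val f : R -> G) s, (\val g : R -> G) s).
  exact: (val_continuous nE).
have nt : \forall s \near t, K s /\ A ((\val f : R -> G) s).
  apply: filterI; last exact: cf.
  have : nbhs t (ball t 1) by exact: nbhsx_ballx.
  apply: filterS => s; rewrite /ball/= ltr_distlC => /andP[h1 h2].
  by rewrite /K/= in_itv/= !ltW.
exists ([set g | forall s, K s -> E ((\val f : R -> G) s, (\val g : R -> G) s)],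
  [set s | K s /\ A ((\val f : R -> G) s)]) => //.
move=> [g s] [/= h [Ks As]].
have := AB ((\val f : R -> G) s, (\val f : R -> G) s - (\val g : R -> G) s).
by rewrite /= opprB addrCA subrr addr0; apply; split => //; exact: h.
Qed.

Definition one_parameter (p : R -> G) : Prop :=
  {morph p : s t / s + t} /\ continuous p.

Lemma L_of_family (X : topologicalType) (F : X -> R -> G) :
  continuous (fun p : X * R => F p.1 p.2) -> (forall x, one_parameter (F x)) ->
  exists2 f : X -> L R G, continuous f & forall x, (\val (f x) : R -> G) = F x.
Proof.
move=> cF oF; pose A : set {family compact, R -> group_uniform G} :=
  [set f | {morph (f : R -> G) : s t / s + t} /\ continuous (f : R -> G)].
pose f (x : X) : L R G := exist (fun g => g \in A) (F x) (mem_set (oF x : A (F x))).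
exists f => //; apply: (@continuous_set_type _ A X f).
exact: family_continuous.
Qed.

(** By the exponential law the maps to [L R G] are the families of one-parameter
    subgroups, and [expG] is their value at one. The condition of extension of
    real functions holds on a compactum, by Tietze. *)
Lemma zero_soft_path_extension : compact [set: G] -> hausdorff_space G ->
  zero_soft R (@expG R G) -> path_extension one_parameter.
Proof.
move=> cG hG soft Z cZ zZ Z0 clZ0 H0 h cH0 oH0 _ ch H01.
have nZ : normal_space Z by apply: compact_normal; [exact: cZ.2|exact: cZ.1].
have tZ : tychonov Z.
  split; last exact: cZ.2.
  by apply: normal_completely_regular => //; exact/hausdorff_accessible/cZ.2.
have dZ : dim_le R 0 Z by exact: zero_dimensional_dim0.
have [g0 cg0 g0E] := L_of_family cH0 oH0.
have [|phi cphi|g [cg gE gh]] := soft Z tZ dZ Z0 clZ0 g0 h cg0 ch.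
- by move=> z; rewrite /expG g0E H01.
- apply: compactum_tietze => // z.
  apply: (@cvg_comp _ _ _ g0 phi _ (nbhs (g0 z))); first exact: cg0.
  exact: cphi.
exists (fun z => (\val (g z) : R -> G)); split.
- move=> p; have ev := @eval_continuous (g p.1, p.2).
  apply: (@cvg_comp _ _ _ (fun p : Z * R => (g p.1, p.2))
    (fun p : L R G * R => (\val p.1 : R -> G) p.2) _ (nbhs (g p.1, p.2)) _ _ ev).
  apply: (@cvg_pair _ _ _ (nbhs p) (nbhs (g p.1)) (nbhs p.2)); last exact: cvg_snd.
  apply: (@cvg_comp _ _ _ fst g _ (nbhs p.1)); first exact: cvg_fst.
  exact: cg.
- by move=> z; exact: (set_valP (g z)).
- move=> z; have [gD _] := set_valP (g z).
  by apply: (addrI ((\val (g z) : R -> G) 0)); rewrite -gD !addr0.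
- by move=> z; exact: gh.
- by move=> z t _; rewrite gE g0E.
Qed.

End OneParameterSubgroups.

(** * Torus groups have the extension properties *)

Section CircleAE1.
Variable R : realType.
Local Notation T := (circle R).

Lemma pr_comp_continuous (X : topologicalType) (f : X -> R) :
  continuous f -> continuous (fun x => pr (f x) : T).
Proof.
move=> cf x; apply: (@cvg_comp _ _ _ f pr _ (nbhs (f x))); first exact: cf.
exact: pr_continuous.
Qed.

(** A point that is within a third of a turn of both ends of the arc from [p] to
    [p + pr 3^-1] lies on this arc. At an end of the arc, nearness
    to that end is already the conclusion. *)
Lemma arc_third (a p : T) (y : R) : 0 <= y <= 3^-1 ->
  (y < 3^-1 -> `|angle (a - p)| < 3^-1) ->
  (0 < y -> `|angle (a - (p + pr 3^-1))| < 3^-1) ->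
  `|angle (a - (p + pr y))| < 3^-1.
Proof.
move=> /andP[y0 y1] h1 h2.
have [yE|yn] := eqVneq y 0; first by rewrite yE pr0 addr0; apply: h1; rewrite yE; lra.
have [yE|yn'] := eqVneq y 3^-1; first by rewrite yE; apply: h2; rewrite yE; lra.
have {}h1 := h1 _; have {}h2 := h2 _.
have yp : 0 < y by rewrite lt0r yn.
have yl : y < 3^-1 by rewrite lt_neqAle yn'.
move: (h1 yl) (h2 yp); set x := angle (a - p) => x1.
have xE b : a - (p + pr b) = pr (x - b) by rewrite prB angleK opprD addrA.
rewrite !xE => x2; move: x1; rewrite ltr_norml => /andP[x3 x4].
have x0 : 0 < x.
  rewrite ltNge; apply/negP => x0.
  have [xh|xh] := leP (- 2^-1) (x - 3^-1).
    by move: x2; rewrite angle_pr ?ltr_norml; [move=> /andP[]|]; lra.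
  have e : pr (x - 3^-1) = pr (x + (1 - 3^-1)) :> T.
    by apply/pr_eq; exists (-1); rewrite mulrN1z; lra.
  by move: x2; rewrite e angle_pr ?ltr_norml; [move=> /andP[]|]; lra.
apply: le_lt_trans (norm_angle_min _) _; rewrite ltr_norml; lra.
Qed.

Lemma glue_continuous (X Y : topologicalType) (A B : set X) (u : X -> Y) :
  closed A -> closed B -> A `|` B = setT ->
  {within A, continuous u} -> {within B, continuous u} -> continuous u.
Proof.
move=> cA cB AB uA uB; apply/continuous_subspace_setT; rewrite -AB.
exact: withinU_continuous.
Qed.

Lemma within_eq (X Y : topologicalType) (A : set X) (u f : X -> Y) :
  continuous f -> (forall x, A x -> u x = f x) -> {within A, continuous u}.
Proof.
move=> cf uf; apply: (@subspace_eq_continuous _ A _ f).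
  by move=> x /set_mem Ax; exact: esym (uf x Ax).
exact: continuous_subspaceT.
Qed.

(** Three nonnegative functions of which one vanishes at each point are barycentric
    coordinates on the boundary of a triangle, that is on the circle, with the
    vertices at the thirds of a turn. *)
Lemma triangle_map (Z : topologicalType) (l : 'I_3 -> Z -> R) :
  (forall i, continuous (l i)) -> (forall i z, 0 <= l i z) ->
  (forall z, \sum_i l i z > 0) -> (forall z, exists i, l i z = 0) ->
  exists u : Z -> T, continuous u /\ forall (a : T) z,
    (forall i, 0 < l i z -> `|angle (a - pr (i%:R / 3))| < 3^-1) ->
    `|angle (a - u z)| < 3^-1.
Proof.
move=> cl l0 lsum lzero.
pose s z := \sum_i l i z; pose mu i z := l i z / s z.
pose i0 : 'I_3 := @Ordinal 3 0 isT; pose i1 : 'I_3 := @Ordinal 3 1 isT.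
pose i2 : 'I_3 := @Ordinal 3 2 isT.
have sE z : s z = l i0 z + l i1 z + l i2 z.
  rewrite /s !big_ord_recl big_ord0 addr0 addrA.
  by congr (_ + _ + _); congr (l _ z); exact: val_inj.
have cs : continuous s.
  move=> z; apply: (@cvg_big R _ +%R); first exact: add_continuous.
  by move=> i _; exact: cl.
have cmu i : continuous (mu i).
  move=> z; apply: cvgM; first exact: cl.
  by apply: cvgV; [exact: (lt0r_neq0 (lsum z))|exact: cs].
have mu0 i z : 0 <= mu i z by rewrite divr_ge0// ltW// lsum.
have musum z : mu i0 z + mu i1 z + mu i2 z = 1.
  by rewrite /mu -!mulrDl -sE divff// lt0r_neq0// lsum.
have mul0 i z : (mu i z == 0) = (l i z == 0).
  by rewrite mulf_eq0 invr_eq0 [s z == 0]gt_eqF ?orbF// lsum.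
have mul0' i z : 0 < mu i z -> 0 < l i z.
  by move=> h; rewrite lt0r -mul0 gt_eqF// l0.
pose f0 z : T := pr 0 + pr (mu i1 z / 3).
pose f1 z : T := pr 3^-1 + pr (mu i2 z / 3).
pose f2 z : T := pr (2 / 3) + pr (mu i0 z / 3).
have cf (a : R) i : continuous (fun z => pr a + pr (mu i z / 3) : T).
  apply: fctD_continuous; first exact: cst_continuous.
  by apply: pr_comp_continuous => z; apply: cvgMl; exact: cmu.
pose u z : T := if mu i2 z == 0 then f0 z else if mu i0 z == 0 then f1 z else f2 z.
have pr1 : pr 1 = 0 :> T by have := pr_int R 1; rewrite mulr1z.
have u0 z : mu i2 z = 0 -> u z = f0 z by rewrite /u => ->; rewrite eqxx.
have u1 z : mu i0 z = 0 -> u z = f1 z.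
  rewrite /u => m0; rewrite m0 eqxx; case: eqP => // m2.
  have m1 : mu i1 z = 1 by have := musum z; rewrite m0 m2; lra.
  by rewrite /f0 /f1 m1 m2 pr0 add0r mul0r pr0 addr0 mul1r.
have u2 z : mu i1 z = 0 -> u z = f2 z.
  rewrite /u => m1; case: eqP => m2.
    have m0 : mu i0 z = 1 by have := musum z; rewrite m1 m2; lra.
    rewrite /f0 /f2 m0 m1 mul0r pr0 addr0 -prD.
    by rewrite (_ : 2 / 3 + 1 / 3 = 1 :> R) ?pr1//; lra.
  case: eqP => // m0; have m2' : mu i2 z = 1 by have := musum z; rewrite m0 m1; lra.
  rewrite /f1 /f2 m0 m2' mul0r pr0 addr0 -prD; congr pr; lra.
pose C i := [set z | mu i z = 0].
have clC i : closed (C i).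
  apply: (@preimage_closed Z R (mu i) [set 0]); last exact: closed_eq.
  by move=> z _; exact: cmu.
have muzero z : exists i, mu i z = 0.
  by have [i iz] := lzero z; exists i; apply/eqP; rewrite mul0 iz.
have ord3 (i : 'I_3) : [\/ i = i0, i = i1 | i = i2].
  case: (unliftP ord0 i) => [j ->|->]; last by apply: Or31; exact: val_inj.
  case: (unliftP ord0 j) => [k ->|->]; last by apply: Or32; exact: val_inj.
  by rewrite (ord1 k); apply: Or33; exact: val_inj.
exists u; split.
  apply: (@glue_continuous _ _ (C i2 `|` C i0) (C i1)) => //; first exact: closedU.
  - apply/seteqP; split => // z _; have [i iz] := muzero z; move: iz.
    by case: (ord3 i) => ->; [left; right|right|left; left].
  - apply: withinU_continuous => //; first exact: within_eq (cf 0 i1) u0.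
    exact: within_eq (cf 3^-1 i2) u1.
  - exact: within_eq (cf (2 / 3) i0) u2.
move=> a z ha.
have mule i : 0 <= mu i z / 3 <= 3^-1.
  rewrite divr_ge0//= -[leRHS]mul1r ler_pM2r ?invr_gt0//.
  have := musum z; have := mu0 i0 z; have := mu0 i1 z; have := mu0 i2 z.
  by case: (ord3 i) => ->; lra.
have lt3 i : mu i z / 3 < 3^-1 -> mu i z < 1 by lra.
have gt3 i : 0 < mu i z / 3 -> 0 < mu i z by lra.
have := musum z; have := mu0 i0 z; have := mu0 i1 z; have := mu0 i2 z.
move=> m2 m1 m0 m.
have [i iz] := muzero z; case: (ord3 i) iz => -> iz.
- rewrite u1//; apply: arc_third => [//|/lt3 h|/gt3 h].
    by have := ha i1; rewrite mul1r; apply; apply: mul0'; lra.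
  rewrite -prD (_ : 3^-1 + 3^-1 = 2 / 3); last by lra.
  by apply: (ha i2); exact: mul0'.
- rewrite u2//; apply: arc_third => [//|/lt3 h|/gt3 h].
    by apply: (ha i2); apply: mul0'; lra.
  rewrite -prD (_ : 2 / 3 + 3^-1 = 1); last by lra.
  by have := ha i0; rewrite mul0r pr0 pr1; apply; exact: mul0'.
- rewrite u0//; apply: arc_third => [//|/lt3 h|/gt3 h].
    by have := ha i0; rewrite mul0r; apply; apply: mul0'; lra.
  by have := ha i1; rewrite mul1r pr0 add0r; apply; exact: mul0'.
Qed.

(** A partition of unity subordinate to a cover of order one shrinks any cover
    by three functionally open sets to one of empty triple intersection. *)
Lemma dim1_shrink (Z : topologicalType) (U : 'I_3 -> set Z) : dim_le R 1 Z ->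
  (forall i, functionally_open R (U i)) -> (forall z, exists i, U i z) ->
  exists l : 'I_3 -> Z -> R, [/\ forall i, continuous (l i),
    forall i z, 0 <= l i z, forall i z, 0 < l i z -> U i z,
    forall z, \sum_i l i z > 0 & forall z, exists i, l i z = 0].
Proof.
move=> dZ Uo Ucov.
have [|V [[Vfin Vo Vcov] Vref Vord]] := dZ (range U).
  split.
  - exact/finite_image/finite_finset.
  - by move=> _ [i _ <-].
  - by apply/seteqP; split => // z _; have [i iz] := Ucov z; exists (U i) => //; exists i.
have [s sV] := (finite_seqP V).1 Vfin.
have /choice[psi psiP] : forall B, exists psi : Z -> R,
    V B -> continuous psi /\ B = [set z | psi z != 0].
  move=> B; have [VB|nVB] := pselect (V B); last by exists (cst 0).
  by have [psi cpsi BE] := Vo B VB; exists psi.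
have /choice[c cP] : forall B, exists i, V B -> B `<=` U i.
  move=> B; have [VB|nVB] := pselect (V B); last by exists ord0.
  by have [_ [i _ <-] BU] := Vref B VB; exists i.
have Vs B : (B \in s) -> V B by rewrite sV.
pose l i z := \sum_(B <- s | c B == i) `|if `[< V B >] then psi B z else 0|.
have l_ge0 i z : 0 <= l i z by exact: sumr_ge0.
have lpos i z : 0 < l i z -> exists B, [/\ V B, c B = i & B z].
  move=> lz; apply: contrapT => nB; move: lz; rewrite /l big1 ?ltxx// => B /eqP cB.
  case: asboolP => VB; last by rewrite normr0.
  apply/eqP; rewrite normr_eq0; apply/negPn/negP => pz; apply: nB; exists B; split => //.
  by rewrite (psiP B VB).2.
exists l; split => //.
- move=> i z; apply: (@cvg_big R _ +%R); first exact: add_continuous.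
  move=> B _; apply: cvg_norm; case: asboolP => VB; last exact: cvg_cst.
  exact: (psiP B VB).1.
- move=> i z /lpos[B [VB cB Bz]]; rewrite -cB; exact: (cP B VB).
- move=> z; have : [set: Z] z by [].
  rewrite -Vcov => -[B VB Bz]; apply: (@lt_le_trans _ _ (l (c B) z)); last first.
    by rewrite (bigD1 (c B))//= lerDl sumr_ge0.
  have sB : B \in s by have := VB; rewrite sV.
  rewrite /l (big_rem B)//= eqxx asboolT// ltr_wpDr ?sumr_ge0// normr_gt0.
  by move: Bz; rewrite {1}(psiP B VB).2.
- move=> z; apply: contrapT => /forallNP nz.
  have lz i : 0 < l i z by rewrite lt0r l_ge0 andbT; apply/eqP/nz.
  have /choice[B BP] : forall i, exists B, [/\ V B, c B = i & B z].
    by move=> i; exact: lpos.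
  have : (\bigcap_(i in [set: 'I_3]) B i) z by move=> i _; have [] := BP i.
  rewrite Vord//; last by move=> i; have [] := BP i.
  by move=> i j ij; have [_ <- _] := BP i; have [_ <- _] := BP j; rewrite ij.
Qed.

(** The open arcs of a third of a turn around the vertices of a triangle cover the
    circle; [U i] extends their preimages to a cover of [Z]. As [dim Z <= 1], the
    cover shrinks to one without triple intersection, which gives a map [u] to
    the circle. On [Z0] it is within a third of a turn of [g0]; so [g0 - u] has a
    continuous angle there, which Tietze extends. *)
Theorem circle_AE1 (Z : topologicalType) (Z0 : set Z) (g0 : Z0 -> T) :
  compactum Z -> dim_le R 1 Z -> closed Z0 -> continuous g0 ->
  exists2 g : Z -> T, continuous g & forall z : Z0, g (\val z) = g0 z.
Proof.
move=> cZ dZ clZ0 cg0.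
pose d (i : 'I_3) (z : Z0) := Num.max 0 (3^-1 - `|angle (g0 z - pr (i%:R / 3))|).
have cd i : continuous (d i).
  move=> z; apply: (@continuous_max _ _ (cst 0)
    (fun z : Z0 => 3^-1 - `|angle (g0 z - pr (i%:R / 3))|)).
    exact: cst_continuous.
  apply: (@cvgB _ _ _ (nbhs z)); first exact: cvg_cst.
  have c1 := fctB_continuous cg0 (@cst_continuous Z0 T (pr (i%:R / 3))).
  apply: (@cvg_comp _ _ _ (fun z => g0 z - pr (i%:R / 3)) (fun a : T => `|angle a|)
    _ (nbhs (g0 z - pr (i%:R / 3)))); first exact: c1.
  exact: norm_angle_continuous.
have /choice[phi phiP] : forall i, exists phi : Z -> R, continuous phi /\
    forall z : Z0, phi (\val z) = d i z.
  by move=> i; have [phi cphi phiE] := compactum_tietze cZ clZ0 (cd i); exists phi.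
have dP i z : d i z != 0 -> `|angle (g0 z - pr (i%:R / 3))| < 3^-1.
  move=> dz; rewrite ltNge; apply/negP => h; move/eqP : dz; apply.
  by apply/max_idPl; rewrite subr_le0.
have dcov (z : Z0) : exists i, d i z != 0.
  suff [i hi] : exists i : 'I_3, `|angle (g0 z - pr (i%:R / 3))| < 3^-1.
    by exists i; rewrite gt_eqF// /d lt_max subr_gt0 hi orbT.
  have gE : g0 z = pr (angle (g0 z)) by rewrite angleK.
  have /andP[x1 x2] := angle_itv (g0 z); rewrite gE; move: (angle (g0 z)) x1 x2 => x x1 x2.
  have [xa|xa] := ltP x (- 4^-1).
    exists (@Ordinal 3 2 isT); rewrite -prB.
    have -> : pr (x - 2%:R / 3) = pr (x + 1 / 3) :> T.
      by apply/pr_eq; exists (-1); rewrite mulrN1z; lra.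
    apply: le_lt_trans (norm_angle_min _) _; rewrite ltr_norml; lra.
  have [xb|xb] := ltP x 4^-1.
    exists (@Ordinal 3 0 isT); rewrite mul0r -prB subr0.
    apply: le_lt_trans (norm_angle_min _) _; rewrite ltr_norml; lra.
  exists (@Ordinal 3 1 isT); rewrite -prB.
  apply: le_lt_trans (norm_angle_min _) _; rewrite /= ltr_norml; lra.
pose D := \bigcap_(i in [set: 'I_3]) [set z | phi i z = 0].
have clD : closed D.
  apply: closed_bigI => i _.
  apply: (@preimage_closed Z R (phi i) [set 0]); last exact: closed_eq.
  by move=> z _; exact: (phiP i).1.
have Z0D : Z0 `&` D = set0.
  apply/seteqP; split => // z [zp Dz].
  have [i /eqP] := dcov (exist _ z (mem_set zp)); apply.
  by rewrite -(phiP i).2; exact: Dz.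
have [eta [ceta eta0 eta1]] := compactum_urysohn R cZ clZ0 clD Z0D.
pose U i := [set z | phi i z ^+ 2 + eta z ^+ 2 != 0].
have Uo i : functionally_open R (U i).
  exists (fun z => phi i z ^+ 2 + eta z ^+ 2) => //.
  move=> z; apply: cvgD; rewrite /GRing.exp/=.
    by apply: cvgM; exact: (phiP i).1.
  by apply: cvgM; exact: ceta.
have Ucov z : exists i, U i z.
  have [Dz|nD] := pselect (D z).
    by exists ord0; rewrite /U/= eta1// (Dz ord0)// expr0n expr1n add0r oner_eq0.
  have [i iz] : exists i, phi i z != 0.
    by apply: contrapT => /forallNP h; apply: nD => i _; apply/eqP/negPn/negP/h.
  by exists i; rewrite /U/= paddr_eq0 ?sqr_ge0// sqrf_eq0 (negPf iz).
have [l [cl l0 lU lsum lzero]] := dim1_shrink dZ Uo Ucov.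
have [u [cu uP]] := triangle_map cl l0 lsum lzero.
have near (z : Z0) : `|angle (g0 z - u (\val z))| < 3^-1.
  apply: uP => i /lU; rewrite /U /= (phiP i).2 (eta0 _ (set_valP z)).
  by rewrite expr0n addr0 sqrf_eq0; exact: dP.
have cuv : continuous (fun z : Z0 => u (\val z)).
  move=> z; apply: (@cvg_comp _ _ _ \val u _ (nbhs (\val z))); last exact: cu.
  exact: val_continuous.
have cth : continuous (fun z : Z0 => angle (g0 z - u (\val z))).
  move=> z; apply: (@cvg_comp _ _ _ (fun z => g0 z - u (\val z)) angle _
    (nbhs (g0 z - u (\val z)))); first exact: (fctB_continuous cg0 cuv).
  by apply: angle_continuous; apply: lt_trans (near z) _; lra.
have [th cth' thE] := compactum_tietze cZ clZ0 cth.
exists (fun z => u z + pr (th z)).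
  exact: fctD_continuous cu (pr_comp_continuous cth').
by move=> z; rewrite thE angleK subrKC.
Qed.

Theorem torus_AE1 (G : topologicalZmodType) : compact [set: G] ->
  hausdorff_space G -> torus_group R G -> AE1_compactum R G.
Proof.
move=> cG hG [K [f [g [fD fK gK cf cg]]]]; split => // Z cZ dZ Z0 clZ0 g0 cg0.
have /choice[h hP] : forall k, exists h : Z -> T, continuous h /\
    forall z : Z0, h (\val z) = f (g0 z) k.
  move=> k; have [|h ch hE] := @circle_AE1 Z Z0 (fun z => f (g0 z) k) cZ dZ clZ0.
    move=> z; apply: (@cvg_comp _ _ _ (fun z => f (g0 z)) (fun x => x k) _
      (nbhs (f (g0 z)))); last exact: torus_proj_continuous.
    apply: (@cvg_comp _ _ _ g0 f _ (nbhs (g0 z))); first exact: cg0.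
    exact: cf.
  by exists h.
exists (fun z => g (fun k => h k z)).
  move=> z; apply: (@cvg_comp _ _ _ (fun z => (fun k => h k z) : torus R K) g _
    (nbhs ((fun k => h k z) : torus R K))); last exact: cg.
  by apply: torus_continuous => k; exact: (hP k).1.
move=> z; rewrite -[RHS]fK; congr g; apply/funext => k.
exact: (hP k).2.
Qed.

End CircleAE1.

Section TorusSoft.
Variable R : realType.
Local Notation T := (circle R).

(** In a disjoint refinement, the members that lie in [U1] and the others have
    complementary unions, and both unions are open. *)
Lemma dim0_clopen (Z : topologicalType) (U1 U2 : set Z) : dim_le R 0 Z ->
  functionally_open R U1 -> functionally_open R U2 -> U1 `|` U2 = setT ->
  exists C, [/\ clopen C, C `<=` U1 & ~` C `<=` U2].
Proof.
move=> dZ Uo1 Uo2 U12.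
have [|V [[Vfin Vo Vcov] Vref Vord]] := dZ [set U1; U2].
  split.
  - by rewrite finite_setU; split; exact: finite_set1.
  - by move=> _ [->|->].
  - apply/seteqP; split => // z _; have : (U1 `|` U2) z by rewrite U12.
    by move=> [zU|zU]; [exists U1 => //; left|exists U2 => //; right].
have disj A B z : V A -> V B -> A z -> B z -> A = B.
  move=> VA VB Az Bz; apply: contrapT => AB.
  pose F (i : 'I_2) := if i == ord0 then A else B.
  suff : (\bigcap_(i in [set: 'I_2]) F i) z.
    rewrite Vord//; last by move=> i; rewrite /F; case: ifP.
    move=> i j; rewrite /F; have i2 (k : 'I_2) : k != ord0 -> k = ord_max.
      by case: k => [[|[|m]]] km // _; exact: val_inj.
    case: eqVneq => [->|/i2 ->]; case: eqVneq => [->|/i2 ->] //.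
    by move=> /esym.
  by move=> i _; rewrite /F; case: ifP.
pose C := \bigcup_(A in V `&` [set A | A `<=` U1]) A.
pose C' := \bigcup_(A in V `&` [set A | ~ A `<=` U1]) A.
have oC : open C.
  by apply: bigcup_open => A [VA _]; exact: functionally_open_open (Vo A VA).
have oC' : open C'.
  by apply: bigcup_open => A [VA _]; exact: functionally_open_open (Vo A VA).
have CC' : C = ~` C'.
  apply/seteqP; split => z.
    move=> [A [VA AU] Az] [B [VB BU] Bz]; apply: BU.
    by rewrite -(disj A B z).
  move=> nz; have : [set: Z] z by [].
  rewrite -Vcov => -[A VA Az]; exists A => //; split => //=.
  by apply: contrapT => AU; apply: nz; exists A.
exists C; split.
- by split => //; rewrite CC'; exact: open_closedC.
- by move=> z [A [_ AU] Az]; exact: AU.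
- rewrite CC' setCK => z [A [VA AU] Az].
  by have [B [->|->] AB] := Vref A VA; [case: (AU AB)|exact: AB].
Qed.

(** There are two local logarithms, one continuous away from the half turn and one
    away from zero; a clopen set separates their domains. The first one is used
    wherever the map vanishes, and there it vanishes. *)
Lemma dim0_log (Z : topologicalType) (d : Z -> T) : dim_le R 0 Z ->
  continuous d -> exists f : Z -> R, [/\ continuous f, forall z, pr (f z) = d z
    & forall z, d z = 0 -> f z = 0].
Proof.
move=> dZ cd.
have cn : continuous (fun z => `|angle (d z)|).
  move=> z; apply: (@cvg_comp _ _ _ d (fun a : T => `|angle a|) _ (nbhs (d z))).
    exact: cd.
  exact: norm_angle_continuous.
pose U1 := [set z | Num.max 0 (4^-1 - `|angle (d z)|) != 0].
pose U2 := [set z | `|angle (d z)| != 0].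
have U1P z : U1 z -> `|angle (d z)| < 4^-1.
  move=> /eqP h; rewrite ltNge; apply/negP => h'; apply: h.
  by apply/max_idPl; rewrite subr_le0.
have Uo1 : functionally_open R U1.
  exists (fun z => Num.max 0 (4^-1 - `|angle (d z)|)) => // z.
  apply: (@continuous_max _ _ (cst 0) (fun z => 4^-1 - `|angle (d z)|)).
    exact: cst_continuous.
  by apply: (@cvgB _ _ _ (nbhs z)); [exact: cvg_cst|exact: cn].
have Uo2 : functionally_open R U2 by exists (fun z => `|angle (d z)|).
have U12 : U1 `|` U2 = setT.
  apply/seteqP; split => // z _.
  have [dz|dz] := eqVneq (`|angle (d z)|) 0; [left|by right].
  by rewrite /U1/= dz subr0 gt_eqF// lt_max invr_gt0 ltr0n orbT.
have [C [clC CU1 CU2]] := dim0_clopen dZ Uo1 Uo2 U12.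
pose half : T := pr 2^-1.
exists (fun z => if `[< C z >] then angle (d z) else angle (d z - half) + 2^-1); split.
- apply: clopen_if_continuous => // z Cz.
    apply: (@cvg_comp _ _ _ d angle _ (nbhs (d z))); first exact: cd.
    by apply: angle_continuous; apply: lt_trans (U1P z (CU1 z Cz)) _; lra.
  have dz : `|angle (d z)| != 0 := CU2 z Cz.
  apply: (@cvgD _ _ _ (nbhs z)); last exact: cvg_cst.
  apply: (@cvg_comp _ _ _ (fun z => d z - half) angle _ (nbhs (d z - half))).
    exact: (fctB_continuous cd (@cst_continuous Z T half)).
  apply: angle_continuous; rewrite lt_neqAle norm_angle_le andbT.
  apply: contra dz => /eqP h; rewrite normr_eq0; apply/eqP.
  have -> : d z = 0; last exact: angle0.
  apply: (addIr (- half)); rewrite add0r -[LHS]angleK.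
  have [->|->] : angle (d z - half) = 2^-1 \/ angle (d z - half) = - 2^-1.
  - have [p|p] := leP 0 (angle (d z - half)); first by left; rewrite -h ger0_norm.
    by right; rewrite -h ltr0_norm// opprK.
  - by rewrite /half -prN; apply/pr_eq; exists 1; rewrite opprK mulr1z; lra.
  - by rewrite prN.
- by move=> z; case: asboolP => _; [exact: angleK|rewrite prD angleK subrK].
- move=> z dz; have Cz : C z.
    apply: contrapT => /CU2; rewrite /U2/= dz angle0 normr0 eqxx; exact: Bool.diff_false_true.
  by rewrite asboolT// dz angle0.
Qed.

(** A one-parameter subgroup of a torus is given by the slopes of its coordinates,
    and [expG] reduces the slopes modulo one. The slopes of [g0] are real
    functions, so they extend to [Z]; by [dim0_log] the extension can be corrected
    by a function that vanishes on [Z0], so as to lift [h]. *)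
Theorem torus_zero_soft (G : topologicalZmodType) :
  torus_group R G -> zero_soft R (@expG R G).
Proof.
move=> [K [f [fi [fD fK fiK cf cfi]]]] Z tZ dZ Z0 clZ0 g0 h cg0 ch g0h gext.
pose chi k (x : G) : T := f x k.
have cchi k : continuous (chi k).
  move=> x; apply: (@cvg_comp _ _ _ f (fun y : torus R K => y k) _ (nbhs (f x))).
    exact: cf.
  exact: (@torus_proj_continuous R K k (f x)).
have chiD k : {morph chi k : x y / x + y} by move=> x y; rewrite /chi fD.
pose slope k (p : L R G) : R := winding (fun t => chi k ((\val p : R -> G) t)).
have cslope k : continuous (slope k).
  apply: winding_continuous => p.
  apply: (@cvg_comp _ _ _ (fun p : L R G * R => (\val p.1 : R -> G) p.2) (chi k)
    _ (nbhs ((\val p.1 : R -> G) p.2))); last exact: cchi.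
  exact: (@eval_continuous R G p).
have slopeP k (p : L R G) t : chi k ((\val p : R -> G) t) = pr (t * slope k p).
  have [pD cp] := set_valP p.
  apply: (@hom_winding R (fun t => chi k ((\val p : R -> G) t))).
    move=> s; apply: (@cvg_comp _ _ _ (\val p : R -> G) (chi k) _
      (nbhs ((\val p : R -> G) s))); last exact: cchi.
    exact: cp.
  by move=> s s'; rewrite pD chiD.
have /choice[psi psiP] : forall k, exists psi : Z -> R, continuous psi /\
    forall z : Z0, psi (\val z) = slope k (g0 z).
  by move=> k; have [psi cpsi psiE] := gext (slope k) (cslope k); exists psi.
have cchih k : continuous (fun z => chi k (h z)).
  move=> z; apply: (@cvg_comp _ _ _ h (chi k) _ (nbhs (h z))); first exact: ch.
  exact: cchi.
have /choice[l lP] : forall k, exists l : Z -> R, [/\ continuous l,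
    forall z, pr (l z) = chi k (h z) - pr (psi k z)
    & forall z : Z0, l (\val z) = 0].
  move=> k; have [|l [cl lE l0]] := @dim0_log Z (fun z => chi k (h z) - pr (psi k z)) dZ.
    exact: (fctB_continuous (cchih k) (pr_comp_continuous (psiP k).1)).
  exists l; split => // z; apply: l0.
  by rewrite -g0h /expG slopeP mul1r (psiP k).2 subrr.
pose s k z := psi k z + l k z.
have cs k : continuous (s k).
  by move=> z; apply: cvgD; [exact: (psiP k).1|have [+ _ _] := lP k; exact].
have prs k z : pr (s k z) = chi k (h z).
  by rewrite prD; have [_ -> _] := lP k; rewrite subrKC.
have s0 k (z : Z0) : s k (\val z) = slope k (g0 z).
  by rewrite /s (psiP k).2; have [_ _ ->] := lP k; rewrite addr0.
pose F z t : torus R K := fun k => pr (t * s k z).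
have fiD : {morph fi : x y / x + y} by move=> x y; rewrite -{1}(fiK x) -{1}(fiK y) -fD fK.
have FD z : {morph F z : t t' / t + t'}.
  by move=> t t'; apply/funext => k; rewrite /F mulrDl prD.
have cFt : continuous (fun p : Z * R => F p.1 p.2).
  apply: torus_continuous => k; apply: pr_comp_continuous => p.
  apply: cvgM; first exact: cvg_snd.
  by apply: (@cvg_comp _ _ _ fst (s k) _ (nbhs p.1)); [exact: cvg_fst|exact: cs].
have cF : continuous (fun p : Z * R => fi (F p.1 p.2)).
  move=> p; apply: (@cvg_comp _ _ _ (fun p : Z * R => F p.1 p.2) fi _
    (nbhs (F p.1 p.2))); last exact: cfi.
  exact: cFt.
have oF z : one_parameter (fun t => fi (F z t)).
  split; first by move=> t t'; rewrite FD fiD.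
  exact: (@path_of_family _ _ _ (fun z t => fi (F z t)) z cF).
have [g cg gE] := L_of_family cF oF.
exists g; split => //.
- move=> z; apply: val_inj; rewrite gE; apply/funext => t.
  rewrite -[RHS]fK; congr fi; apply/funext => k.
  by rewrite /F s0 -slopeP.
- move=> z; rewrite /expG gE -[RHS]fK; congr fi; apply/funext => k.
  by rewrite /F mul1r prs.
Qed.

End TorusSoft.

Theorem theoremE (R : realType) (G : topologicalZmodType)
    (cG : compact [set: G]) (hG : hausdorff_space G) :
  (torus_group R G <-> AE1_compactum R G) /\
  (AE1_compactum R G <-> zero_soft R (@expG R G)).
Proof.
have ab : torus_group R G -> AE1_compactum R G := torus_AE1 cG hG.
have ba : AE1_compactum R G -> torus_group R G.
  move=> /AE1_path_extension; apply: torus_of_path_extension => // p q p0 q0.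
  by rewrite p0 q0 subrr.
have ac : torus_group R G -> zero_soft R (@expG R G) := @torus_zero_soft R G.
have ca : zero_soft R (@expG R G) -> torus_group R G.
  move=> /(zero_soft_path_extension cG hG).
  apply: torus_of_path_extension => // p q [pD cp] [qD cq]; split.
    by move=> s t; rewrite pD qD opprD addrACA.
  exact: fctB_continuous.
by split; split; [exact: ab|exact: ba|move=> /ba/ac|move=> /ca/ab].
Qed.
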